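(* Let $A$, $B$ be rings, ${}_AV_B$ and ${}_BU_A$ bimodules with $U\otimes_A V=0=V\otimes_B U$, and let $\Lambda_{(0,0)}=\begin{pmatrix} A & V \\ U & B \end{pmatrix}$ be the Morita context ring with both bimodule homomorphisms zero. Let $(X,Y,f,g)$ be a $\Lambda_{(0,0)}$-module and $[W,N,s,t]$ a $\Lambda_{(0,0)}^{\mathrm{op}}$-module. (1) Suppose that $\mathrm{Tor}^B_{j}(V,U\otimes_A F_1)=0=\mathrm{Tor}^A_{j}(U,V\otimes_B F_2)$ for all $j\ge1$, all flat $A$-modules $F_1$ and all flat $B$-modules $F_2$. If $\mathrm{fd}_B U<\infty$, $\mathrm{fd}_{A^{\mathrm{op}}}U<\infty$, $\mathrm{fd}_A V<\infty$ and $\mathrm{fd}_{B^{\mathrm{op}}}V<\infty$, then $(X,Y,f,g)\in\mathsf{DP}(\Lambda_{(0,0)})$ if and only if both $f$ and $g$ are monomorphisms, $\mathrm{coker}(f)\in\mathsf{DP}(B)$ and $\mathrm{coker}(g)\in\mathsf{DP}(A)$. (2) Let $\Lambda_{(0,0)}$ be a right coherent ring and let $U_A$ and $V_B$ be finitely generated. If $\mathrm{Ext}^{j}_{A^{\mathrm{op}}}(U,\mathrm{Hom}_{B^{\mathrm{op}}}(V,E_2))=0=\mathrm{Ext}^{j}_{B^{\mathrm{op}}}(V,\mathrm{Hom}_{A^{\mathrm{op}}}(U,E_1))$ for all $j\ge1$, all $FP$-injective $A^{\mathrm{op}}$-modules $E_1$ and all $FP$-injective $B^{\mathrm{op}}$-modules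 $E_2$, $\mathrm{fd}_B U<\infty$, $\mathrm{fd}_A V<\infty$, $\mathrm{pd}_{A^{\mathrm{op}}}U<\infty$ and $\mathrm{pd}_{B^{\mathrm{op}}}V<\infty$, then $[W,N,s,t]\in\mathsf{DI}(\Lambda_{(0,0)}^{\mathrm{op}})$ if and only if both $s$ and $t$ are epimorphisms, $\ker(s)\in\mathsf{DI}(B^{\mathrm{op}})$ and $\ker(t)\in\mathsf{DI}(A^{\mathrm{op}})$.
   Context: Rings are nonzero, associative and unital. ''Module'' means left module; right $R$-modules are viewed as $R^{\mathrm{op}}$-modules. $\mathrm{fd}$, $\mathrm{pd}$ denote flat and projective dimension. $\Lambda_{(0,0)}$ is the ring of matrices $\begin{pmatrix} a & v \\ u & b \end{pmatrix}$ ($a\in A$, $b\in B$, $u\in U$, $v\in V$) with the usual matrix operations, where all products of an element of $U$ with an element of $V$ (in either order) are zero. A $\Lambda_{(0,0)}$-module is identified with a quadruple $(X,Y,f,g)$ with $X$ an $A$-module, $Y$ a $B$-module, $f\in\mathrm{Hom}_B(U\otimes_A X,Y)$ and $g\in\mathrm{Hom}_A(V\otimes_B Y,X)$. A $\Lambda_{(0,0)}^{\mathrm{op}}$-module is identified with a quadruple $[W,N,s,t]$ with $W$ an $A^{\mathrm{op}}$-module, $N$ a $B^{\mathrm{op}}$-module, $s\in\mathrm{Hom}_{B^{\mathrm{op}}}(N,\mathrm{Hom}_{A^{\mathrm{op}}}(U,W))$ and $t\in\mathrm{Hom}_{A^{\mathrm{op}}}(W,\mathrm{Hom}_{B^{\mathrm{op}}}(V,N))$.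 (Because $U\otimes_AV=0=V\otimes_BU$, no further compatibility conditions on these maps arise.) For a ring $S$: $\mathsf{DP}(S)$ is the class of Ding projective $S$-modules, i.e. modules isomorphic to $\mathrm{Im}(P^{-1}\to P^0)$ for an exact complex $P^\bullet$ of projective $S$-modules with $\mathrm{Hom}_S(P^\bullet,F)$ exact for every flat $S$-module $F$. An $S^{\mathrm{op}}$-module $B'$ is $FP$-injective if $\mathrm{Ext}^1_{S^{\mathrm{op}}}(L,B')=0$ for every finitely presented $S^{\mathrm{op}}$-module $L$. $\mathsf{DI}(S^{\mathrm{op}})$ is the class of Ding injective $S^{\mathrm{op}}$-modules, i.e. modules isomorphic to $\ker(I^0\to I^1)$ for an exact complex $I^\bullet$ of injective $S^{\mathrm{op}}$-modules with $\mathrm{Hom}_{S^{\mathrm{op}}}(E,I^\bullet)$ exact for every $FP$-injective $S^{\mathrm{op}}$-module $E$. *)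

(* Defs.v *)
From HB Require Import structures.
From mathcomp Require Import all_boot all_order all_algebra.
From mathcomp Require Import boolp.

Set Implicit Arguments.
Unset Strict Implicit.
Unset Printing Implicit Defensive.

Import GRing.Theory.
Local Open Scope ring_scope.
Local Open Scope quotient_scope.

(* Rings are [nzRingType] (nonzero, associative, unital). A left R-module is
   an [lmodType R]; a right R-module is an R^op-module, i.e. an
   [lmodType R^c], with [(r : R^c) *: m] standing for m r. *)

Section KerImCoker.
Variables (R : nzRingType) (M N : lmodType R) (f : {linear M -> N}).

Definition in_ker : pred M := [pred x | f x == 0].
Definition in_im : pred N := [pred y | `[< exists x, f x = y >]].

Lemma in_im_submod : subsemimod_closed in_im.
Proof.
split; first split.
- by apply/asboolP; exists 0; rewrite linear0.
- move=> _ _ /asboolP[x <-] /asboolP[y <-].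
  by apply/asboolP; exists (x + y); rewrite linearD.
- by move=> a _ /asboolP[x <-]; apply/asboolP; exists (a *: x); rewrite linearZ.
Qed.

Lemma in_ker_submod : subsemimod_closed in_ker.
Proof.
split; first split.
- by rewrite inE linear0.
- by move=> x y; rewrite !inE linearD => /eqP-> /eqP->; rewrite addr0.
- by move=> a x; rewrite !inE linearZ => /eqP->; rewrite /= scaler0.
Qed.

Record mker := Mker { mker_val :> M; mkerP : in_ker mker_val }.
HB.instance Definition _ := [isSub for mker_val].
HB.instance Definition _ := [Choice of mker by <:].
HB.instance Definition _ :=
  GRing.SubChoice_isSubLmodule.Build R M in_ker mker in_ker_submod.

Record mim := Mim { mim_val :> N; mimP : in_im mim_val }.
HB.instance Definition _ := [isSub for mim_val].
HB.instance Definition _ := [Choice of mim by <:].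
HB.instance Definition _ :=
  GRing.SubChoice_isSubLmodule.Build R N in_im mim in_im_submod.

Definition coker_rel : rel N := fun x y => in_im (x - y).

Lemma coker_relP x y : reflect (exists m, f m = x - y) (coker_rel x y).
Proof. exact: asboolP. Qed.

Lemma coker_equiv : equiv_class_of coker_rel.
Proof.
split=> [x|x y|y x z].
- by apply/coker_relP; exists 0; rewrite linear0 subrr.
- by apply/coker_relP/coker_relP => -[m fm]; exists (- m);
    rewrite linearN fm opprB.
- move=> /coker_relP[m fm] /coker_relP[m' fm'].
  by apply/coker_relP; exists (m + m'); rewrite linearD fm fm' addrA subrK.
Qed.

Definition coker_eq : equiv_rel N := EquivRelPack coker_equiv.
Definition mcoker := {eq_quot coker_eq}.
HB.instance Definition _ : EqQuotient _ coker_eq mcoker := EqQuotient.on mcoker.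
HB.instance Definition _ := Choice.on mcoker.

Definition mcoker_pi (x : N) : mcoker := \pi_mcoker x.

Lemma mcokerW (P : mcoker -> Type) :
  (forall x, P (mcoker_pi x)) -> forall x, P x.
Proof. exact: quotW. Qed.

Lemma mcoker_eqP x y : (exists m, f m = x - y) <-> mcoker_pi x = mcoker_pi y.
Proof.
split=> [/coker_relP xy|/eqmodP xy]; first exact/eqmodP.
exact/coker_relP.
Qed.

Lemma mcoker_repr x : exists m, f m = repr (mcoker_pi x) - x.
Proof. by apply/mcoker_eqP; rewrite /mcoker_pi reprK. Qed.

Definition mcoker_add (x y : mcoker) := mcoker_pi (repr x + repr y).
Definition mcoker_opp (x : mcoker) := mcoker_pi (- repr x).
Definition mcoker_scale (a : R) (x : mcoker) := mcoker_pi (a *: repr x).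

Lemma mcoker_addE x y :
  mcoker_add (mcoker_pi x) (mcoker_pi y) = mcoker_pi (x + y).
Proof.
have [m fm] := mcoker_repr x; have [n fn] := mcoker_repr y.
by apply/mcoker_eqP; exists (m + n); rewrite linearD fm fn opprD addrACA.
Qed.

Lemma mcoker_oppE x : mcoker_opp (mcoker_pi x) = mcoker_pi (- x).
Proof.
have [m fm] := mcoker_repr x.
by apply/mcoker_eqP; exists (- m); rewrite linearN fm opprD.
Qed.

Lemma mcoker_scaleE a x :
  mcoker_scale a (mcoker_pi x) = mcoker_pi (a *: x).
Proof.
have [m fm] := mcoker_repr x.
by apply/mcoker_eqP; exists (a *: m); rewrite linearZ fm /= scalerBr.
Qed.

Local Opaque mcoker_add mcoker_opp mcoker_scale.
Fact mcoker_addA : associative mcoker_add.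
Proof.
by elim/mcokerW=> x; elim/mcokerW=> y; elim/mcokerW=> z; rewrite !mcoker_addE addrA.
Qed.
Fact mcoker_addC : commutative mcoker_add.
Proof. by elim/mcokerW=> x; elim/mcokerW=> y; rewrite !mcoker_addE addrC. Qed.
Fact mcoker_add0 : left_id (mcoker_pi 0) mcoker_add.
Proof. by elim/mcokerW=> x; rewrite mcoker_addE add0r. Qed.
Fact mcoker_addN : left_inverse (mcoker_pi 0) mcoker_opp mcoker_add.
Proof. by elim/mcokerW=> x; rewrite mcoker_oppE mcoker_addE addNr. Qed.
HB.instance Definition _ := GRing.isZmodule.Build mcoker
  mcoker_addA mcoker_addC mcoker_add0 mcoker_addN.

Fact mcoker_scaleA a b x :
  mcoker_scale a (mcoker_scale b x) = mcoker_scale (a * b) x.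
Proof. by elim/mcokerW: x => x; rewrite !mcoker_scaleE scalerA. Qed.
Fact mcoker_scale1 : left_id 1 mcoker_scale.
Proof. by elim/mcokerW=> x; rewrite mcoker_scaleE scale1r. Qed.
Fact mcoker_scaleDr : right_distributive mcoker_scale +%R.
Proof.
move=> a; elim/mcokerW=> x; elim/mcokerW=> y.
rewrite (mcoker_addE x y : mcoker_pi x + mcoker_pi y = _).
by rewrite !mcoker_scaleE scalerDr; symmetry; exact: mcoker_addE.
Qed.
Fact mcoker_scaleDl x : {morph mcoker_scale^~ x : a b / a + b}.
Proof.
elim/mcokerW: x => x a b; rewrite !mcoker_scaleE scalerDl; symmetry; exact: mcoker_addE.
Qed.
HB.instance Definition _ := GRing.Zmodule_isLmodule.Build R mcoker
  mcoker_scaleA mcoker_scale1 mcoker_scaleDr mcoker_scaleDl.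

End KerImCoker.

Definition isomorphic (R : nzRingType) (M N : lmodType R) : Prop :=
  exists f : {linear M -> N}, bijective f.

Definition surj (S T : Type) (f : S -> T) : Prop := forall y, exists x, f x = y.

(* R-S-bimodules; [bract u s] is u s. *)
Record bimod (R S : nzRingType) := Bimod {
  bileft :> lmodType R;
  bract : bileft -> S -> bileft;
  bractA : forall u s t, bract u (s * t) = bract (bract u s) t;
  bract1 : forall u, bract u 1 = u;
  bractDl : forall u v s, bract (u + v) s = bract u s + bract v s;
  bractDr : forall u s t, bract u (s + t) = bract u s + bract u t;
  bractZ : forall r u s, bract (r *: u) s = r *: bract u s
}.

Section RightModule.
Variables (R S : nzRingType) (U : bimod R S).

Definition rmod_sort : Type := U.
HB.instance Definition _ := GRing.Zmodule.on rmod_sort.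

Definition rmod_scale (s : S^c) (u : rmod_sort) : rmod_sort := bract (u : U) (s : S).

Fact rmod_scaleA (s t : S^c) (u : rmod_sort) :
  rmod_scale s (rmod_scale t u) = rmod_scale (s * t) u.
Proof. by rewrite /rmod_scale -bractA. Qed.
Fact rmod_scale1 : left_id 1 rmod_scale.
Proof. by move=> u; exact: bract1. Qed.
Fact rmod_scaleDr : right_distributive rmod_scale +%R.
Proof. by move=> s u v; exact: bractDl. Qed.
Fact rmod_scaleDl u : {morph rmod_scale^~ u : s t / s + t}.
Proof. by move=> s t; exact: bractDr. Qed.
HB.instance Definition _ := GRing.Zmodule_isLmodule.Build S^c rmod_sort
  rmod_scaleA rmod_scale1 rmod_scaleDr rmod_scaleDl.

Definition rmod : lmodType S^c := rmod_sort.

Lemma rmod_scaleE (s : S) (u : rmod) : (s : S^c) *: u = bract (u : U) s.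
Proof. by []. Qed.

End RightModule.

Definition balanced (R : nzRingType) (M : lmodType R^c) (N : lmodType R)
    (G : zmodType) (b : M -> N -> G) : Prop :=
  [/\ forall m m' n, b (m + m') n = b m n + b m' n,
      forall m n n', b m (n + n') = b m n + b m n' &
      forall (r : R) m n, b ((r : R^c) *: m) n = b m (r *: n)].

(* M (x)_R N is the set of finite formal sums of pairs (m, n), two sums being
   identified when every balanced map takes the same value on both. The
   universal property is [tens_liftE] and [tens_ext] below. *)
Section Tensor.
Variables (R : nzRingType) (M : lmodType R^c) (N : lmodType R).

Definition tsum (G : zmodType) (b : M -> N -> G) (s : seq (M * N)) : G :=
  \sum_(p <- s) b p.1 p.2.

Definition tens_rel : rel (seq (M * N)) := fun s t =>
  `[< forall (G : zmodType) (b : M -> N -> G),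
        balanced b -> tsum b s = tsum b t >].

Lemma tens_equiv : equiv_class_of tens_rel.
Proof.
split=> [s|s t|t s u].
- exact/asboolP.
- by apply/asboolP/asboolP => st G b bb; rewrite st.
- move=> /asboolP st /asboolP tu; apply/asboolP => G b bb.
  by rewrite st // tu.
Qed.

Definition tens_eq : equiv_rel (seq (M * N)) := EquivRelPack tens_equiv.
Definition tens := {eq_quot tens_eq}.
HB.instance Definition _ : EqQuotient _ tens_eq tens := EqQuotient.on tens.
HB.instance Definition _ := Choice.on tens.

Definition tens_pi (s : seq (M * N)) : tens := \pi_tens s.

Lemma tensW (P : tens -> Type) : (forall s, P (tens_pi s)) -> forall t, P t.
Proof. exact: quotW. Qed.

Lemma tens_eqP s t :
  (forall (G : zmodType) (b : M -> N -> G), balanced b -> tsum b s = tsum b t)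
  <-> tens_pi s = tens_pi t.
Proof. by split=> [st|/eqmodP/asboolP//]; apply/eqmodP/asboolP. Qed.

Definition tens_lift (G : zmodType) (b : M -> N -> G) (x : tens) : G :=
  tsum b (repr x).

Lemma tens_lift_pi (G : zmodType) (b : M -> N -> G) s :
  balanced b -> tens_lift b (tens_pi s) = tsum b s.
Proof. by apply: (tens_eqP _ _).2; rewrite /tens_pi reprK. Qed.

Definition tens_add (x y : tens) : tens := tens_pi (repr x ++ repr y).
Definition tens_opp (x : tens) : tens :=
  tens_pi [seq (- p.1, p.2) | p <- repr x].

Lemma tsum_cat (G : zmodType) (b : M -> N -> G) s t :
  tsum b (s ++ t) = tsum b s + tsum b t.
Proof. exact: big_cat. Qed.

Lemma balanced0l (G : zmodType) (b : M -> N -> G) n : balanced b -> b 0 n = 0.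
Proof. by case=> bD _ _; apply: (addrI (b 0 n)); rewrite -bD !addr0. Qed.

Lemma balancedNl (G : zmodType) (b : M -> N -> G) m n :
  balanced b -> b (- m) n = - b m n.
Proof.
move=> bb; apply/eqP; rewrite -addr_eq0; case: (bb) => bD _ _.
by rewrite -bD addNr balanced0l.
Qed.

Lemma tsum_opp (G : zmodType) (b : M -> N -> G) s : balanced b ->
  tsum b [seq (- p.1, p.2) | p <- s] = - tsum b s.
Proof.
move=> bb; rewrite /tsum big_map -sumrN; apply: eq_bigr => p _.
exact: balancedNl.
Qed.

Lemma tsum_repr (G : zmodType) (b : M -> N -> G) s :
  balanced b -> tsum b (repr (tens_pi s)) = tsum b s.
Proof. exact: tens_lift_pi. Qed.

Lemma tens_addE s t : tens_add (tens_pi s) (tens_pi t) = tens_pi (s ++ t).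
Proof. by apply/tens_eqP => G b bb; rewrite !tsum_cat !tsum_repr. Qed.

Lemma tens_oppE s :
  tens_opp (tens_pi s) = tens_pi [seq (- p.1, p.2) | p <- s].
Proof. by apply/tens_eqP => G b bb; rewrite !tsum_opp ?tsum_repr. Qed.

Local Opaque tens_add tens_opp.
Fact tens_addA : associative tens_add.
Proof.
by elim/tensW=> x; elim/tensW=> y; elim/tensW=> z; rewrite !tens_addE catA.
Qed.
Fact tens_addC : commutative tens_add.
Proof.
elim/tensW=> x; elim/tensW=> y; rewrite !tens_addE.
by apply/tens_eqP => G b bb; rewrite !tsum_cat addrC.
Qed.
Fact tens_add0 : left_id (tens_pi [::]) tens_add.
Proof. by elim/tensW=> x; rewrite tens_addE. Qed.
Fact tens_addN : left_inverse (tens_pi [::]) tens_opp tens_add.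
Proof.
elim/tensW=> x; rewrite tens_oppE tens_addE; apply/tens_eqP => G b bb.
by rewrite tsum_cat tsum_opp // addNr /tsum big_nil.
Qed.
HB.instance Definition _ := GRing.isZmodule.Build tens
  tens_addA tens_addC tens_add0 tens_addN.

Definition tpure (m : M) (n : N) : tens := tens_pi [:: (m, n)].

Lemma tpure_balanced : balanced tpure.
Proof.
split=> [m m' n|m n n'|r m n].
- rewrite [RHS]tens_addE; apply/tens_eqP => G b bb.
  by rewrite tsum_cat /tsum !big_seq1 /=; case: bb => ->.
- rewrite [RHS]tens_addE; apply/tens_eqP => G b bb.
  by rewrite tsum_cat /tsum !big_seq1 /=; case: bb => _ ->.
- by apply/tens_eqP => G b bb; rewrite /tsum !big_seq1 /=; case: bb => _ _ ->.
Qed.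

Lemma tens_liftE (G : zmodType) (b : M -> N -> G) m n :
  balanced b -> tens_lift b (tpure m n) = b m n.
Proof. by move=> bb; rewrite tens_lift_pi // /tsum big_seq1. Qed.

Lemma tens_liftD (G : zmodType) (b : M -> N -> G) :
  balanced b -> {morph tens_lift b : x y / x + y}.
Proof.
move=> bb; elim/tensW=> x; elim/tensW=> y.
by rewrite [_ + _]tens_addE !tens_lift_pi // tsum_cat.
Qed.

Lemma tens_ind (P : tens -> Prop) :
  P 0 -> (forall m n x, P x -> P (tpure m n + x)) -> forall x, P x.
Proof.
move=> P0 PD; elim/tensW; elim=> [//|[m n] s IHs].
have -> : tens_pi ((m, n) :: s) = tpure m n + tens_pi s.
  by rewrite [RHS]tens_addE.
exact: PD.
Qed.

Lemma tens_ext (G : zmodType) (f g : tens -> G) :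
    {morph f : x y / x + y} -> {morph g : x y / x + y} ->
  (forall m n, f (tpure m n) = g (tpure m n)) -> f =1 g.
Proof.
move=> fD gD fg; apply: tens_ind => [|m n x IHx].
  apply: (@addrI _ (f 0)); rewrite -fD !addr0.
  have g0 : g 0 = 0 by apply: (addrI (g 0)); rewrite -gD !addr0.
  by rewrite g0 addr0.
by rewrite fD gD fg IHx.
Qed.

End Tensor.

Definition tens_zero (R : nzRingType) (M : lmodType R^c) (N : lmodType R) : Prop :=
  forall t : tens M N, t = 0.

Definition tens_map (R : nzRingType) (M M' : lmodType R^c) (N N' : lmodType R)
    (f : {linear M -> M'}) (g : {linear N -> N'}) : tens M N -> tens M' N' :=
  tens_lift (fun m n => tpure (f m) (g n)).

Lemma tens_mapE (R : nzRingType) (M M' : lmodType R^c) (N N' : lmodType R)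
    (f : {linear M -> M'}) (g : {linear N -> N'}) m n :
  tens_map f g (tpure m n) = tpure (f m) (g n).
Proof.
apply: tens_liftE; have [bDl bDr bZ] := tpure_balanced M' N'.
split=> *; rewrite ?linearD ?bDl ?bDr //.
by rewrite linearZ bZ linearZ.
Qed.

(* U (x)_S X as a left R-module, for an R-S-bimodule U. *)
Section TensorModule.
Variables (R S : nzRingType) (U : bimod R S) (X : lmodType S).

Definition tact (r : R) (u : rmod U) (x : X) : tens (rmod U) X :=
  tpure (r *: (u : U) : rmod U) x.

Lemma tact_balanced r : balanced (tact r).
Proof.
have [bDl bDr bZ] := tpure_balanced (rmod U) X.
rewrite /tact; split=> [u v x|u x y|s u x].
- by rewrite scalerDr bDl.
- by rewrite bDr.
- by rewrite -bZ !rmod_scaleE bractZ.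
Qed.

Definition tens_scale (r : R) : tens (rmod U) X -> tens (rmod U) X :=
  tens_lift (tact r).

Lemma tens_scaleE r u x :
  tens_scale r (tpure u x) = tpure (r *: (u : U) : rmod U) x.
Proof. exact/tens_liftE/tact_balanced. Qed.

Fact tens_scaleDr : right_distributive tens_scale +%R.
Proof. by move=> r; exact/tens_liftD/tact_balanced. Qed.
Fact tens_scaleA r s t : tens_scale r (tens_scale s t) = tens_scale (r * s) t.
Proof.
move: t; apply: tens_ext => [t t'|t t'|u x]; rewrite ?tens_scaleDr //.
by rewrite !tens_scaleE scalerA.
Qed.
Fact tens_scale1 : left_id 1 tens_scale.
Proof.
apply: tens_ext => [t t'|t t'|u x]; rewrite ?tens_scaleDr //.
by rewrite tens_scaleE scale1r.
Qed.
Fact tens_scaleDl t : {morph tens_scale^~ t : r s / r + s}.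
Proof.
move=> r s; move: t.
apply: tens_ext => [t t'|t t'|u x]; rewrite ?tens_scaleDr //.
  by rewrite addrACA.
by have [bDl _ _] := tpure_balanced (rmod U) X; rewrite !tens_scaleE scalerDl bDl.
Qed.
HB.instance Definition _ := GRing.Zmodule_isLmodule.Build R (tens (rmod U) X)
  tens_scaleA tens_scale1 tens_scaleDr tens_scaleDl.

Lemma scale_tpure (r : R) (u : U) (x : X) :
  r *: tpure (u : rmod U) x = tpure (r *: u : rmod U) x.
Proof. exact: tens_scaleE. Qed.

Lemma tpure_bract (u : U) (s : S) (x : X) :
  tpure (bract u s : rmod U) x = tpure (u : rmod U) (s *: x).
Proof. by have [_ _ <-] := tpure_balanced (rmod U) X. Qed.

Lemma tpureDl (u v : U) (x : X) :
  tpure (u + v : rmod U) x = tpure (u : rmod U) x + tpure (v : rmod U) x.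
Proof. by have [-> _ _] := tpure_balanced (rmod U) X. Qed.

Lemma tpureDr (u : U) (x y : X) :
  tpure (u : rmod U) (x + y) = tpure (u : rmod U) x + tpure (u : rmod U) y.
Proof. by have [_ -> _] := tpure_balanced (rmod U) X. Qed.

Lemma tpure0l (x : X) : tpure (0 : rmod U) x = 0.
Proof. exact/balanced0l/tpure_balanced. Qed.

End TensorModule.

Lemma linear_eq (R : nzRingType) (M N : lmodType R) (f g : {linear M -> N}) :
  f =1 g -> f = g.
Proof.
case: f g => [f [[fD] [fZ]]] [g [[gD] [gZ]]] /= /funext fg; subst g.
by rewrite (Prop_irrelevance fD gD) (Prop_irrelevance fZ gZ).
Qed.

(* Hom_{S^op}(U, W) for an R-S-bimodule U, a right R-module by
   (h r)(u) = h (r u). *)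
Section HomModule.
Variables (R S : nzRingType) (U : bimod R S) (W : lmodType S^c).

Definition homr : Type := {linear rmod U -> W}.
HB.instance Definition _ := gen_eqMixin homr.
HB.instance Definition _ := gen_choiceMixin homr.

Definition homr_fun (h : homr) : rmod U -> W := GRing.Linear.sort h.
Coercion homr_fun : homr >-> Funclass.

Definition homr_zero : homr := (\0 : {linear rmod U -> W}).
Definition homr_opp (h : homr) : homr :=
  (\- (h : {linear rmod U -> W}) : {linear rmod U -> W}).
Definition homr_add (h k : homr) : homr :=
  ((h : {linear rmod U -> W}) \+ (k : {linear rmod U -> W})
   : {linear rmod U -> W}).

Fact homr_addA : associative homr_add.
Proof. by move=> f g h; apply: linear_eq => u /=; rewrite addrA. Qed.
Fact homr_addC : commutative homr_add.
Proof. by move=> f g; apply: linear_eq => u /=; rewrite addrC. Qed.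
Fact homr_add0 : left_id homr_zero homr_add.
Proof. by move=> f; apply: linear_eq => u /=; rewrite add0r. Qed.
Fact homr_addN : left_inverse homr_zero homr_opp homr_add.
Proof. by move=> f; apply: linear_eq => u /=; rewrite addNr. Qed.
HB.instance Definition _ := GRing.isZmodule.Build homr
  homr_addA homr_addC homr_add0 homr_addN.

Definition lmul_fun (r : R) (u : rmod U) : rmod U := r *: (u : U).
Fact lmul_fun_linear r : linear (lmul_fun r).
Proof.
move=> s u v; rewrite /lmul_fun scalerDr; congr (_ + _).
by rewrite !rmod_scaleE bractZ.
Qed.
HB.instance Definition _ r :=
  GRing.isLinear.Build S^c (rmod U) (rmod U) _ (lmul_fun r) (lmul_fun_linear r).

Definition homr_scale (r : R^c) (h : homr) : homr :=
  ((h : {linear rmod U -> W}) \o (lmul_fun (r : R)) : {linear rmod U -> W}).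

Fact homr_scaleA (r s : R^c) h :
  homr_scale r (homr_scale s h) = homr_scale (r * s) h.
Proof. by apply: linear_eq => u /=; rewrite /lmul_fun scalerA. Qed.
Fact homr_scale1 : left_id 1 homr_scale.
Proof. by move=> h; apply: linear_eq => u /=; rewrite /lmul_fun scale1r. Qed.
Fact homr_scaleDr : right_distributive homr_scale +%R.
Proof. by move=> r h k; apply: linear_eq. Qed.
Fact homr_scaleDl h : {morph homr_scale^~ h : r s / r + s}.
Proof.
move=> r s; apply: linear_eq => u /=.
rewrite -linearD; congr (h _); exact: (scalerDl (u : U) (r : R) (s : R)).
Qed.
HB.instance Definition _ := GRing.Zmodule_isLmodule.Build R^c homr
  homr_scaleA homr_scale1 homr_scaleDr homr_scaleDl.

Lemma homrDE (h k : homr) u : (h + k) u = h u + k u. Proof. by []. Qed.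
Lemma homrZE (r : R) (h : homr) u : ((r : R^c) *: h) u = h (r *: (u : U)).
Proof. by []. Qed.

End HomModule.

Definition projective (R : nzRingType) (P : lmodType R) : Prop :=
  forall (M N : lmodType R) (p : {linear M -> N}) (h : {linear P -> N}),
    surj p -> exists k : {linear P -> M}, forall x, p (k x) = h x.

Definition injmod (R : nzRingType) (I : lmodType R) : Prop :=
  forall (M N : lmodType R) (i : {linear M -> N}) (h : {linear M -> I}),
    injective i -> exists k : {linear N -> I}, forall x, k (i x) = h x.

Definition flat (R : nzRingType) (F : lmodType R) : Prop :=
  forall (M N : lmodType R^c) (i : {linear M -> N}),
    injective i -> injective (tens_map i (idfun : {linear F -> F})).

(* Flatness of a right R-module; [flat] at R^c would instead test it against
   modules over R^c^c. *)
Definition rflat (R : nzRingType) (F : lmodType R^c) : Prop :=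
  forall (M N : lmodType R) (i : {linear M -> N}),
    injective i -> injective (tens_map (idfun : {linear F -> F}) i).

Definition fingen (R : nzRingType) (M : lmodType R) : Prop :=
  exists (n : nat) (e : 'I_n -> M),
    forall m, exists c : 'I_n -> R, m = \sum_i c i *: e i.

Definition finpres (R : nzRingType) (M : lmodType R) : Prop :=
  exists (n : nat) (p : {linear 'rV[R]_n -> M}), surj p /\ fingen (mker p).

(* Left coherence: finitely generated left ideals, i.e. finitely generated
   modules embedded in R, are finitely presented. *)
Definition coherent (R : nzRingType) : Prop :=
  forall (I : lmodType R) (i : {linear I -> R^o}),
    injective i -> fingen I -> finpres I.

Definition right_coherent (R : nzRingType) : Prop := coherent R^c.

Record resolution (R : nzRingType) (M : lmodType R) := Resolution {
  robj :> nat -> lmodType R;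
  rdiff : forall n, {linear robj n.+1 -> robj n};
  raug : {linear robj 0 -> M};
  raug_surj : surj raug;
  rexact0 : forall x, raug x = 0 <-> exists y, rdiff 0 y = x;
  rexact : forall n x, rdiff n x = 0 <-> exists y, rdiff n.+1 y = x
}.

(* The class [C] is that of flat, resp. projective, modules: fd or pd of M is
   finite when M has such a resolution of finite length. *)
Definition finite_dim (R : nzRingType) (C : lmodType R -> Prop)
    (M : lmodType R) : Prop :=
  exists (n : nat) (P : resolution M),
    (forall i, C (P i)) /\ (forall i, (n < i)%N -> forall x : P i, x = 0).

Definition fd_finite (R : nzRingType) (M : lmodType R) : Prop :=
  finite_dim (@flat R) M.
Definition rfd_finite (R : nzRingType) (M : lmodType R^c) : Prop :=
  finite_dim (@rflat R) M.
Definition pd_finite (R : nzRingType) (M : lmodType R) : Prop :=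
  finite_dim (@projective R) M.

(* Tor_j(V, M) = 0: the complex V (x) P has zero homology in degree j, for
   every projective resolution P of M. *)
Definition Tor_zero (R : nzRingType) (j : nat)
    (V : lmodType R^c) (M : lmodType R) : Prop :=
  forall P : resolution M, (forall i, projective (P i)) ->
    let d n := tens_map (idfun : {linear V -> V}) (rdiff P n) in
    match j with
    | 0 => forall x, exists y, d 0 y = x
    | k.+1 => forall x, d k x = 0 -> exists y, d k.+1 y = x
    end.

(* Ext^j(M, N) = 0: the complex Hom(P, N) has zero cohomology in degree j, for
   every projective resolution P of M. *)
Definition Ext_zero (R : nzRingType) (j : nat) (M N : lmodType R) : Prop :=
  forall P : resolution M, (forall i, projective (P i)) ->
    forall h : {linear P j -> N}, (forall x, h (rdiff P j x) = 0) ->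
    match j return {linear P j -> N} -> Prop with
    | 0 => fun h => forall x, h x = 0
    | k.+1 => fun h =>
        exists g : {linear P k -> N}, forall x, g (rdiff P k x) = h x
    end h.

Definition FP_injective (R : nzRingType) (M : lmodType R) : Prop :=
  forall L : lmodType R, finpres L -> Ext_zero 1 L M.

Record complex (R : nzRingType) := Complex {
  cobj :> int -> lmodType R;
  cdiff : forall i, {linear cobj i -> cobj (i + 1)}
}.

Definition exact_complex (R : nzRingType) (P : complex R) : Prop :=
  forall i x, cdiff P (i + 1) x = 0 <-> exists y, cdiff P i y = x.

Definition hom_from_exact (R : nzRingType) (P : complex R) (F : lmodType R) :
    Prop :=
  forall i (h : {linear P (i + 1) -> F}),
    (forall x, h (cdiff P i x) = 0) <->
    exists k : {linear P (i + 1 + 1) -> F},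
      forall x, k (cdiff P (i + 1) x) = h x.

Definition hom_to_exact (R : nzRingType) (E : lmodType R) (I : complex R) :
    Prop :=
  forall i (h : {linear E -> I (i + 1)}),
    (forall x, cdiff I (i + 1) (h x) = 0) <->
    exists k : {linear E -> I i}, forall x, cdiff I i (k x) = h x.

Definition DP (R : nzRingType) (M : lmodType R) : Prop :=
  exists P : complex R,
    [/\ forall i, projective (P i),
        exact_complex P,
        forall F : lmodType R, flat F -> hom_from_exact P F &
        isomorphic M (mim (cdiff P (- 1)))].

Definition DI (R : nzRingType) (M : lmodType R) : Prop :=
  exists I : complex R,
    [/\ forall i, injmod (I i),
        exact_complex I,
        forall E : lmodType R, FP_injective E -> hom_to_exact E I &
        isomorphic M (mker (cdiff I 0))].

Section Morita.
Variables (A B : nzRingType) (V : bimod A B) (U : bimod B A).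

(* ((a, v), (u, b)) is the matrix with rows (a v) and (u b). *)
Definition Lambda00 : Type := ((A * V) * (U * B))%type.
HB.instance Definition _ := GRing.Zmodule.on Lambda00.

Definition Lmk (a : A) (v : V) (u : U) (b : B) : Lambda00 := ((a, v), (u, b)).
Definition La (x : Lambda00) : A := x.1.1.
Definition Lv (x : Lambda00) : V := x.1.2.
Definition Lu (x : Lambda00) : U := x.2.1.
Definition Lb (x : Lambda00) : B := x.2.2.

Definition L1 : Lambda00 := Lmk 1 0 0 1.
Definition Lmul (x y : Lambda00) : Lambda00 :=
  Lmk (La x * La y)
      (La x *: Lv y + bract (Lv x) (Lb y))
      (bract (Lu x) (La y) + Lb x *: Lu y)
      (Lb x * Lb y).

Lemma bract0l (R S : nzRingType) (W : bimod R S) s : bract (0 : W) s = 0.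
Proof. by apply: (addrI (bract 0 s)); rewrite -bractDl !addr0. Qed.
Lemma bract0r (R S : nzRingType) (W : bimod R S) (w : W) : bract w 0 = 0.
Proof. by apply: (addrI (bract w 0)); rewrite -bractDr !addr0. Qed.

Fact LmulA : associative Lmul.
Proof.
move=> x y z; rewrite /Lmul /La /Lv /Lu /Lb /=; congr ((_, _), (_, _)).
- by rewrite mulrA.
- by rewrite scalerDr bractDl bractZ bractA scalerA addrA.
- by rewrite scalerDr bractDl bractZ bractA scalerA addrA.
- by rewrite mulrA.
Qed.
Fact Lmul1l : left_id L1 Lmul.
Proof.
case=> [[a v] [u b]]; rewrite /Lmul /La /Lv /Lu /Lb /=.
by rewrite !mul1r !scale1r !bract0l addr0 add0r.
Qed.
Fact Lmul1r : right_id L1 Lmul.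
Proof.
case=> [[a v] [u b]]; rewrite /Lmul /La /Lv /Lu /Lb /=.
by rewrite !mulr1 !scaler0 !bract1 addr0 add0r.
Qed.
Fact LmulDl : left_distributive Lmul +%R.
Proof.
move=> x y z; rewrite /Lmul /La /Lv /Lu /Lb /=; congr ((_, _), (_, _)) => /=;
  by rewrite ?mulrDl // scalerDl bractDl addrACA.
Qed.
Fact LmulDr : right_distributive Lmul +%R.
Proof.
move=> x y z; rewrite /Lmul /La /Lv /Lu /Lb /=; congr ((_, _), (_, _)) => /=;
  by rewrite ?mulrDr // scalerDr bractDr addrACA.
Qed.
Fact L1_neq0 : L1 != 0.
Proof. by apply/eqP => -[] /eqP; rewrite oner_eq0. Qed.
HB.instance Definition _ := GRing.Zmodule_isNzRing.Build Lambda00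
  LmulA Lmul1l Lmul1r LmulDl LmulDr L1_neq0.

End Morita.

Lemma balanced_eq0 (R : nzRingType) (M : lmodType R^c) (N : lmodType R)
    (G : zmodType) (b : M -> N -> G) :
  tens_zero M N -> balanced b -> forall m n, b m n = 0.
Proof.
move=> t0 bb m n; rewrite -(tens_liftE m n bb) (t0 (tpure m n)).
by apply: (addrI (tens_lift b 0)); rewrite -tens_liftD // !addr0.
Qed.

(* The left module (X, Y, f, g):
   (a v; u b) (x, y) = (a x + g (v (x) y), f (u (x) x) + b y).
   Associativity needs f (u (x) g (v (x) y)) = 0 = g (v (x) f (u (x) x)), which
   holds because U (x)_A V = 0 = V (x)_B U. *)
Definition LambdaL (A B : nzRingType) (V : bimod A B) (U : bimod B A)
    (UV0 : tens_zero (rmod U) V) (VU0 : tens_zero (rmod V) U)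
    (X : lmodType A) (Y : lmodType B)
    (f : {linear tens (rmod U) X -> Y}) (g : {linear tens (rmod V) Y -> X}) :
  Type := (X * Y)%type.

Section LeftModule.
Variables (A B : nzRingType) (V : bimod A B) (U : bimod B A).
Variables (UV0 : tens_zero (rmod U) V) (VU0 : tens_zero (rmod V) U).
Variables (X : lmodType A) (Y : lmodType B).
Variables (f : {linear tens (rmod U) X -> Y}).
Variables (g : {linear tens (rmod V) Y -> X}).
Local Notation LM := (LambdaL UV0 VU0 f g).

HB.instance Definition _ := GRing.Zmodule.on LM.

Definition LambdaL_scale (l : Lambda00 V U) (m : LM) : LM :=
  (La l *: m.1 + g (tpure (Lv l : rmod V) m.2),
   f (tpure (Lu l : rmod U) m.1) + Lb l *: m.2).

Lemma LambdaL_fg0 (u : U) (v : V) y :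
  f (tpure (u : rmod U) (g (tpure (v : rmod V) y))) = 0.
Proof.
pose b (u : rmod U) (v : V) := f (tpure u (g (tpure (v : rmod V) y))).
apply: (@balanced_eq0 _ _ _ _ b UV0); rewrite /b.
have [Dl Dr Z] := tpure_balanced (rmod U) X.
have [Dl' _ _] := tpure_balanced (rmod V) Y.
split=> [u1 u2 w|u1 w w'|r u1 w].
- by rewrite Dl linearD.
- by rewrite Dl' linearD Dr linearD.
- by rewrite Z -linearZ -tens_scaleE.
Qed.

Lemma LambdaL_gf0 (v : V) (u : U) x :
  g (tpure (v : rmod V) (f (tpure (u : rmod U) x))) = 0.
Proof.
pose b (v : rmod V) (u : U) := g (tpure v (f (tpure (u : rmod U) x))).
apply: (@balanced_eq0 _ _ _ _ b VU0); rewrite /b.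
have [Dl Dr Z] := tpure_balanced (rmod V) Y.
have [Dl' _ _] := tpure_balanced (rmod U) X.
split=> [v1 v2 w|v1 w w'|r v1 w].
- by rewrite Dl linearD.
- by rewrite Dl' linearD Dr linearD.
- by rewrite Z -linearZ -tens_scaleE.
Qed.

Fact LambdaL_scaleA l l' m :
  LambdaL_scale l (LambdaL_scale l' m) = LambdaL_scale (l * l') m.
Proof.
case: l l' m => [[a v] [u b]] [[a' v'] [u' b']] [x y].
rewrite /LambdaL_scale /=; congr pair.
- rewrite /Lmul /La /Lv /Lu /Lb /= !tpureDr !tpureDl !linearD /= LambdaL_gf0 add0r.
  by rewrite scalerDr scalerA -scale_tpure linearZ tpure_bract addrA.
- rewrite /Lmul /La /Lv /Lu /Lb /= !tpureDr !tpureDl !linearD /= LambdaL_fg0 addr0.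
  by rewrite scalerDr scalerA -scale_tpure linearZ tpure_bract addrA.
Qed.
Fact LambdaL_scale1 : left_id 1 LambdaL_scale.
Proof.
case=> x y; rewrite /LambdaL_scale /La /Lv /Lu /Lb /=.
by rewrite !tpure0l !linear0 !scale1r addr0 add0r.
Qed.
Fact LambdaL_scaleDr : right_distributive LambdaL_scale +%R.
Proof.
move=> l [x y] [x' y']; rewrite /LambdaL_scale /=; congr pair => /=;
  by rewrite scalerDr tpureDr linearD addrACA.
Qed.
Fact LambdaL_scaleDl m : {morph LambdaL_scale^~ m : l l' / l + l'}.
Proof.
case: m => x y l l'; rewrite /LambdaL_scale /La /Lv /Lu /Lb /=; congr pair => /=;
  by rewrite scalerDl tpureDl linearD addrACA.
Qed.
HB.instance Definition _ := GRing.Zmodule_isLmodule.Build (Lambda00 V U) LM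
  LambdaL_scaleA LambdaL_scale1 LambdaL_scaleDr LambdaL_scaleDl.

End LeftModule.

(* The right module [W, N, s, t]:
   (w, n) (a v; u b) = (w a + s n u, t w v + n b). *)
Definition LambdaR (A B : nzRingType) (V : bimod A B) (U : bimod B A)
    (UV0 : tens_zero (rmod U) V) (VU0 : tens_zero (rmod V) U)
    (W : lmodType A^c) (N : lmodType B^c)
    (s : {linear N -> homr U W}) (t : {linear W -> homr V N}) :
  Type := (W * N)%type.

Section RightLambdaModule.
Variables (A B : nzRingType) (V : bimod A B) (U : bimod B A).
Variables (UV0 : tens_zero (rmod U) V) (VU0 : tens_zero (rmod V) U).
Variables (W : lmodType A^c) (N : lmodType B^c).
Variables (s : {linear N -> homr U W}) (t : {linear W -> homr V N}).
Local Notation RM := (LambdaR UV0 VU0 s t).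

HB.instance Definition _ := GRing.Zmodule.on RM.

Definition LambdaR_scale (l : (Lambda00 V U)^c) (m : RM) : RM :=
  ((La l : A^c) *: m.1 + s m.2 (Lu l), t m.1 (Lv l) + (Lb l : B^c) *: m.2).

Lemma LambdaR_ts0 (u : U) (v : V) n : t (s n u) v = 0.
Proof.
pose b (u : rmod U) (v : V) := t (s n u) v.
apply: (@balanced_eq0 _ _ _ _ b UV0); rewrite /b.
split=> [u1 u2 w|u1 w w'|r u1 w]; rewrite /homr_fun.
- by rewrite !linearD.
- by rewrite linearD.
- by rewrite !linearZ.
Qed.

Lemma LambdaR_st0 (v : V) (u : U) w : s (t w v) u = 0.
Proof.
pose b (v : rmod V) (u : U) := s (t w v) u.
apply: (@balanced_eq0 _ _ _ _ b VU0); rewrite /b.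
split=> [v1 v2 x|v1 x x'|r v1 x]; rewrite /homr_fun.
- by rewrite !linearD.
- by rewrite linearD.
- by rewrite !linearZ.
Qed.

Fact LambdaR_scaleA l l' m :
  LambdaR_scale l (LambdaR_scale l' m) = LambdaR_scale (l * l') m.
Proof.
case: l l' m => [[a v] [u b]] [[a' v'] [u' b']] [w n].
rewrite /LambdaR_scale /La /Lv /Lu /Lb /=; congr pair.
- rewrite !linearD !homrDE /= [X in _ + (X + _)]LambdaR_st0 add0r.
  rewrite scalerDr scalerA -addrA; congr (_ + (_ + _)); last by rewrite linearZ.
  by symmetry; exact: (linearZ_LR (s n : {linear rmod U -> W}) (a : A^c)).
- rewrite !linearD !homrDE /= [X in _ + X + _ *: (_ + _)]LambdaR_ts0 addr0.
  rewrite scalerDr scalerA addrA; congr (_ + _ + _); first by rewrite linearZ.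
  by symmetry; exact: (linearZ_LR (t w : {linear rmod V -> N}) (b : B^c)).
Qed.
Fact LambdaR_scale1 : left_id 1 LambdaR_scale.
Proof.
case=> w n; rewrite /LambdaR_scale /La /Lv /Lu /Lb /=.
by rewrite /homr_fun !linear0 !scale1r addr0 add0r.
Qed.
Fact LambdaR_scaleDr : right_distributive LambdaR_scale +%R.
Proof.
move=> l [w n] [w' n']; rewrite /LambdaR_scale /=; congr pair => /=;
  by rewrite scalerDr linearD homrDE addrACA.
Qed.
Fact LambdaR_scaleDl m : {morph LambdaR_scale^~ m : l l' / l + l'}.
Proof.
case: m => w n l l'; rewrite /LambdaR_scale /La /Lv /Lu /Lb /=.
by congr pair => /=; rewrite scalerDl /homr_fun linearD addrACA.
Qed.
HB.instance Definition _ := GRing.Zmodule_isLmodule.Build (Lambda00 V U)^c RM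
  LambdaR_scaleA LambdaR_scale1 LambdaR_scaleDr LambdaR_scaleDl.

End RightLambdaModule.

(* Main.v *)
Require Import Defs.
From HB Require Import structures.
From mathcomp Require Import all_boot all_order all_algebra.
From mathcomp Require Import boolp classical_sets zify.

Set Implicit Arguments.
Unset Strict Implicit.
Unset Printing Implicit Defensive.

Import Order.TTheory GRing.Theory Num.Theory.
Local Open Scope ring_scope.

(** Ding projectivity and Ding injectivity are first freed from complexes: a
    module is Ding projective exactly when it lies in a class of modules that is
    closed under syzygies and cosyzygies for projective modules and whose members
    M satisfy Ext^1(M, F) = 0 for every flat F ([DP_class_of], [DP_of_class]), and
    dually with injective and FP-injective modules ([DI_class_of],
    [DI_of_class]). Everything is then a matter of first extension groups, whose
    vanishing is expressed as an extension property of maps ([ext1z]), of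
    dimension shifting, and of Tor_1(G, N), which vanishes exactly when
    Ext^1(N, G^+) does, G^+ being the character module of G.

    A left module over the matrix ring is a quadruple (X, Y, f, g). For a pair of
    projective modules (P, Q) the quadruple on P + V (x) Q and Q + U (x) P is
    projective, and these are all the projective modules up to direct summands
    ([TL_projective], [LL_projective]). As V (x) U = 0, tensoring with V does not
    see the difference between Y and coker f. On this rests a horseshoe
    construction: if f and g are injective and their cokernels have syzygies and
    cosyzygies in given classes, then (X, Y, f, g) has a syzygy and a cosyzygy
    with respect to a module induced from (P, Q), again with injective structure
    maps and with cokernels in these classes ([coker_class_left],
    [coker_class_right]). What it needs is that the tensor products stay exact,
    i.e. Tor_1(V, L) = 0 for L Ding projective, and that maps extend to V (x) Q,
    i.e. Ext^1(L, V (x) Q) = 0. The first holds because V has finite flat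
    dimension as a right module, the second because V (x) Q has finite flat
    dimension. Finally, a flat module F over the matrix ring has injective
    structure maps and flat cokernels ([LL_flat]), so that it is an extension of
    modules with zero structure maps whose components are flat or are tensor
    products of flat modules with U and V; hence there are no extensions by F.

    Conversely, the cokernels of the members of a class as above again form such
    a class. Along syzygies and cosyzygies one meets projective quadruples, whose
    components are summands of Q + U (x) P; by hypothesis the higher Tor of V
    vanishes on them, and as V has finite flat dimension Tor_1(V, Y) = 0 for all
    members ([DP_class_ext_charL]). So f and g are injective and the sequences of
    cokernels are exact. Orthogonality of the cokernels to flat modules is that of
    the quadruple to the module on a flat pair with zero structure maps, and the
    latter has finite flat dimension, by inducing projective resolutions of the
    tensor products ([DP_class_ext_ZL]).

    The finite flat dimension of U (x) F comes from the left structure of U. If U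
    has flat dimension n, then Ext^1(L, U^+) = 0 for an n-th syzygy L of right
    modules. Hence tensoring with U keeps injective the inclusion into a
    projective module whose quotient is L, and Ext^1(L, Hom(U, E)) = 0 for E
    injective by adjunction. So the n-th cosyzygies of Hom(U, E) are injective,
    and with E = F^+ these are the characters of the n-th syzygies of U (x) F
    ([tens_flat_syzygy]).

    The statement on right modules is dual. A right module is a quadruple with
    structure maps s into Hom(U, W) and t into Hom(V, N); coinduced modules,
    kernels and Hom take the place of induced modules, cokernels and tensor
    products. The one new ingredient is finiteness, since FP-injectivity is tested
    on finitely presented modules only. Over a coherent ring all syzygies of these
    may be chosen finitely presented; coherence passes from the matrix ring to A
    and B and makes U and V finitely presented ([relfg_transfer]). Thus the
    argument of the preceding paragraph applies to FP-injective E, as L and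
    L (x) U are finitely presented ([homr_FP_cosyzygy]). Finitely presented modules
    over the matrix ring have finitely presented components, and conversely for
    zero structure maps; therefore coinduction preserves FP-injectivity
    ([HR_FP_injective]), and an FP-injective module has surjective structure maps
    with FP-injective kernels ([RR_FP_injective]). *)

(** * Short exact sequences *)

Definition mklin (R : nzRingType) (M N : lmodType R) (f : M -> N)
  (fL : linear f) : {linear M -> N} :=
  HB.pack f (GRing.isLinear.Build R M N *:%R f fL).

(** Maps are defined below by what they must satisfy: a linear relation that is
    total and single-valued is the graph of a linear map. *)
Lemma linear_of_rel (R : nzRingType) (M N : lmodType R) (r : M -> N -> Prop) :
    (forall x, exists y, r x y) ->
    (forall a x y x' y', r x y -> r x' y' -> r (a *: x + x') (a *: y + y')) ->
    (forall y, r 0 y -> y = 0) ->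
  exists f : {linear M -> N}, forall x y, r x y <-> f x = y.
Proof.
move=> rT rL r0; have [f fr] := choice rT.
have rU x y y' : r x y -> r x y' -> y = y'.
  move=> h h'; apply/eqP; rewrite -subr_eq0; apply/eqP/r0.
  by have := rL (-1) _ _ _ _ h' h; rewrite !scaleN1r addNr addrC.
have fL : linear f by move=> a x y; apply: (rU (a *: x + y)) => //; apply: rL.
exists (mklin fL) => x y; split=> [rxy|<-]; last exact: fr.
exact: rU (fr x) rxy.
Qed.

Section Ses.
Variable R : nzRingType.
Implicit Types K P L E M N Q F C I J : lmodType R.

Definition ses K P L (i : {linear K -> P}) (p : {linear P -> L}) : Prop :=
  [/\ injective i, surj p & forall x, p x = 0 <-> exists y, i y = x].

Lemma lin_inj M N (f : {linear M -> N}) : (forall x, f x = 0 -> x = 0) -> injective f.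
Proof.
move=> f0 x y fxy; apply/eqP; rewrite -subr_eq0; apply/eqP/f0.
by rewrite linearB fxy subrr.
Qed.

Lemma lin_inj0 M N (f : {linear M -> N}) x : injective f -> f x = 0 -> x = 0.
Proof. by move=> fI fx; apply: fI; rewrite fx linear0. Qed.

Lemma ses0 K P L (i : {linear K -> P}) (p : {linear P -> L}) y :
  ses i p -> p (i y) = 0.
Proof. by case=> _ _ ex; apply/ex; exists y. Qed.

Lemma ses_lift K P L (i : {linear K -> P}) (p : {linear P -> L}) E
    (h : {linear E -> P}) : ses i p -> (forall e, p (h e) = 0) ->
  exists k : {linear E -> K}, forall e, i (k e) = h e.
Proof.
move=> [iI _ ex] ph.
have [||y iy|k kE] := @linear_of_rel R E K (fun e y => i y = h e).
- by move=> e; apply/ex.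
- by move=> a x y x' y' e e'; rewrite !linearP e e'.
- by apply: (lin_inj0 iI); rewrite iy linear0.
by exists k => e; apply/kE.
Qed.

Lemma ses_desc K P L (i : {linear K -> P}) (p : {linear P -> L}) E
    (h : {linear P -> E}) : ses i p -> (forall y, h (i y) = 0) ->
  exists k : {linear L -> E}, forall x, k (p x) = h x.
Proof.
move=> [_ pS ex] hi.
have [|||k kE] := @linear_of_rel R L E (fun l e => exists x, p x = l /\ h x = e).
- by move=> l; have [x px] := pS l; exists (h x), x.
- move=> a l e l' e' [x [<- <-]] [x' [<- <-]].
  by exists (a *: x + x'); rewrite !linearP.
- by move=> e [x [/ex[y <-] <-]]; apply: hi.
by exists k => x; apply/kE; exists x.
Qed.

Fact mker_val_linear M N (f : {linear M -> N}) : linear (@mker_val R M N f).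
Proof. by []. Qed.
Definition kin M N (f : {linear M -> N}) : {linear mker f -> M} :=
  mklin (mker_val_linear (f := f)).
Fact mcoker_pi_linear M N (f : {linear M -> N}) : linear (mcoker_pi f).
Proof. by move=> a x y; symmetry; rewrite -[RHS]mcoker_addE -mcoker_scaleE. Qed.
Definition cpi M N (f : {linear M -> N}) : {linear N -> mcoker f} :=
  mklin (mcoker_pi_linear f).

Lemma kin_inj M N (f : {linear M -> N}) : injective (kin f).
Proof. exact: val_inj. Qed.

Lemma kinP M N (f : {linear M -> N}) x : f x = 0 <-> exists y, kin f y = x.
Proof.
split=> [fx|[[y /= /eqP fy] <-]//].
have kx : in_ker f x by apply/eqP.
by exists (Mker kx).
Qed.

Lemma kin0 M N (f : {linear M -> N}) y : f (kin f y) = 0.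
Proof. by apply/kinP; exists y. Qed.

Lemma ker_lift M N K (f : {linear M -> N}) (h : {linear K -> M}) :
  (forall y, f (h y) = 0) ->
  exists h' : {linear K -> mker f}, forall x, kin f (h' x) = h x.
Proof.
move=> fh; have [|||h' h'E] := @linear_of_rel _ K (mker f) (fun x y => kin f y = h x).
- by move=> x; apply/kinP.
- by move=> c x y x' y' e e'; rewrite !linearP e e'.
- by move=> y e; apply: kin_inj; rewrite e !linear0.
by exists h' => x; apply/h'E.
Qed.

Lemma cpi_surj M N (f : {linear M -> N}) : surj (cpi f).
Proof. by elim/mcokerW=> x; exists x. Qed.

Lemma cpiP M N (f : {linear M -> N}) x : cpi f x = 0 <-> exists y, f y = x.
Proof.
have <- : cpi f 0 = 0 by rewrite linear0.
by rewrite -(mcoker_eqP f x 0) subr0.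
Qed.

Lemma coker_desc M N K (f : {linear M -> N}) (h : {linear N -> K}) :
  (forall x, h (f x) = 0) ->
  exists h' : {linear mcoker f -> K}, forall x, h' (cpi f x) = h x.
Proof.
move=> hf; have [|||h' h'E] := @linear_of_rel _ (mcoker f) K
  (fun y l => exists x, cpi f x = y /\ h x = l).
- by move=> z; have [x <-] := cpi_surj z; exists (h x), x.
- by move=> r z l z' l' [x [<- <-]] [x' [<- <-]]; exists (r *: x + x'); rewrite !linearP.
- by move=> l [x [/cpiP[z <-] <-]].
by exists h' => x; apply/h'E; exists x.
Qed.

Lemma ses_kin M N (f : {linear M -> N}) : surj f -> ses (kin f) f.
Proof. by move=> fS; split=> //; [apply: kin_inj|apply: kinP]. Qed.

Lemma ses_cpi M N (f : {linear M -> N}) : injective f -> ses f (cpi f).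
Proof. by move=> fI; split=> //; [apply: cpi_surj|apply: cpiP]. Qed.

Fact mim_val_linear M N (f : {linear M -> N}) : linear (@mim_val R M N f).
Proof. by []. Qed.
Definition iin M N (f : {linear M -> N}) : {linear mim f -> N} :=
  mklin (mim_val_linear (f := f)).
Lemma iin_inj M N (f : {linear M -> N}) : injective (iin f).
Proof. exact: val_inj. Qed.
Lemma iinP M N (f : {linear M -> N}) x : (exists y, iin f y = x) <-> exists y, f y = x.
Proof.
split=> [[[y /= yP] <-]|fx]; first exact/asboolP.
have xP : in_im f x by apply/asboolP.
by exists (Mim xP).
Qed.
Lemma mim_onto M N (f : {linear M -> N}) :
  exists q : {linear M -> mim f}, surj q /\ forall x, iin f (q x) = f x.
Proof.
have [q qE] : exists q : {linear M -> mim f}, forall x, iin f (q x) = f x.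
  apply: (ses_lift (ses_cpi (@iin_inj _ _ f))) => x.
  by apply/cpiP/iinP; exists x.
exists q; split=> // y; have [|x fx] := (iinP f (iin f y)).1; first by exists y.
by exists x; apply: iin_inj; rewrite qE.
Qed.

Lemma isoP M N : isomorphic M N <->
  exists (f : {linear M -> N}) (g : {linear N -> M}), cancel f g /\ cancel g f.
Proof.
split=> [[f [g fK gK]]|[f [g [fK gK]]]]; last by exists f; exists g.
have gL : linear g by move=> a x y; apply: (can_inj fK); rewrite linearP !gK.
by exists f, (mklin gL).
Qed.

Lemma iso_refl M : isomorphic M M.
Proof. by exists idfun; exists idfun. Qed.
Lemma iso_sym M N : isomorphic M N -> isomorphic N M.
Proof. by case/isoP=> f [g [fK gK]]; apply/isoP; exists g, f. Qed.
Lemma iso_trans M N L : isomorphic M N -> isomorphic N L -> isomorphic M L.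
Proof.
move=> /isoP[f [g [fK gK]]] /isoP[f' [g' [fK' gK']]]; apply/isoP.
by exists (f' \o f), (g \o g'); split; apply: can_comp.
Qed.

Lemma iso_bij M N (f : {linear M -> N}) : injective f -> surj f -> isomorphic M N.
Proof.
move=> fI fS; have [g gE] := choice fS.
by exists f; exists g => x //; apply: fI.
Qed.

Lemma ses_iso_sub K K' P L (i : {linear K -> P}) (p : {linear P -> L}) :
  isomorphic K' K -> ses i p -> exists i' : {linear K' -> P}, ses i' p.
Proof.
move=> /isoP[f [g [fK gK]]] [iI pS ex]; exists (i \o f); split=> //=.
- by move=> x y /iI/(can_inj fK).
- move=> x; rewrite ex; split=> -[y <-]; last by exists (f y).
  by exists (g y); rewrite /= gK.
Qed.

Lemma ses_iso_quo K P L L' (i : {linear K -> P}) (p : {linear P -> L}) :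
  isomorphic L L' -> ses i p -> exists p' : {linear P -> L'}, ses i p'.
Proof.
move=> /isoP[f [g [fK gK]]] [iI pS ex]; exists (f \o p); split=> //=.
- by move=> y; have [x px] := pS (g y); exists x; rewrite /= px gK.
- move=> x; rewrite -ex; split=> [h|->]; last by rewrite linear0.
  by apply: (can_inj fK); rewrite h linear0.
Qed.

Lemma ses_iso_mid K P P' L (i : {linear K -> P}) (p : {linear P -> L}) :
  isomorphic P P' -> ses i p ->
  exists (i' : {linear K -> P'}) (p' : {linear P' -> L}), ses i' p'.
Proof.
move=> /isoP[f [g [fK gK]]] [iI pS ex]; exists (f \o i), (p \o g); split=> /=.
- by move=> x y /(can_inj fK)/iI.
- by move=> y; have [x px] := pS y; exists (f x); rewrite /= fK.
- move=> x; rewrite ex; split=> -[y yx]; exists y; last by rewrite -yx fK.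
  by rewrite yx gK.
Qed.

Definition retract N N' : Prop :=
  exists (s : {linear N -> N'}) (r : {linear N' -> N}), cancel s r.

Lemma iso_retract M N : isomorphic M N -> retract M N.
Proof. by case/isoP=> f [g [fK _]]; exists f, g. Qed.

(** ** Vanishing of Ext^1 *)

(** Ext^1(N, K) = 0, put as an extension property of maps, which is verified and
    transported by lifting and glueing maps. *)
Definition ext1z N K : Prop :=
  forall E' E (i : {linear E' -> E}) (p : {linear E -> N}), ses i p ->
  forall h : {linear E' -> K}, exists k : {linear E -> K}, forall x, k (i x) = h x.

Lemma ext1z_inj N K : injmod K -> ext1z N K.
Proof. by move=> KI E' E i p [iI _ _] h; apply: KI. Qed.

(** One presentation of N tests all its extensions E: the projective module Q maps
    to E, and E is generated by the images of Q and E', so that a map given on E'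
    is extended by prescribing it on Q. *)
Lemma ext1z_pres N1 Q N K (j : {linear N1 -> Q}) (q : {linear Q -> N}) :
    ses j q -> projective Q ->
    (forall h : {linear N1 -> K}, exists k : {linear Q -> K}, forall x, k (j x) = h x) ->
  ext1z N K.
Proof.
move=> jq Qproj hext E' E i p ip h.
have [iI pS ex] := ip; have [_ qS _] := jq.
have [phi phiE] := Qproj E N p q pS.
have [psi psiE] : exists psi : {linear N1 -> E'}, forall x, i (psi x) = phi (j x).
  by apply: (ses_lift (h := phi \o j) ip) => e /=; rewrite phiE (ses0 _ jq).
have [k kE] := hext (h \o psi).
have [|||g gE] := @linear_of_rel R E K
  (fun e y => exists x e', e = phi x + i e' /\ y = k x + h e').
- move=> e; have [x qx] := qS (p e).
  have [|e' ie'] := (ex (e - phi x)).1; first by rewrite linearB phiE qx subrr.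
  by exists (k x + h e'), x, e'; rewrite ie' addrC subrK.
- move=> a e y e1 y1 [x [e' [-> ->]]] [x1 [e1' [-> ->]]].
  exists (a *: x + x1), (a *: e' + e1').
  by rewrite !linearP /= !scalerDr; split; rewrite addrACA.
- move=> y [x [e' [/esym e0 ->]]].
  have qx : q x = 0 by rewrite -phiE -[RHS](linear0 p) -e0 linearD (ses0 _ ip) addr0.
  have [_ _ exq] := jq; have [z jz] := (exq x).1 qx; subst x.
  rewrite kE /= -linearD; suff -> : psi z + e' = 0 by rewrite linear0.
  by apply: (lin_inj0 iI); rewrite linearD psiE.
exists g => x; apply/gE; exists 0, x; by rewrite !linear0 !add0r.
Qed.

Lemma ext1z_copres N K I C (j : {linear K -> I}) (q : {linear I -> C}) :
    ses j q -> injmod I ->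
    (forall h : {linear N -> C}, exists k : {linear N -> I}, forall x, q (k x) = h x) ->
  ext1z N K.
Proof.
move=> jq Iinj hext E' E i p ip h.
have [iI pS ex] := ip; have [jI qS exq] := jq.
have [phi phiE] := Iinj E' E i (j \o h) iI.
have [psi psiE] : exists psi : {linear N -> C}, forall x, psi (p x) = q (phi x).
  by apply: (ses_desc (h := q \o phi) ip) => y /=; rewrite phiE /= (ses0 _ jq).
have [k kE] := hext psi.
have [|g gE] := ses_lift (h := phi \- (k \o p)) jq.
  by move=> e /=; rewrite linearB kE psiE subrr.
exists g => x; apply: jI; rewrite gE /= phiE /= (ses0 _ ip) linear0 subr0 //.
Qed.

Lemma ext1z_proj N K : projective N -> ext1z N K.
Proof.
move=> NP E' E i p ip h; have [_ pS _] := ip.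
have [s sE] := NP E N p idfun pS.
have [r rE] : exists r : {linear E -> E'}, forall e, i (r e) = e - s (p e).
  apply: (ses_lift (h := idfun \- (s \o p)) ip) => e /=.
  by rewrite linearB sE subrr.
exists (h \o r) => x /=; congr (h _); case: (ip) => iI _ _; apply: iI.
by rewrite rE (ses0 _ ip) linear0 subr0.
Qed.

Lemma pullback M N L (f : {linear M -> L}) (g : {linear N -> L}) :
  exists (G : lmodType R) (a : {linear G -> M}) (b : {linear G -> N}),
    [/\ forall x, f (a x) = g (b x),
        forall x y, a x = a y -> b x = b y -> x = y &
        forall m n, f m = g n -> exists x, a x = m /\ b x = n].
Proof.
pose h : {linear (M * N)%type -> L} := (f \o fst) \- (g \o snd).
exists (mker h), (fst \o kin h), (snd \o kin h); split=> /=.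
- move=> x; apply/eqP; rewrite -subr_eq0; apply/eqP.
  by apply/(kinP h); exists x.
- by move=> x y e1 e2; apply: kin_inj;
    rewrite [LHS]surjective_pairing [RHS]surjective_pairing; congr pair.
- move=> m n mn; have [|x xE] := (kinP h (m, n)).1; first by rewrite /= mn subrr.
  by exists x; rewrite -![mker_val x]/(kin h x) xE.
Qed.

(** The obstruction to lifting a map from N to K through F is the extension of N
    by K1 that is pulled back along it. *)
Lemma ext1z_lift N K1 F K (j : {linear K1 -> F}) (q : {linear F -> K})
    (h : {linear N -> K}) : ext1z N K1 -> ses j q ->
  exists k : {linear N -> F}, forall x, q (k x) = h x.
Proof.
move=> NK1 jq; have [jI qS ex] := jq.
have [G [a [b [abE abI abS]]]] := pullback q h.
have [i iE] : exists i : {linear K1 -> G}, forall x, a (i x) = j x /\ b (i x) = 0.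
  have [|||i iE] := @linear_of_rel R K1 G (fun x g => a g = j x /\ b g = 0).
  - by move=> x; apply: abS; rewrite (ses0 _ jq) linear0.
  - by move=> c x y x' y' [e1 e2] [e1' e2']; rewrite !linearP e1 e2 e1' e2' scaler0 addr0.
  - by move=> y [e1 e2]; apply: abI; rewrite ?e1 ?e2 !linear0.
  by exists i => x; apply/iE.
have ib : ses i b.
  split=> [x y e|n|x].
  - by apply: jI; rewrite -(iE x).1 -(iE y).1 e.
  - by have [f fE] := qS (h n); have [x [_ <-]] := abS f n fE; exists x.
  - split=> [bx|[y <-]]; last by case: (iE y).
    have [|y jy] := (ex (a x)).1; first by rewrite abE bx linear0.
    by exists y; apply: abI; rewrite ?(iE y).1 ?(iE y).2.
have [r rE] := NK1 _ _ _ _ ib idfun.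
have [|k kE] := ses_desc (h := a \- (j \o r)) ib.
  by move=> y /=; rewrite rE (iE y).1 subrr.
exists k => n; have [_ bS _] := ib; have [g <-] := bS n.
by rewrite kE /= linearB abE (ses0 _ jq) subr0.
Qed.

(** Dimension shifting: with Q projective, Ext^1(N', K) is Ext^2(N, K), the next
    term after Ext^1(N, F) and Ext^1(N, K') in the long exact sequence. *)
Lemma ext1z_shift N' Q N K F K' (j : {linear N' -> Q}) (q : {linear Q -> N})
    (a : {linear K -> F}) (b : {linear F -> K'}) :
  ses j q -> projective Q -> ses a b -> ext1z N' K -> ext1z N F -> ext1z N K'.
Proof.
move=> jq QP ab N'K NF; apply: (ext1z_pres jq) => // h.
have [g gE] := ext1z_lift h N'K ab.
have [k kE] := NF _ _ _ _ jq g.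
by exists (b \o k) => x /=; rewrite kE gE.
Qed.

(** Here F is injective, and Ext^1(N, K') is Ext^2(N, K). *)
Lemma ext1z_unshift N' Q N K F K' (j : {linear N' -> Q}) (q : {linear Q -> N})
    (a : {linear K -> F}) (b : {linear F -> K'}) :
  ses j q -> ses a b -> injmod F -> ext1z Q K -> ext1z N K' -> ext1z N' K.
Proof.
move=> jq ab FI QK NK'; apply: (ext1z_copres ab) => // h.
have [g gE] := NK' _ _ _ _ jq h.
have [k kE] := ext1z_lift g QK ab.
by exists (k \o j) => x /=; rewrite kE gE.
Qed.

Lemma ext1z_retractl N N' K : retract N N' -> ext1z N' K -> ext1z N K.
Proof.
move=> [s [r sK]] N'K E' E i p ip h; have [iI pS ex] := ip.
have [G [a [b [abE abI abS]]]] := pullback p r.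
have [i' iE] : exists i' : {linear E' -> G}, forall x, a (i' x) = i x /\ b (i' x) = 0.
  have [|||i' iE] := @linear_of_rel R E' G (fun x g => a g = i x /\ b g = 0).
  - by move=> x; apply: abS; rewrite (ses0 _ ip) linear0.
  - by move=> c x y x' y' [e1 e2] [e1' e2']; rewrite !linearP e1 e2 e1' e2' scaler0 addr0.
  - by move=> y [e1 e2]; apply: abI; rewrite ?e1 ?e2 !linear0.
  by exists i' => x; apply/iE.
have ib : ses i' b.
  split=> [x y e|n|x].
  - by apply: iI; rewrite -(iE x).1 -(iE y).1 e.
  - by have [f fE] := pS (r n); have [x [_ <-]] := abS f n fE; exists x.
  - split=> [bx|[y <-]]; last by case: (iE y).
    have [|y jy] := (ex (a x)).1; first by rewrite abE bx linear0.
    by exists y; apply: abI; rewrite ?(iE y).1 ?(iE y).2.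
have [k kE] := N'K _ _ _ _ ib h.
have [|||t tE] := @linear_of_rel R E G (fun e g => a g = e /\ b g = s (p e)).
- by move=> e; apply: abS; rewrite sK.
- by move=> c x y x' y' [e1 e2] [e1' e2']; rewrite !linearP e1 e2 e1' e2'.
- by move=> y [e1 e2]; apply: abI; rewrite ?e1 ?e2 !linear0.
exists (k \o t) => x /=; rewrite -kE; congr (k _).
by apply/tE; rewrite (ses0 _ ip) linear0; apply: iE.
Qed.

Lemma ext1z_retractr N K K' : retract K K' -> ext1z N K' -> ext1z N K.
Proof.
move=> [s [r sK]] NK' E' E i p ip h.
have [k kE] := NK' _ _ _ _ ip (s \o h).
by exists (r \o k) => x /=; rewrite kE /= sK.
Qed.

Lemma ext1z_extl N1 N N2 K (j : {linear N1 -> N}) (q : {linear N -> N2}) :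
  ses j q -> ext1z N1 K -> ext1z N2 K -> ext1z N K.
Proof.
move=> jq N1K N2K E' E i p ip h; have [iI pS ex] := ip; have [jI qS exq] := jq.
pose E1 := mker (q \o p).
have ses2 : ses (kin (q \o p)) (q \o p).
  by apply: ses_kin => y; have [n <-] := qS y; have [e <-] := pS n; exists e.
have [i1 i1E] : exists i1 : {linear E' -> E1}, forall x, kin _ (i1 x) = i x.
  by apply: (ses_lift ses2) => e /=; rewrite (ses0 _ ip) linear0.
have [p1 p1E] : exists p1 : {linear E1 -> N1}, forall x, j (p1 x) = p (kin _ x).
  apply: (ses_lift (h := p \o kin _) jq) => e.
  exact: (ses0 e ses2).
have ses1 : ses i1 p1.
  split=> [x y e|n|x].
  - by apply: iI; rewrite -!i1E e.
  - have [e eE] := pS (j n).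
    have [|x xE] := (kinP (q \o p) e).1; first by rewrite /= eE (ses0 _ jq).
    by exists x; apply: jI; rewrite p1E xE.
  - split=> [p1x|[y <-]]; last by apply: jI; rewrite p1E i1E linear0 (ses0 _ ip).
    have [|y iy] := (ex (kin _ x)).1; first by rewrite -p1E p1x linear0.
    by exists y; apply: kin_inj; rewrite i1E.
have [k1 k1E] := N1K _ _ _ _ ses1 h.
have [k kE] := N2K _ _ _ _ ses2 k1.
by exists k => x; rewrite -i1E kE k1E.
Qed.

(** The map from E' to K is first extended modulo K1. Pulling this extension back
    to K gives a module that is an extension of N by K1 + E', on which the
    projection to K1 extends; its extension corrects the first choice. *)
Lemma ext1z_extr N K1 K K2 (j : {linear K1 -> K}) (q : {linear K -> K2}) :
  ses j q -> ext1z N K1 -> ext1z N K2 -> ext1z N K.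
Proof.
move=> jq NK1 NK2 E' E i p ip h; have [iI pS ex] := ip; have [jI qS exq] := jq.
have [k2 k2E] := NK2 _ _ _ _ ip (q \o h).
have [G [a [b [abE abI abS]]]] := pullback k2 q.
pose m : {linear (K1 * E')%type -> K} := (j \o fst) \+ (h \o snd).
have [i' iE] : exists i' : {linear (K1 * E')%type -> G},
    forall x, a (i' x) = i x.2 /\ b (i' x) = m x.
  have [|||i' iE] := @linear_of_rel R (K1 * E')%type G (fun x g => a g = i x.2 /\ b g = m x).
  - by move=> x; apply: abS; rewrite k2E /= linearD (ses0 _ jq) add0r.
  - move=> c x y x' y' [e1 e2] [e1' e2'].
    by rewrite [a _]linearP e1 e1' [b _]linearP e2 e2' -!linearP.
  - by move=> y [e1 e2]; apply: abI; rewrite ?e1 ?e2 !linear0.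
  by exists i' => x; apply/iE.
have sG : ses i' (p \o a).
  split=> [x y e|n|x] /=.
  - case: x y e => [x1 x2] [y1 y2] e.
    have e2 : x2 = y2 by apply: iI; rewrite -(iE (x1, x2)).1 -(iE (y1, y2)).1 e.
    have := (iE (x1, x2)).2; rewrite e (iE (y1, y2)).2 /m /= e2 => /addIr/jI ->.
    by [].
  - have [e eE] := pS n; have [k kE] := qS (k2 e).
    by have [|x [ax _]] := abS e k; [rewrite kE|exists x; rewrite /= ax].
  - split=> [/ex[e' ie']|[y <-]]; last by rewrite (iE y).1 (ses0 _ ip).
    have [|k1 jk1] := (exq (b x - h e')).1.
      by rewrite linearB -abE -ie' k2E /= subrr.
    exists (k1, e'); apply: abI; rewrite ?(iE _).1 ?(iE _).2 //=.
    by rewrite /m /= jk1 subrK.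
have [r rE] := NK1 _ _ _ _ sG fst.
have [|||g gE] := @linear_of_rel R E K (fun e y => exists x, a x = e /\ y = b x - j (r x)).
- move=> e; have [k kE] := qS (k2 e).
  have [|x [ax bx]] := abS e k; first by rewrite kE.
  by exists (b x - j (r x)), x.
- move=> c e y e' y' [x [<- ->]] [x' [<- ->]]; exists (c *: x + x').
  rewrite [a _]linearP; split=> //.
  by rewrite [b (_ + _)]linearP [r (_ + _)]linearP [j (_ + _)]linearP scalerBr
    opprD addrACA.
- move=> y [x [ax ->]].
  have [|k1 jk1] := (exq (b x)).1; first by rewrite -abE ax linear0.
  have -> : x = i' (k1, 0).
    by apply: abI; rewrite ?(iE _).1 ?(iE _).2 /m /= ?linear0 ?addr0.
  by rewrite rE (iE _).2 /m /= linear0 addr0 subrr.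
exists g => x; apply/gE; exists (i' (0, x)).
by rewrite (iE _).1 (iE _).2 rE /m /= linear0 subr0 add0r.
Qed.

Lemma projective_retract P Q : retract P Q -> projective Q -> projective P.
Proof.
move=> [s [r sK]] QP M N p h pS; have [k kE] := QP _ _ p (h \o r) pS.
by exists (k \o s) => x /=; rewrite kE /= sK.
Qed.
Lemma injmod_retract I J : retract I J -> injmod J -> injmod I.
Proof.
move=> [s [r sK]] JI M N i h iI; have [k kE] := JI _ _ i (s \o h) iI.
by exists (r \o k) => x /=; rewrite kE /= sK.
Qed.

Lemma injmodP K : injmod K <-> forall N, ext1z N K.
Proof.
split=> [KI N|extK M N i h iI]; first exact: ext1z_inj.
exact: (extK _ _ _ _ _ (ses_cpi iI) h).
Qed.

Lemma ses_can M N (f : {linear M -> N}) (g : {linear N -> M}) :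
  cancel f g -> cancel g f -> ses (\0 : {linear 'rV[R]_0 -> M}) f.
Proof.
move=> fK gK; split=> [x y _|y|x]; first by apply/matrixP => i [].
  by exists (g y); rewrite gK.
split=> [fx|[y <-]]; last exact: linear0.
by exists 0; apply: (can_inj fK); rewrite fx !linear0.
Qed.

Fact pinl_linear M N : linear (fun x : M => (x, 0) : (M * N)%type).
Proof. by move=> a x y; rewrite [RHS]surjective_pairing /= scaler0 addr0. Qed.
Definition pinl M N : {linear M -> (M * N)%type} := mklin (@pinl_linear M N).
Fact pinr_linear M N : linear (fun y : N => (0, y) : (M * N)%type).
Proof. by move=> a x y; rewrite [RHS]surjective_pairing /= scaler0 addr0. Qed.
Definition pinr M N : {linear N -> (M * N)%type} := mklin (@pinr_linear M N).

Lemma ses_pinl M N : ses (pinl M N) snd.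
Proof.
split=> [x y e|y|[x y]]; [exact: (congr1 fst e)|by exists (0, y)|].
by split=> [y0|[z e]]; [exists x; rewrite -[y]/((x, y).2) [X in (x, X)]y0|exact: (esym (congr1 snd e))].
Qed.

Lemma ses_pinr M N : ses (pinr M N) fst.
Proof.
split=> [x y e|x|[x y]]; [exact: (congr1 snd e)|by exists (x, 0)|].
by split=> [x0|[z e]]; [exists y; rewrite -[x]/((x, y).1) [X in (X, y)]x0|exact: (esym (congr1 fst e))].
Qed.

End Ses.

(** The components of a map between quadruples are linear over different rings;
    hence a statement about maps of sets with base points. *)
Definition exact_at (S T Z : Type) (h : S -> T) (k : T -> Z) (z : Z) : Prop :=
  [/\ injective h, surj k & forall x, k x = z <-> exists y, h y = x].

Lemma pair_exact (X1 X2 X3 Y1 Y2 Y3 : Type) (h1 : X1 -> X2) (k1 : X2 -> X3)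
    (h2 : Y1 -> Y2) (k2 : Y2 -> Y3) (h : X1 * Y1 -> X2 * Y2) (k : X2 * Y2 -> X3 * Y3)
    (x0 : X1) (y0 : Y1) x3 y3 :
  (forall x y, h (x, y) = (h1 x, h2 y)) -> (forall x y, k (x, y) = (k1 x, k2 y)) ->
  exact_at h k (x3, y3) <-> exact_at h1 k1 x3 /\ exact_at h2 k2 y3.
Proof.
move=> hE kE; split=> [[hI kS ex]|[[hI1 kS1 ex1] [hI2 kS2 ex2]]].
  have : k (h (x0, y0)) = (x3, y3) by apply/ex; exists (x0, y0).
  rewrite hE kE => -[e1 e2].
  split; split=> [x x' e|z|x].
  - by have [] : (x, y0) = (x', y0) by apply: hI; rewrite !hE e.
  - by have [[x y]] := kS (z, y3); rewrite kE => -[<- _]; exists x.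
  - split=> [kx|[x' <-]].
      have [|[x' y']] := (ex (x, h2 y0)).1; first by rewrite kE kx e2.
      by rewrite hE => -[<- _]; exists x'.
    have : k (h (x', y0)) = (x3, y3) by apply/ex; exists (x', y0).
    by rewrite hE kE => -[].
  - by have [] : (x0, x) = (x0, x') by apply: hI; rewrite !hE e.
  - by have [[x y]] := kS (x3, z); rewrite kE => -[_ <-]; exists y.
  - split=> [ky|[y' <-]].
      have [|[x' y']] := (ex (h1 x0, x)).1; first by rewrite kE ky e1.
      by rewrite hE => -[_ <-]; exists y'.
    have : k (h (x0, y')) = (x3, y3) by apply/ex; exists (x0, y').
    by rewrite hE kE => -[].
split=> [[x y] [x' y']|[x y]|[x y]].
- by rewrite !hE => -[/hI1-> /hI2->].
- by have [x' <-] := kS1 x; have [y' <-] := kS2 y; exists (x', y'); rewrite kE.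
- rewrite kE; split=> [[/ex1[x' <-] /ex2[y' <-]]|[[x' y']]].
    by exists (x', y'); rewrite hE.
  by rewrite hE => -[<- <-]; congr pair; [apply/ex1; exists x'|apply/ex2; exists y'].
Qed.

Lemma ses_prod2 (R : nzRingType) (X1 X2 X3 Y1 Y2 Y3 : lmodType R)
    (h1 : {linear X1 -> X2}) (k1 : {linear X2 -> X3}) (h2 : {linear Y1 -> Y2})
    (k2 : {linear Y2 -> Y3}) (h : {linear (X1 * Y1)%type -> (X2 * Y2)%type})
    (k : {linear (X2 * Y2)%type -> (X3 * Y3)%type}) :
  ses h1 k1 -> ses h2 k2 -> (forall x y, h (x, y) = (h1 x, h2 y)) ->
  (forall x y, k (x, y) = (k1 x, k2 y)) -> ses h k.
Proof. by move=> s1 s2 hE kE; apply/(pair_exact 0 0 0 0 hE kE). Qed.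

(** * Ding projective and Ding injective modules as classes *)

Section TotalResolutions.
Variable R : nzRingType.
Implicit Types (T C : lmodType R -> Prop) (M N P F E : lmodType R).

Definition linked T M M' : Prop :=
  exists P (i : {linear M -> P}) (p : {linear P -> M'}), T P /\ ses i p.

Lemma linked_isol T M N L : isomorphic M N -> linked T N L -> linked T M L.
Proof.
move=> MN [P [i [p [TP ip]]]]; have [i' ip'] := ses_iso_sub MN ip.
by exists P, i', p.
Qed.

Lemma linked_isor T M N L : isomorphic M N -> linked T L M -> linked T L N.
Proof.
move=> MN [P [i [p [TP ip]]]]; have [p' ip'] := ses_iso_quo MN ip.
by exists P, i, p'.
Qed.

Lemma linked_orbit T C M : C M ->
    (forall M, C M -> exists M', C M' /\ linked T M' M) ->
    (forall M, C M -> exists M', C M' /\ linked T M M') ->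
  exists N : int -> lmodType R,
    N 0 = M /\ forall i, C (N i) /\ linked T (N i) (N (i + 1)).
Proof.
move=> CM Cl Cr; pose S := {M | C M}.
have /choice[l lE] : forall x : S, exists y : S, linked T (sval y) (sval x).
  move=> [K CK].
  by have [K' [CK' lk]] := Cl K CK; exists (exist _ K' CK').
have /choice[r rE] : forall x : S, exists y : S, linked T (sval x) (sval y).
  move=> [K CK].
  by have [K' [CK' lk]] := Cr K CK; exists (exist _ K' CK').
pose s0 : S := exist _ M CM.
pose s (i : int) : S :=
  match i with Posz n => iter n r s0 | Negz n => iter n.+1 l s0 end.
exists (fun i => sval (s i)); split=> // i; split; first exact: (svalP (s i)).
case: i => n.
- have -> : Posz n + 1 = Posz n.+1 by rewrite -PoszD addn1.
  exact: rE.
- case: n => [|n]; first exact: lE.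
  have -> : Negz n.+1 + 1 = Negz n.
    by rewrite !NegzE -[n.+2]addn1 PoszD opprD subrK.
  exact: lE.
Qed.

Lemma linked_choice T (N : int -> lmodType R) :
    (forall i, linked T (N i) (N (i + 1))) ->
  exists (P : int -> lmodType R) (a : forall i, {linear N i -> P i})
    (b : forall i, {linear P i -> N (i + 1)}),
    forall i, T (P i) /\ ses (a i) (b i).
Proof.
move=> lk.
have {}lk i : {P : lmodType R & {a : {linear N i -> P} &
    {b : {linear P -> N (i + 1)} | T P /\ ses a b}}}.
  by have [P /cid[a /cid[b h]]] := cid (lk i); exists P, a, b.
exists (fun i => projT1 (lk i)), (fun i => projT1 (projT2 (lk i))).
exists (fun i => sval (projT2 (projT2 (lk i)))) => i.
exact: (svalP (projT2 (projT2 (lk i)))).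
Qed.

Section Splice.
Variables (N P : int -> lmodType R) (a : forall i, {linear N i -> P i}).
Variable b : forall i, {linear P i -> N (i + 1)}.
Hypothesis ab : forall i, ses (a i) (b i).

Definition splice : complex R := Complex (fun i => a (i + 1) \o b i).

Lemma splice_exact : exact_complex splice.
Proof.
move=> i x /=; have [aI _ _] := ab (i + 1 + 1); have [_ _ ex] := ab (i + 1).
split=> [/(lin_inj0 aI)/ex[y <-]|[y <-]]; last by rewrite (ses0 _ (ab _)) linear0.
by have [_ bS _] := ab i; have [z <-] := bS y; exists z.
Qed.

Lemma splice_mim i : isomorphic (N (i + 1)) (mim (cdiff splice i)).
Proof.
have [aI _ ex] := ab (i + 1); have [_ bS _] := ab i.
have [q [qS qE]] := mim_onto (cdiff splice i).
have [|f fE] := ses_desc (h := q) (ab i).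
  by move=> y; apply: iin_inj; rewrite qE /= (ses0 _ (ab i)) !linear0.
apply: (iso_bij (f := f)) => [|y].
  apply: lin_inj => x fx; have [y yx] := bS x; subst x; rewrite fE in fx.
  by apply: (lin_inj0 aI); rewrite -[LHS]/(cdiff splice i y) -qE fx linear0.
by have [x <-] := qS y; exists (b i x).
Qed.

Lemma splice_mker i : isomorphic (N i) (mker (cdiff splice i)).
Proof.
have [aI' _ _] := ab (i + 1); have [aI _ ex] := ab i.
have [|f fE] := ker_lift (f := cdiff splice i) (h := a i).
  by move=> x; rewrite /= (ses0 _ (ab i)) linear0.
apply: (iso_bij (f := f)) => [x y e|y]; first by apply: aI; rewrite -!fE e.
have : cdiff splice i (kin _ y) = 0 by apply/kinP; exists y.
move=> /= /(lin_inj0 aI')/ex[x xE]; exists x; apply: kin_inj.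
by rewrite fE.
Qed.
End Splice.

Definition iso_closed C : Prop := forall M N, isomorphic M N -> C M -> C N.

(** A Ding projective module lies in a class of modules that is closed under
    syzygies and cosyzygies and is Ext^1-orthogonal to flat modules. Classes
    replace complexes indexed by the integers, and orthogonality holds at every
    place of the complex at once. *)
Definition DP_class C : Prop := forall M, C M ->
  [/\ exists M', C M' /\ linked (@projective R) M' M,
      exists M', C M' /\ linked (@projective R) M M' &
      forall F, flat F -> ext1z M F].

Lemma linked_mim (P : complex R) i : exact_complex P ->
  exists q : {linear P (i + 1) -> mim (cdiff P (i + 1))},
    ses (iin (cdiff P i)) q /\ forall x, iin _ (q x) = cdiff P (i + 1) x.
Proof.
move=> Pex; have [q [qS qE]] := mim_onto (cdiff P (i + 1)).
exists q; split=> //; split=> // [|x]; first exact: iin_inj.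
rewrite iinP -Pex -qE; split=> [->|]; first by rewrite linear0.
exact: (lin_inj0 (@iin_inj _ _ _ _)).
Qed.

Lemma DP_class_of M : DP M -> exists C, [/\ DP_class C, iso_closed C & C M].
Proof.
move=> [P [Pproj Pex PF MP]].
exists (fun L => exists i, isomorphic L (mim (cdiff P i))); split; last by exists (-1).
  move=> L [i Li]; split.
  - exists (mim (cdiff P (i - 1))); split; first by exists (i - 1); apply: iso_refl.
    have [j ij] : exists j, i = j + 1 by exists (i - 1); rewrite subrK.
    subst i; rewrite addrK; have [q [qses _]] := linked_mim j Pex.
    by apply: (linked_isor (iso_sym Li)); exists (P (j + 1)), (iin _), q.
  - exists (mim (cdiff P (i + 1))); split; first by exists (i + 1); apply: iso_refl.
    have [q [qses _]] := linked_mim i Pex.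
    by apply: (linked_isol Li); exists (P (i + 1)), (iin _), q.
  - move=> F Fflat; apply: (ext1z_retractl (iso_retract Li)).
    have [j ij] : exists j, i = j + 1 by exists (i - 1); rewrite subrK.
    subst i; have [l ij] : exists l, j = l + 1 by exists (j - 1); rewrite subrK.
    subst j; have [q [qses _]] := linked_mim (l + 1) Pex.
    apply: (ext1z_pres qses) => // h.
    have [q' [q's q'E]] := linked_mim l Pex; have [_ q'S _] := q's.
    have [|k kE] := (PF F Fflat l (h \o q')).1.
      move=> x /=; suff -> : q' (cdiff P l x) = 0 by rewrite linear0.
      by apply: iin_inj; rewrite q'E linear0; apply/Pex; exists x.
    by exists k => y; have [x <-] := q'S y; rewrite q'E kE.
by move=> K L KL [i Ki]; exists i; apply: iso_trans (iso_sym KL) Ki.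
Qed.

(** Syzygies and cosyzygies chosen within the class, indexed by the integers, are
    spliced into a total resolution. *)
Lemma DP_of_class C M : DP_class C -> C M -> DP M.
Proof.
move=> Cclass CM.
have [||N [N0 Nlk]] := linked_orbit (T := @projective R) CM.
- by move=> K /Cclass[].
- by move=> K /Cclass[].
have [P [a [b ab]]] := linked_choice (fun i => (Nlk i).2).
have ses_ab i := (ab i).2.
exists (splice a b); split.
- by move=> i; case: (ab i).
- exact: splice_exact.
- move=> F Fflat i h; split=> [hd|[k kE] x]; last first.
    by rewrite -kE /= (ses0 _ (ses_ab _)) !linear0.
  have [|h' h'E] := ses_desc (h := h) (ses_ab (i + 1)).
    by move=> y; have [_ bS _] := ses_ab i; have [z <-] := bS y; apply: hd.
  have [_ _ extF] := Cclass _ (Nlk (i + 1 + 1 + 1)).1.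
  have [k kE] := extF F Fflat _ _ _ _ (ses_ab (i + 1 + 1)) h'.
  by exists k => x /=; rewrite kE h'E.
- rewrite -N0; have -> : (0 : int) = -1 + 1 by rewrite addNr.
  exact: splice_mim.
Qed.

Definition DI_class C : Prop := forall M, C M ->
  [/\ exists M', C M' /\ linked (@injmod R) M' M,
      exists M', C M' /\ linked (@injmod R) M M' &
      forall E, FP_injective E -> ext1z E M].

Lemma linked_mker (I : complex R) i : exact_complex I ->
  exists q : {linear I i -> mker (cdiff I (i + 1))},
    ses (kin (cdiff I i)) q /\ forall x, kin _ (q x) = cdiff I i x.
Proof.
move=> Iex.
have [|q qE] := ker_lift (f := cdiff I (i + 1)) (h := cdiff I i).
  by move=> x; apply/Iex; exists x.
exists q; split=> //; split=> [|y|x]; first exact: kin_inj.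
- have /Iex[x xE] : cdiff I (i + 1) (kin _ y) = 0 by apply/kinP; exists y.
  by exists x; apply: kin_inj; rewrite qE.
- rewrite -kinP -qE; split=> [->|]; first by rewrite linear0.
  exact: (lin_inj0 (@kin_inj _ _ _ _)).
Qed.

Lemma DI_class_of M : DI M -> exists C, [/\ DI_class C, iso_closed C & C M].
Proof.
move=> [I [Iinj Iex IE MI]].
exists (fun L => exists i, isomorphic L (mker (cdiff I i))); split; last by exists 0.
  move=> L [i Li]; split.
  - exists (mker (cdiff I (i - 1))); split; first by exists (i - 1); apply: iso_refl.
    have [j ij] : exists j, i = j + 1 by exists (i - 1); rewrite subrK.
    subst i; rewrite addrK; have [q [qses _]] := linked_mker j Iex.
    by apply: (linked_isor (iso_sym Li)); exists (I j), (kin _), q.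
  - exists (mker (cdiff I (i + 1))); split; first by exists (i + 1); apply: iso_refl.
    have [q [qses _]] := linked_mker i Iex.
    by apply: (linked_isol Li); exists (I i), (kin _), q.
  - move=> E Efp; apply: (ext1z_retractr (iso_retract Li)).
    have [q [qses qE]] := linked_mker i Iex.
    apply: (ext1z_copres qses) => // h.
    have [|k kE] := (IE E Efp i (kin _ \o h)).1.
      by move=> x /=; apply/kinP; exists (h x).
    by exists k => x; apply: kin_inj; rewrite qE kE.
by move=> K L KL [i Ki]; exists i; apply: iso_trans (iso_sym KL) Ki.
Qed.

Lemma DI_of_class C M : DI_class C -> C M -> DI M.
Proof.
move=> Cclass CM.
have [||N [N0 Nlk]] := linked_orbit (T := @injmod R) CM.
- by move=> K /Cclass[].
- by move=> K /Cclass[].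
have [I [a [b ab]]] := linked_choice (fun i => (Nlk i).2).
have ses_ab i := (ab i).2.
exists (splice a b); split.
- by move=> i; case: (ab i).
- exact: splice_exact.
- move=> E Efp i h; split=> [hd|[k kE] x]; last first.
    by rewrite -kE /= (ses0 _ (ses_ab _)) linear0.
  have [|h' h'E] := ses_lift (h := h) (ses_ab (i + 1)).
    by move=> y; have [aI _ _] := ses_ab (i + 1 + 1); apply: (lin_inj0 aI); apply: hd.
  have [_ _ extE] := Cclass _ (Nlk i).1.
  have [k kE] := ext1z_lift h' (extE E Efp) (ses_ab i).
  by exists k => x /=; rewrite kE h'E.
- by rewrite -N0; exact: splice_mker.
Qed.

(** * Resolutions and dimension shifting *)

Definition syzseq T (Z : nat -> lmodType R) : Prop :=
  forall i, linked T (Z i.+1) (Z i).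
Definition cosyzseq T (K : nat -> lmodType R) : Prop :=
  forall i, linked T (K i) (K i.+1).

(** Ext^1(Z_i, K_(j+1)) and Ext^1(Z_(i+1), K_j) both are Ext^2(Z_i, K_j). *)
Lemma ext1z_balance Z K i j : syzseq (@projective R) Z -> cosyzseq (@injmod R) K ->
  ext1z (Z i.+1) (K j) <-> ext1z (Z i) (K j.+1).
Proof.
move=> ZP KI; have [P [a [b [PP ab]]]] := ZP i; have [I [c [d [II cd]]]] := KI j.
split=> h; first by apply: (ext1z_shift ab PP cd h); apply: ext1z_inj.
by apply: (ext1z_unshift ab cd II) => //; apply: ext1z_proj.
Qed.

Lemma ext1z_balanceD Z K i j m : syzseq (@projective R) Z -> cosyzseq (@injmod R) K ->
  ext1z (Z (i + m)%N) (K j) <-> ext1z (Z i) (K (j + m)%N).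
Proof.
move=> ZP KI; elim: m i j => [|m IHm] i j; first by rewrite !addn0.
by rewrite !addnS -addSn IHm; apply: ext1z_balance.
Qed.

Lemma syzseq_exists T C M : C M ->
  (forall M, C M -> exists M', C M' /\ linked T M' M) ->
  exists Z, [/\ Z 0 = M, syzseq T Z & forall i, C (Z i)].
Proof.
move=> CM Cl; pose S := {M | C M}.
have /choice[l lE] : forall x : S, exists y : S, linked T (sval y) (sval x).
  move=> [K CK].
  by have [K' [CK' lk]] := Cl K CK; exists (exist _ K' CK').
exists (fun i => sval (iter i l (exist _ M CM))); split=> // i.
  exact: (lE (iter i l (exist _ M CM))).
exact: svalP.
Qed.

Lemma cosyzseq_exists T C M : C M ->
  (forall M, C M -> exists M', C M' /\ linked T M M') ->
  exists K, [/\ K 0 = M, cosyzseq T K & forall i, C (K i)].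
Proof.
move=> CM Cl; pose S := {M | C M}.
have /choice[l lE] : forall x : S, exists y : S, linked T (sval x) (sval y).
  move=> [K CK].
  by have [K' [CK' lk]] := Cl K CK; exists (exist _ K' CK').
exists (fun i => sval (iter i l (exist _ M CM))); split=> // i.
exact: svalP.
Qed.

Definition rsyz M (P : resolution M) (n : nat) : lmodType R :=
  if n is k.+1 then mim (rdiff P k) else M.

Definition rsyz_in M (P : resolution M) n : {linear rsyz P n.+1 -> P n} :=
  iin (rdiff P n).

Lemma rsyz_out M (P : resolution M) n : exists q : {linear P n -> rsyz P n},
  ses (rsyz_in P n) q /\
  match n return {linear P n -> rsyz P n} -> Prop with
  | 0 => fun q => q =1 raug P
  | k.+1 => fun q => forall x, rsyz_in P k (q x) = rdiff P k x
  end q.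
Proof.
case: n => [|n].
  exists (raug P); split=> //; split; first exact: iin_inj.
    exact: raug_surj.
  by move=> x; rewrite rexact0 iinP.
have [q [qS qE]] := mim_onto (rdiff P n); exists q; split=> //.
split=> // [|x]; first exact: iin_inj.
rewrite iinP -rexact -qE; split=> [->|]; first by rewrite linear0.
exact: (lin_inj0 (@iin_inj _ _ _ _)).
Qed.

Lemma rsyz_seq T M (P : resolution M) : (forall i, T (P i)) -> syzseq T (rsyz P).
Proof.
by move=> TP i; have [q [h _]] := rsyz_out P i; exists (P i), (rsyz_in P i), q.
Qed.

Lemma finite_dimP T M : iso_closed T ->
  finite_dim T M -> exists Z n, [/\ Z 0 = M, syzseq T Z & T (Z n)].
Proof.
move=> Tiso [n [P [TP P0]]]; exists (rsyz P), n; split=> //.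
  exact: rsyz_seq.
have [q [[_ qS ex] _]] := rsyz_out P n; apply: Tiso (TP n).
apply: (iso_bij (f := q)) => //; apply: lin_inj => x /ex[y <-].
suff -> : y = 0 by rewrite linear0.
apply: iin_inj; rewrite linear0; have [|z <-] := (iinP (rdiff P n) (iin _ y)).1.
  by exists y.
by rewrite (P0 n.+1 (ltnSn n) z) linear0.
Qed.

(** Within a class [S] closed under cosyzygies the Ext^1 of interest is an Ext^1
    with values in cosyzygies of K of any index, hence zero when one of them is
    injective. *)
Lemma ext1z_coresolution (S T : lmodType R -> Prop) K n :
    (forall Y, S Y -> exists2 Y', S Y' & linked T Y Y') ->
    cosyzseq (@injmod R) K -> injmod (K n) ->
    (forall Q i, T Q -> ext1z Q (K i)) ->
  forall Y, S Y -> ext1z Y (K 0).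
Proof.
move=> ST KI Kn QK Y SY; have : forall m, (m <= n)%N -> forall Y, S Y -> ext1z Y (K (n - m)%N).
  elim=> [_ L _|m IHm lt_mn L SL]; first by rewrite subn0; apply: ext1z_inj.
  have [L' SL' [Q [a [b [TQ ab]]]]] := ST L SL.
  have [I [c [d [II cd]]]] := KI (n - m.+1)%N.
  move: c d cd; rewrite -subSn // subSS => c d cd.
  by apply: (ext1z_unshift ab cd II); [exact: QK|apply: IHm => //; exact: ltnW].
by move/(_ n (leqnn n) Y SY); rewrite subnn.
Qed.

Lemma ext1z_resolution (S T : lmodType R -> Prop) Z n :
    (forall Y, S Y -> exists2 Y', S Y' & linked T Y' Y) ->
    syzseq (@projective R) Z -> projective (Z n) ->
    (forall Q i, T Q -> ext1z (Z i) Q) ->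
  forall Y, S Y -> ext1z (Z 0) Y.
Proof.
move=> ST ZP Zn QZ Y SY; have : forall m, (m <= n)%N -> forall Y, S Y -> ext1z (Z (n - m)%N) Y.
  elim=> [_ L _|m IHm lt_mn L SL]; first by rewrite subn0; apply: ext1z_proj.
  have [L' SL' [Q [a [b [TQ ab]]]]] := ST L SL.
  have [I [c [d [II cd]]]] := ZP (n - m.+1)%N.
  move: c d cd; rewrite -subSn // subSS => c d cd.
  by apply: (ext1z_shift cd II ab); [apply: IHm => //; exact: ltnW|exact: QZ].
by move/(_ n (leqnn n) Y SY); rewrite subnn.
Qed.

(** Here the members of the finite sequence need only be orthogonal to the class,
    while it is the class that provides the projective modules. *)
Lemma ext1z_syzygy_dim (S : lmodType R -> Prop) T Z n :
    (forall Y, S Y -> exists2 Y', S Y' & linked (@projective R) Y' Y) ->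
    syzseq T Z -> (forall Q Y, T Q -> S Y -> ext1z Y Q) -> T (Z n) ->
  forall Y, S Y -> ext1z Y (Z 0).
Proof.
move=> SP ZT TS Zn Y SY; have : forall m, (m <= n)%N -> forall Y, S Y -> ext1z Y (Z (n - m)%N).
  elim=> [_ L SL|m IHm lt_mn L SL]; first by rewrite subn0; apply: TS.
  have [L' SL' [Q [a [b [QP ab]]]]] := SP L SL.
  have [I [c [d [TI cd]]]] := ZT (n - m.+1)%N.
  move: c d cd; rewrite -subSn // subSS => c d cd.
  by apply: (ext1z_shift ab QP cd); [apply: IHm => //; exact: ltnW|exact: TS].
by move/(_ n (leqnn n) Y SY); rewrite subnn.
Qed.

Lemma ext1z_cosyzygy_dim (S : lmodType R -> Prop) T K n :
    (forall Y, S Y -> exists2 Y', S Y' & linked (@injmod R) Y Y') ->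
    cosyzseq T K -> (forall Q Y, T Q -> S Y -> ext1z Q Y) -> T (K n) ->
  forall Y, S Y -> ext1z (K 0) Y.
Proof.
move=> SP ZT TS Zn Y SY; have : forall m, (m <= n)%N -> forall Y, S Y -> ext1z (K (n - m)%N) Y.
  elim=> [_ L SL|m IHm lt_mn L SL]; first by rewrite subn0; apply: TS.
  have [L' SL' [Q [a [b [QP ab]]]]] := SP L SL.
  have [I [c [d [TI cd]]]] := ZT (n - m.+1)%N.
  move: c d cd; rewrite -subSn // subSS => c d cd.
  by apply: (ext1z_unshift cd ab QP); [exact: TS|apply: IHm => //; exact: ltnW].
by move/(_ n (leqnn n) Y SY); rewrite subnn.
Qed.

End TotalResolutions.

(** * An injective cogenerator of abelian groups *)

Definition divisible (D : zmodType) : Prop :=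
  forall (n : nat) (y : D), (0 < n)%N -> exists d, d *+ n = y.

Lemma morph_add0 (G H : zmodType) (f : G -> H) :
  {morph f : x y / x + y} -> f 0 = 0.
Proof. by move=> fD; apply: (addrI (f 0)); rewrite -fD !addr0. Qed.

Lemma morph_addN (G H : zmodType) (f : G -> H) :
  {morph f : x y / x + y} -> {morph f : x / - x}.
Proof.
by move=> fD x; apply: (addrI (f x)); rewrite -fD !subrr (morph_add0 fD).
Qed.

(** Baer's argument: among partial homomorphisms extending [h], ordered by
    inclusion of graphs, a maximal one is defined everywhere, because its value
    at a new element can be chosen by divisibility at the least multiple of it
    that lies in the domain. *)
Lemma divisible_injective (D : zmodType) : divisible D ->
  forall (G H : zmodType) (i : G -> H) (h : G -> D),
    {morph i : x y / x + y} -> {morph h : x y / x + y} -> injective i ->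
  exists k : H -> D, {morph k : x y / x + y} /\ forall x, k (i x) = h x.
Proof.
move=> Ddiv G H i h iD hD iI.
pose P (A : set (H * D)) := [/\
  forall x y x' y', A (x, y) -> A (x', y') -> A (x - x', y - y'),
  forall y, A (0, y) -> y = 0 &
  forall z, A z -> forall g, A (i g, h g)].
have [|A [PA Amax]] := @Zorn_bigcup _ P.
  move=> F FP Ftot; split.
  - move=> x y x' y' [A FA Axy] [B FB Bxy].
    have [AB|BA] := Ftot A B FA FB.
      by exists B => //; have [S _ _] := FP B FB; apply: S => //; apply: AB.
    by exists A => //; have [S _ _] := FP A FA; apply: S => //; apply: BA.
  - by move=> y [A FA Ay]; have [_ f0 _] := FP A FA; apply: f0.
  - by move=> z [A FA Az] g; exists A => //; have [_ _ ext] := FP A FA; apply: (ext z).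
have i0 := morph_add0 iD; have h0 := morph_add0 hD.
have iN := morph_addN iD; have hN := morph_addN hD.
have Aext g : A (i g, h g).
  have [[z Az]|A0] := pselect (exists z, A z).
    by have [_ _ ext] := PA; apply: (ext z).
  pose B : set (H * D) := fun z => exists g, z = (i g, h g).
  exfalso; apply: (Amax B).
    split=> [z Az|BA]; first by case: A0; exists z.
    by case: A0; exists (i 0, h 0); apply: BA; exists 0.
  split=> [_ _ _ _ [g1 [-> ->]] [g2 [-> ->]]|y [g1 [e ->]]|z _ g1].
  - by exists (g1 - g2); rewrite iD iN hD hN.
  - by have -> : g1 = 0; [apply: iI; rewrite -e i0|].
  - by exists g1.
have [Asub Afun _] := PA.
have A0 : A (0, 0) by have := Aext 0; rewrite i0 h0.
have AN x y : A (x, y) -> A (- x, - y).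
  by move=> /(Asub _ _ _ _ A0); rewrite !sub0r.
have AD x y x' y' : A (x, y) -> A (x', y') -> A (x + x', y + y').
  by move=> a /AN b; have := Asub _ _ _ _ a b; rewrite !opprK.
have Auniq x y y' : A (x, y) -> A (x, y') -> y = y'.
  move=> a b; apply/eqP; rewrite -subr_eq0; apply/eqP/Afun.
  by have := Asub _ _ _ _ a b; rewrite subrr.
have AMn x y n : A (x, y) -> A (x *+ n, y *+ n).
  move=> a; elim: n => [|n IHn]; first by rewrite !mulr0n.
  by rewrite !mulrS; apply: AD.
have Atot x0 : exists y, A (x0, y).
  have [//|nA] := pselect (exists y, A (x0, y)).
  pose S n := (0 < n)%N && `[< exists y, A (x0 *+ n, y) >].
  have [d dP] : exists d, forall n y, A (x0 *+ n, y) -> y = d *+ n.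
    have [exS|nS] := pselect (exists n, S n); last first.
      exists 0 => n y Ay; rewrite mul0rn; case: (posnP n) => [n0|n_gt0].
        by apply: Afun; rewrite n0 mulr0n in Ay.
      by case: nS; exists n; rewrite /S n_gt0 /=; apply/asboolP; exists y.
    case: (ex_minnP exS) => m /andP[m_gt0 /asboolP[y Ay]] mmin.
    have [d dy] := Ddiv m y m_gt0; exists d => n z Az.
    have nE := divn_eq n m.
    have Ar : A (x0 *+ (n %% m), z - d *+ (n %/ m * m)).
      have -> : x0 *+ (n %% m) = x0 *+ n - x0 *+ (n %/ m * m).
        by rewrite {2}nE mulrnDr addrAC subrr add0r.
      by apply: Asub => //; rewrite mulnC !mulrnA dy; apply: AMn.
    have r0 : (n %% m = 0)%N.
      apply/eqP; rewrite -leqn0 leqNgt; apply/negP => r_gt0.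
      have : S (n %% m)%N by rewrite /S r_gt0; apply/asboolP; exists (z - d *+ (n %/ m * m)).
      by move/mmin; rewrite leqNgt ltn_pmod.
    rewrite r0 mulr0n in Ar; move/Afun/eqP: Ar; rewrite subr_eq0 => /eqP->.
    by rewrite {2}nE r0 addn0.
  have dZ (k : int) y : A (x0 *~ k, y) -> y = d *~ k.
    case: k => n; first exact: dP.
    rewrite NegzE !mulrNz => /AN; rewrite opprK => /dP e.
    by apply: oppr_inj; rewrite opprK.
  pose B : set (H * D) := fun z => exists x y (k : int),
    A (x, y) /\ z = (x + x0 *~ k, y + d *~ k).
  have AB : subset A B.
    by move=> [x y] a; exists x, y, 0; rewrite !mulr0z !addr0.
  exfalso; apply: (Amax B).
    split=> // BA; apply: nA; exists d; apply: BA.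
    by exists 0, 0, 1; rewrite !mulr1z !add0r.
  split=> [_ _ _ _ [x [y [k [a [-> ->]]]]] [x' [y' [k' [a' [-> ->]]]]]|z|z _ g].
  - exists (x - x'), (y - y'), (k - k'); split; first exact: Asub.
    by rewrite !mulrzBr !opprD; congr pair; rewrite addrACA.
  - move=> [x [y [k [a [e ->]]]]].
    have xE : x = - (x0 *~ k) by apply/eqP; rewrite -addr_eq0 -e.
    rewrite xE in a; move/AN: a; rewrite opprK => /dZ <-; exact: subrr.
  - exact/AB/Aext.
have [k kA] := choice Atot.
exists k; split=> [x y|x]; last exact: Auniq (kA _) (Aext x).
by apply: (Auniq (x + y)) => //; apply: AD.
Qed.

Fact int_rat_linear : linear (fun n : int^o => n%:~R : zmodule rat).
Proof.
move=> a x y; rewrite [LHS]intrD; congr (_ + _).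
by rewrite [LHS](intrM _ a x) mulrzl.
Qed.
Definition int_rat : {linear int^o -> zmodule rat} := mklin int_rat_linear.
Definition QZ : zmodType := mcoker int_rat.

Lemma QZ_divisible : divisible QZ.
Proof.
move=> n y n_gt0; have [x <-] := cpi_surj y.
exists (cpi int_rat ((x : rat) / n%:R : rat)); rewrite -raddfMn; congr (cpi _ _).
by rewrite -[LHS]mulr_natr divfK // pnatr_eq0 -lt0n.
Qed.

Lemma QZ_injective (G H : zmodType) (i : G -> H) (h : G -> QZ) :
    {morph i : x y / x + y} -> {morph h : x y / x + y} -> injective i ->
  exists k : H -> QZ, {morph k : x y / x + y} /\ forall x, k (i x) = h x.
Proof. exact/divisible_injective/QZ_divisible. Qed.

Lemma QZ_cogenerator (G : zmodType) (x : G) : x <> 0 ->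
  exists k : G -> QZ, {morph k : x y / x + y} /\ k x <> 0.
Proof.
move=> xN0.
pose c (q : rat) : QZ := cpi int_rat (q : zmodule rat).
have cD : {morph c : p q / p + q} by move=> p q; rewrite /c -linearD.
have cB p q : c p - c q = c (p - q) by rewrite /c -linearB.
have c0 q : c q = 0 <-> exists n : int, n%:~R = q.
  by rewrite /c cpiP; split=> -[n nE]; exists n.
(* The order of [x] decides which fraction [x] may be sent to. *)
have [q [cq qP]] : exists q : rat, c q <> 0 /\
    forall k : int, x *~ k = 0 -> c (k%:~R * q) = 0.
  pose S n := (0 < n)%N && (x *+ n == 0).
  have [exS|nS] := pselect (exists n, S n); last first.
    exists (2%:R^-1); split.
      move/c0 => -[n /(congr1 (fun z => z * 2))]; rewrite mulVf // => /eqP.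
      rewrite -[1]/(1%:~R) -[2]/(2%:~R) -intrM eqr_int => /eqP.
      case: n => n.
        by case: n => //= n; lia.
      by lia.
    move=> k xk; have -> : k = 0; last by rewrite mul0r; apply/c0; exists 0.
    apply/eqP; apply/negP => /negP kN0; apply: nS; exists `|k|%N.
    rewrite /S absz_gt0 kN0 /=; case: k xk {kN0} => n; first by move/eqP.
    by rewrite NegzE mulrNz => /eqP; rewrite oppr_eq0.
  case: (ex_minnP exS) => m /andP[m_gt0 /eqP xm] mmin.
  have mN0 : (m%:~R : rat) != 0 by rewrite intr_eq0 -lt0n.
  exists ((m%:~R)^-1); split.
    move/c0 => -[n /(congr1 (fun z => z * m%:~R))]; rewrite mulVf // => /eqP.
    rewrite -[1]/(1%:~R) -intrM eqr_int => /eqP nm.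
    have m1 : m = 1%N.
      by move: (congr1 (fun z : int => `|z|%N) nm); rewrite abszM /= => /eqP; rewrite muln_eq1 => /andP[_ /eqP].
    by apply: xN0; rewrite -xm m1.
  move=> k xk; apply/c0; exists (k %/ m)%Z.
  suff km : (k %% m)%Z = 0 by rewrite {2}(divz_eq k m) km addr0 intrM mulfK.
  have xr : x *~ (k %% m)%Z = 0.
    by rewrite /modz mulrzBr xk mulrC mulrzA [x *~ m]xm mul0rz subrr.
  have r0 : 0 <= (k %% m)%Z by apply: modz_ge0; rewrite -lt0n.
  have rm : (k %% m)%Z < m by apply: ltz_pmod.
  case: (k %% m)%Z r0 rm xr => // -[//|r] _ rm xr.
  have /mmin : S r.+1 by rewrite /S /=; apply/eqP.
  by rewrite leqNgt -ltz_nat rm.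
pose fx : int^o -> zmodule G := fun n => x *~ n.
have fxL : linear fx.
  move=> a u v; rewrite scalezrE /fx [LHS]mulrzDr; congr (_ + _).
  by rewrite -[a *: u]/(a * (u : int)) mulrC mulrzA.
pose X := mim (mklin fxL).
have [h hE] : exists h : {linear X -> (mcoker int_rat : lmodType int)},
    forall k : int, forall z : X, iin _ z = fx k -> h z = c (k%:~R * q).
  have [|||h hE] := @linear_of_rel int X (mcoker int_rat)
      (fun z y => exists k : int, iin _ z = fx k /\ y = c (k%:~R * q)).
  - move=> z; have [|k kE] := (iinP (mklin fxL) (iin _ z)).1; first by exists z.
    by exists (c (k%:~R * q)), k.
  - move=> a z y z' y' [k [e ->]] [k' [e' ->]]; exists (a * k + k').
    rewrite [LHS]linearP e e'; split; first by rewrite -[RHS]/(mklin fxL (a *: (k : int^o) + k')) linearP.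
    rewrite /c -linearP; congr (cpi _ _).
    by rewrite scalezrE intrD intrM mulrDl -mulrzl mulrA.
  - by move=> y [k [e ->]]; apply: qP; rewrite -[LHS]/(fx k) -e linear0.
  by exists h => k z e; apply/hE; exists k.
have [k [kD kE]] := @QZ_injective X G (iin _) h (linearD _) (linearD _) (@iin_inj _ _ _ _).
exists k; split=> //.
have [|z zE] := (iinP (mklin fxL) (x : zmodule G)).2; first by exists 1; rewrite /= /fx mulr1z.
rewrite -[x in k x]zE kE (hE 1); first by rewrite mul1r.
by rewrite zE /fx mulr1z.
Qed.

(** * Character modules and flatness *)

(** Character modules exchange left and right modules; as R^c^c is not the ring
    structure R itself, both directions are instances of one construction along
    an antihomomorphism. *)
Record antimor (S R : nzRingType) := Antimor {
  amf :> S -> R;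
  amD : {morph amf : x y / x + y};
  am1 : amf 1 = 1;
  amM : forall x y, amf (x * y) = amf y * amf x
}.

Section Character.
Variables (S R : nzRingType) (sigma : antimor S R) (N : lmodType R).

Record chr := Chr { chr_fun :> N -> QZ; chrD : {morph chr_fun : x y / x + y} }.
HB.instance Definition _ := gen_eqMixin chr.
HB.instance Definition _ := gen_choiceMixin chr.

Lemma chr_ext (f g : chr) : f =1 g -> f = g.
Proof.
case: f g => [f fD] [g gD] /= /funext fg; subst g.
by rewrite (Prop_irrelevance fD gD).
Qed.

Fact chr_zeroD : {morph (fun=> 0 : QZ) : x y / (x : N) + y >-> x + y}.
Proof. by move=> x y; rewrite addr0. Qed.
Definition chr_zero := Chr chr_zeroD.
Fact chr_oppD (f : chr) : {morph (fun x => - f x) : x y / x + y}.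
Proof. by move=> x y; rewrite chrD opprD. Qed.
Definition chr_opp f := Chr (chr_oppD f).
Fact chr_addD (f g : chr) : {morph (fun x => f x + g x) : x y / x + y}.
Proof. by move=> x y; rewrite !chrD addrACA. Qed.
Definition chr_add f g := Chr (chr_addD f g).

Fact chr_addA : associative chr_add.
Proof. by move=> f g h; apply: chr_ext => x /=; rewrite addrA. Qed.
Fact chr_addC : commutative chr_add.
Proof. by move=> f g; apply: chr_ext => x /=; rewrite addrC. Qed.
Fact chr_add0 : left_id chr_zero chr_add.
Proof. by move=> f; apply: chr_ext => x /=; rewrite add0r. Qed.
Fact chr_addN : left_inverse chr_zero chr_opp chr_add.
Proof. by move=> f; apply: chr_ext => x /=; rewrite addNr. Qed.
HB.instance Definition _ := GRing.isZmodule.Build chr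
  chr_addA chr_addC chr_add0 chr_addN.

Fact chr_scaleD s (f : chr) : {morph (fun x => f (sigma s *: x)) : x y / x + y}.
Proof. by move=> x y; rewrite scalerDr chrD. Qed.
Definition chr_scale s f := Chr (chr_scaleD s f).
Fact chr_scaleA s t f : chr_scale s (chr_scale t f) = chr_scale (s * t) f.
Proof. by apply: chr_ext => x /=; rewrite scalerA amM. Qed.
Fact chr_scale1 : left_id 1 chr_scale.
Proof. by move=> f; apply: chr_ext => x /=; rewrite am1 scale1r. Qed.
Fact chr_scaleDr : right_distributive chr_scale +%R.
Proof. by move=> s f g; apply: chr_ext. Qed.
Fact chr_scaleDl f : {morph chr_scale^~ f : s t / s + t}.
Proof. by move=> s t; apply: chr_ext => x /=; rewrite amD scalerDl chrD. Qed.
HB.instance Definition _ := GRing.Zmodule_isLmodule.Build S chr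
  chr_scaleA chr_scale1 chr_scaleDr chr_scaleDl.

Definition chrmod : lmodType S := chr.

Lemma chr0 (f : chrmod) : f 0 = 0. Proof. exact/morph_add0/chrD. Qed.
Lemma chrDE (f g : chrmod) x : (f + g) x = f x + g x. Proof. by []. Qed.
Lemma chrZE s (f : chrmod) x : (s *: f) x = f (sigma s *: x). Proof. by []. Qed.

Lemma chr_sep (x : N) : (forall f : chrmod, f x = 0) -> x = 0.
Proof.
move=> f0; apply: contrapT => /QZ_cogenerator[k [kD]]; apply.
exact: (f0 (Chr kD)).
Qed.
End Character.

Section CharacterMaps.
Variables (S R : nzRingType) (sigma : antimor S R).
Implicit Types K P L N : lmodType R.

Lemma chr_preD N N' (f : {linear N -> N'}) (c : chrmod sigma N') :
  {morph (fun x => c (f x)) : x y / x + y}.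
Proof. by move=> x y; rewrite linearD chrD. Qed.
Fact chr_pre_linear N N' (f : {linear N -> N'}) :
  linear (fun c : chrmod sigma N' => Chr (chr_preD f c) : chrmod sigma N).
Proof. by move=> a c d; apply: chr_ext => x /=; rewrite -linearZ. Qed.
Definition chrmap N N' (f : {linear N -> N'}) :
  {linear chrmod sigma N' -> chrmod sigma N} := mklin (chr_pre_linear f).

Lemma chrmapE N N' (f : {linear N -> N'}) c x : chrmap f c x = c (f x).
Proof. by []. Qed.

Lemma chrmap_ses K P L (i : {linear K -> P}) (p : {linear P -> L}) :
  ses i p -> ses (chrmap p) (chrmap i).
Proof.
move=> ip; have [iI pS ex] := ip; split=> [c d e|c|c].
- by apply: chr_ext => y; have [x <-] := pS y; rewrite -!chrmapE e.
- have [k [kD kE]] := QZ_injective (linearD i) (@chrD _ _ c) iI.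
  by exists (Chr kD); apply: chr_ext => x; apply: kE.
- split=> [ci|[d <-]]; last by apply: chr_ext => x /=; rewrite (ses0 _ ip) chr0.
  have ker x : p x = 0 -> c x = 0.
    by move=> /ex[y <-]; rewrite -chrmapE ci.
  have [s sE] := choice pS.
  have cs x : c (s (p x)) = c x.
    apply/eqP; rewrite -subr_eq0 -(morph_addN (@chrD _ _ c)) -chrD; apply/eqP/ker.
    by rewrite linearB sE subrr.
  have sD : {morph (fun l => c (s l)) : l m / l + m}.
    move=> l m; have [x <-] := pS l; have [y <-] := pS m.
    by rewrite -linearD !cs chrD.
  by exists (Chr sD); apply: chr_ext => x /=.
Qed.

Lemma chrmap_retract N N' : retract N N' -> retract (chrmod sigma N) (chrmod sigma N').
Proof.
move=> [s [r sK]]; exists (chrmap r), (chrmap s) => c.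
by apply: chr_ext => x /=; rewrite sK.
Qed.
End CharacterMaps.

Lemma chr_swap (S R : nzRingType) (sigma : antimor S R) (tau : antimor R S) :
    cancel tau sigma -> forall (M : lmodType S) (N : lmodType R)
    (h : {linear M -> chrmod sigma N}),
  exists h' : {linear N -> chrmod tau M}, forall m n, h' n m = h m n.
Proof.
move=> tauK M N h.
have hD n : {morph (fun m => h m n) : x y / x + y} by move=> x y; rewrite linearD.
have hL : linear (fun n => Chr (hD n) : chrmod tau M).
  move=> r x y; apply: chr_ext => m /=; rewrite chrD; congr (_ + _).
  by rewrite linearZ /= tauK.
by exists (mklin hL).
Qed.

(** Lifting against the characters of a monomorphism, which form a surjection. *)
Lemma chr_projective (S R : nzRingType) (sigma : antimor S R) (tau : antimor R S) :
    cancel tau sigma -> cancel sigma tau -> forall N : lmodType R,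
  projective N -> injmod (chrmod sigma N).
Proof.
move=> tauK sigmaK N NP M M' i h iI.
have [h' h'E] := chr_swap tauK h.
have [_ iS _] := chrmap_ses tau (ses_cpi iI).
have [k kE] := NP _ _ (chrmap tau i) h' iS.
have [k' k'E] := chr_swap sigmaK k.
by exists k' => x; apply: chr_ext => n; rewrite k'E -h'E -kE.
Qed.

Section CharacterRL.
Variable R : nzRingType.

Fact amR_D : {morph (fun x : R^c => x : R) : x y / x + y}. Proof. by []. Qed.
Definition amR : antimor R^c R := @Antimor R^c R (fun x => x) amR_D erefl (fun x y => erefl).
Fact amL_D : {morph (fun x : R => x : R^c) : x y / x + y}. Proof. by []. Qed.
Definition amL : antimor R R^c := @Antimor R R^c (fun x => x) amL_D erefl (fun x y => erefl).

Definition charR (N : lmodType R) : lmodType R^c := chrmod amR N.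
Definition charL (G : lmodType R^c) : lmodType R := chrmod amL G.

Lemma charL_projective (G : lmodType R^c) : projective G -> injmod (charL G).
Proof. exact: (@chr_projective _ _ amL amR). Qed.
Lemma charR_projective (N : lmodType R) : projective N -> injmod (charR N).
Proof. exact: (@chr_projective _ _ amR amL). Qed.

Lemma charL_bal (G : lmodType R^c) (N : lmodType R) (h : {linear N -> charL G}) :
  balanced (fun g n => h n g).
Proof.
by split=> [g g' n|g n n'|r g n]; rewrite ?chrD ?linearD ?linearZ.
Qed.
Lemma bal_charL (G : lmodType R^c) (N : lmodType R) (b : G -> N -> QZ) :
  balanced b -> exists h : {linear N -> charL G}, forall g n, h n g = b g n.
Proof.
move=> [bD1 bD2 bZ].
have hD n : {morph (fun g => b g n) : x y / x + y} by move=> x y; apply: bD1.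
have hL : linear (fun n => Chr (hD n) : charL G).
  by move=> r x y; apply: chr_ext => g /=; rewrite bD2 -bZ.
by exists (mklin hL).
Qed.
Lemma charR_bal (G : lmodType R^c) (N : lmodType R) (h : {linear G -> charR N}) :
  balanced (fun g n => h g n).
Proof.
by split=> [g g' n|g n n'|r g n]; rewrite ?chrD ?linearD ?linearZ.
Qed.
Lemma bal_charR (G : lmodType R^c) (N : lmodType R) (b : G -> N -> QZ) :
  balanced b -> exists h : {linear G -> charR N}, forall g n, h g n = b g n.
Proof.
move=> [bD1 bD2 bZ].
have hD g : {morph (fun n => b g n) : x y / x + y} by move=> x y; apply: bD2.
have hL : linear (fun g => Chr (hD g) : charR N).
  by move=> r x y; apply: chr_ext => g /=; rewrite bD1 bZ.
by exists (mklin hL).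
Qed.

Lemma tens_map_bal (M M' : lmodType R^c) (N N' : lmodType R)
    (f : {linear M -> M'}) (g : {linear N -> N'}) :
  balanced (fun m n => tpure (f m) (g n)).
Proof.
have [bDl bDr bZ] := tpure_balanced M' N'.
split=> *; rewrite ?linearD ?bDl ?bDr //.
by rewrite linearZ bZ linearZ.
Qed.

Lemma tens_mapD (M M' : lmodType R^c) (N N' : lmodType R)
    (f : {linear M -> M'}) (g : {linear N -> N'}) :
  {morph tens_map f g : x y / x + y}.
Proof. exact/tens_liftD/tens_map_bal. Qed.

Lemma tens_map_surj (M M' : lmodType R^c) (N N' : lmodType R)
    (f : {linear M -> M'}) (g : {linear N -> N'}) :
  surj f -> surj g -> surj (tens_map f g).
Proof.
move=> fS gS; apply: tens_ind => [|m n x [y <-]].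
  by exists 0; apply/morph_add0/tens_mapD.
have [m' <-] := fS m; have [n' <-] := gS n.
by exists (tpure m' n' + y); rewrite tens_mapD tens_mapE.
Qed.

(** The group QZ is an injective cogenerator, and the maps from a tensor product
    to it are the balanced maps. *)
Lemma tens_map_injP (M M' : lmodType R^c) (N N' : lmodType R)
    (f : {linear M -> M'}) (g : {linear N -> N'}) :
  injective (tens_map f g) <->
  (forall b : M -> N -> QZ, balanced b ->
    exists2 b' : M' -> N' -> QZ, balanced b' & forall m n, b' (f m) (g n) = b m n).
Proof.
split=> [fgI b bb|bext].
  have [k [kD kE]] := QZ_injective (tens_mapD f g) (tens_liftD bb) fgI.
  exists (fun m n => k (tpure m n)); last first.
    by move=> m n; rewrite -tens_mapE kE tens_liftE.
  have [bDl bDr bZ] := tpure_balanced M' N'.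
  by split=> *; rewrite ?bDl ?bDr ?kD ?bZ.
suff inj0 x : tens_map f g x = 0 -> x = 0.
  move=> x y xy; apply/eqP; rewrite -subr_eq0; apply/eqP/inj0.
  by rewrite tens_mapD (morph_addN (tens_mapD _ _)) xy subrr.
move=> fgx; apply: contrapT => /QZ_cogenerator[k [kD]]; apply.
have bb : balanced (fun m n => k (tpure m n)).
  have [bDl bDr bZ] := tpure_balanced M N.
  by split=> *; rewrite ?bDl ?bDr ?kD ?bZ.
have [b' b'b b'E] := bext _ bb.
have -> : k x = tens_lift b' (tens_map f g x).
  move: x {fgx}; apply: tens_ext => [//|x y|m n].
    by rewrite tens_mapD tens_liftD.
  by rewrite tens_mapE tens_liftE.
rewrite fgx; apply: morph_add0; exact: tens_liftD.
Qed.

Lemma flatP (F : lmodType R) : flat F <-> injmod (charR F).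
Proof.
split=> [Ff M N i h iI|Fi M N i iI].
  have [b' b'b b'E] := (tens_map_injP i idfun).1 (Ff _ _ i iI) _ (charR_bal h).
  have [k kE] := bal_charR b'b; exists k => x; apply: chr_ext => y.
  by rewrite kE b'E.
apply/tens_map_injP => b bb; have [h hE] := bal_charR bb.
have [k kE] := Fi _ _ i h iI.
by exists (fun m n => k m n); [apply: charR_bal|move=> m n; rewrite kE hE].
Qed.

Lemma rflatP (G : lmodType R^c) : rflat G <-> injmod (charL G).
Proof.
split=> [Ff M N i h iI|Fi M N i iI].
  have [b' b'b b'E] := (tens_map_injP idfun i).1 (Ff _ _ i iI) _ (charL_bal h).
  have [k kE] := bal_charL b'b; exists k => x; apply: chr_ext => y.
  by rewrite kE b'E.
apply/tens_map_injP => b bb; have [h hE] := bal_charL bb.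
have [k kE] := Fi _ _ i h iI.
by exists (fun m n => k n m); [apply: charL_bal|move=> m n; rewrite kE hE].
Qed.

Lemma projective_flat (P : lmodType R) : projective P -> flat P.
Proof. by move=> PP; apply/flatP/charR_projective. Qed.

Lemma flat_retract (F F' : lmodType R) : retract F F' -> flat F' -> flat F.
Proof.
move=> FF' /flatP F'f; apply/flatP.
exact: injmod_retract (chrmap_retract amR FF') F'f.
Qed.

(** Injectivity of G (x) K -> G (x) P for a presentation K -> P -> N, which is
    the vanishing of Tor_1(G, N), amounts to that of Ext^1(N, G^+). *)
Lemma ext1z_tens (G : lmodType R^c) (K P N : lmodType R)
    (i : {linear K -> P}) (p : {linear P -> N}) :
  ses i p -> ext1z N (charL G) -> injective (tens_map (idfun : {linear G -> G}) i).
Proof.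
move=> ip NG; apply/tens_map_injP => b bb; have [h hE] := bal_charL bb.
have [k kE] := NG _ _ _ _ ip h.
by exists (fun m n => k n m); [apply: charL_bal|move=> m n; rewrite kE hE].
Qed.

Lemma tens_ext1z (G : lmodType R^c) (K P N : lmodType R)
    (i : {linear K -> P}) (p : {linear P -> N}) :
  ses i p -> projective P -> injective (tens_map (idfun : {linear G -> G}) i) ->
  ext1z N (charL G).
Proof.
move=> ip PP iI; apply: (ext1z_pres ip PP) => h.
have [b' b'b b'E] := (tens_map_injP idfun i).1 iI _ (charL_bal h).
have [k kE] := bal_charL b'b; exists k => x; apply: chr_ext => y.
by rewrite kE b'E.
Qed.

Lemma ext1z_tensR (U : lmodType R) (K P N : lmodType R^c)
    (i : {linear K -> P}) (p : {linear P -> N}) :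
  ses i p -> ext1z N (charR U) -> injective (tens_map i (idfun : {linear U -> U})).
Proof.
move=> ip NG; apply/tens_map_injP => b bb; have [h hE] := bal_charR bb.
have [k kE] := NG _ _ _ _ ip h.
by exists (fun m n => k m n); [apply: charR_bal|move=> m n; rewrite kE hE].
Qed.

Lemma tens_right_exact (G : lmodType R^c) (K P N : lmodType R)
    (i : {linear K -> P}) (p : {linear P -> N}) z :
    surj p -> (forall x, p x = 0 -> exists y, i y = x) ->
    tens_map (idfun : {linear G -> G}) p z = 0 ->
  exists w, tens_map (idfun : {linear G -> G}) i w = z.
Proof.
move=> pS ex pz.
have fL : linear (tens_map (idfun : {linear G -> G}) i
    : zmodule (tens G K) -> zmodule (tens G P)).
  move=> a x y; rewrite scalezrE [LHS]tens_mapD; congr (_ + _).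
  have := raddfMz (HB.pack (tens_map (idfun : {linear G -> G}) i)
    (GRing.isZmodMorphism.Build _ _ (tens_map idfun i) (fun x y =>
      etrans (tens_mapD _ _ _ _) (congr1 _ (morph_addN (tens_mapD _ _) y))))
     : {additive _ -> _}).
  by move/(_ a x).
pose c := cpi (mklin fL).
have [s sE] := choice pS.
have cs g x : c (tpure g (s (p x))) = c (tpure g x).
  apply/eqP; rewrite -subr_eq0 -linearB; apply/eqP/cpiP.
  have [|y yE] := ex (s (p x) - x); first by rewrite linearB sE subrr.
  exists (tpure g y); rewrite [LHS]tens_mapE yE.
  have [_ bDr _] := tpure_balanced G P; rewrite bDr; congr (_ + _).
  exact: (morph_addN (bDr g)).
have [bDl bDr bZ] := tpure_balanced G P.
have bb : balanced (fun g n => c (tpure g (s n))).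
  split=> [g g' n|g n n'|r g n].
  - by rewrite bDl linearD.
  - by have [x <-] := pS n; have [x' <-] := pS n'; rewrite -linearD !cs bDr linearD.
  - by have [x <-] := pS n; rewrite -linearZ !cs bZ.
have : c z = tens_lift (fun g n => c (tpure g (s n))) (tens_map idfun p z).
  move: z {pz}; apply: tens_ext => [x y|x y|g x].
  - by rewrite linearD.
  - by rewrite tens_mapD tens_liftD.
  - by rewrite tens_mapE tens_liftE.
rewrite pz (morph_add0 (tens_liftD bb)) => /cpiP[w wz].
by exists w.
Qed.
End CharacterRL.

(** * Enough projectives and injectives *)

(** The free module on a set, built from formal sums as the tensor product is:
    sums are identified when all maps to modules agree on them. *)
Section Free.
Variables (R : nzRingType) (X : choiceType).

Definition fsum (N : lmodType R) (phi : X -> N) (s : seq (R * X)) : N :=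
  \sum_(p <- s) p.1 *: phi p.2.

Definition free_rel : rel (seq (R * X)) := fun s t =>
  `[< forall (N : lmodType R) (phi : X -> N), fsum phi s = fsum phi t >].

Lemma free_equiv : equiv_class_of free_rel.
Proof.
split=> [s|s t|t s u]; first exact/asboolP.
- by apply/asboolP/asboolP => st N phi; rewrite st.
- by move=> /asboolP st /asboolP tu; apply/asboolP => N phi; rewrite st tu.
Qed.

Definition free_eq : equiv_rel (seq (R * X)) := EquivRelPack free_equiv.
Definition freemod := {eq_quot free_eq}%qT.
HB.instance Definition _ : EqQuotient _ free_eq freemod := EqQuotient.on freemod.
HB.instance Definition _ := Choice.on freemod.

Definition fpi (s : seq (R * X)) : freemod := (\pi_freemod s)%qT.

Lemma freeW (P : freemod -> Type) : (forall s, P (fpi s)) -> forall t, P t.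
Proof. exact: quotW. Qed.

Lemma free_eqP s t :
  (forall (N : lmodType R) (phi : X -> N), fsum phi s = fsum phi t) <-> fpi s = fpi t.
Proof. by split=> [st|/eqmodP/asboolP//]; apply/eqmodP/asboolP. Qed.

Lemma fsum_repr (N : lmodType R) (phi : X -> N) s :
  fsum phi (repr (fpi s)) = fsum phi s.
Proof. by move: N phi; apply/free_eqP; rewrite /fpi reprK. Qed.

Definition fscale_seq (r : R) (s : seq (R * X)) := [seq (r * p.1, p.2) | p <- s].
Definition free_add (x y : freemod) : freemod := fpi (repr x ++ repr y).
Definition free_scale (r : R) (x : freemod) : freemod := fpi (fscale_seq r (repr x)).

Lemma fsum_cat (N : lmodType R) (phi : X -> N) s t :
  fsum phi (s ++ t) = fsum phi s + fsum phi t.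
Proof. exact: big_cat. Qed.
Lemma fsum_scale (N : lmodType R) (phi : X -> N) r s :
  fsum phi (fscale_seq r s) = r *: fsum phi s.
Proof.
by rewrite /fsum big_map scaler_sumr; apply: eq_bigr => p _; rewrite scalerA.
Qed.

Lemma free_addE s t : free_add (fpi s) (fpi t) = fpi (s ++ t).
Proof. by apply/free_eqP => N phi; rewrite !fsum_cat !fsum_repr. Qed.
Lemma free_scaleE r s : free_scale r (fpi s) = fpi (fscale_seq r s).
Proof. by apply/free_eqP => N phi; rewrite !fsum_scale fsum_repr. Qed.

Local Opaque free_add free_scale.
Fact free_addA : associative free_add.
Proof. by elim/freeW=> x; elim/freeW=> y; elim/freeW=> z; rewrite !free_addE catA. Qed.
Fact free_addC : commutative free_add.
Proof.
elim/freeW=> x; elim/freeW=> y; rewrite !free_addE.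
by apply/free_eqP => N phi; rewrite !fsum_cat addrC.
Qed.
Fact free_add0 : left_id (fpi [::]) free_add.
Proof. by elim/freeW=> x; rewrite free_addE. Qed.
Fact free_addN : left_inverse (fpi [::]) (free_scale (- 1)) free_add.
Proof.
elim/freeW=> x; rewrite free_scaleE free_addE; apply/free_eqP => N phi.
by rewrite fsum_cat fsum_scale scaleN1r addNr /fsum big_nil.
Qed.
HB.instance Definition _ := GRing.isZmodule.Build freemod
  free_addA free_addC free_add0 free_addN.

Fact free_scaleA a b x : free_scale a (free_scale b x) = free_scale (a * b) x.
Proof.
elim/freeW: x => x; rewrite !free_scaleE; apply/free_eqP => N phi.
by rewrite !fsum_scale scalerA.
Qed.
Fact free_scale1 : left_id 1 free_scale.
Proof.
elim/freeW=> x; rewrite !free_scaleE; apply/free_eqP => N phi.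
by rewrite !fsum_scale scale1r.
Qed.
Fact free_scaleDr : right_distributive free_scale +%R.
Proof.
move=> a; elim/freeW=> x; elim/freeW=> y.
rewrite (free_addE x y : fpi x + fpi y = _) !free_scaleE [RHS]free_addE.
by apply/free_eqP => N phi; rewrite fsum_cat !fsum_scale fsum_cat scalerDr.
Qed.
Fact free_scaleDl x : {morph free_scale^~ x : a b / a + b}.
Proof.
elim/freeW: x => x a b; rewrite !free_scaleE [RHS]free_addE.
by apply/free_eqP => N phi; rewrite fsum_cat !fsum_scale scalerDl.
Qed.
HB.instance Definition _ := GRing.Zmodule_isLmodule.Build R freemod
  free_scaleA free_scale1 free_scaleDr free_scaleDl.

Definition fgen (x : X) : freemod := fpi [:: (1, x)].

Definition free_lift (N : lmodType R) (phi : X -> N) (t : freemod) : N :=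
  fsum phi (repr t).

Fact free_lift_linear (N : lmodType R) (phi : X -> N) : linear (free_lift phi).
Proof.
move=> a; elim/freeW=> x; elim/freeW=> y.
rewrite (free_scaleE a x : a *: fpi x = _) (free_addE _ y : _ + fpi y = _).
by rewrite /free_lift !fsum_repr fsum_cat fsum_scale.
Qed.

Lemma free_universal (N : lmodType R) (phi : X -> N) :
  exists h : {linear freemod -> N}, forall x, h (fgen x) = phi x.
Proof.
exists (mklin (@free_lift_linear N phi)) => x /=.
by rewrite /free_lift fsum_repr /fsum big_seq1 scale1r.
Qed.

Lemma free_unique (N : lmodType R) (h k : {linear freemod -> N}) :
  (forall x, h (fgen x) = k (fgen x)) -> h =1 k.
Proof.
move=> hk; elim/freeW; elim=> [|[a x] s IHs].
  by rewrite -[fpi [::]]/(0 : freemod) !linear0.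
have -> : fpi ((a, x) :: s) = a *: fgen x + fpi s.
  rewrite [a *: fgen x]free_scaleE [RHS]free_addE.
  by apply/free_eqP => M phi; rewrite fsum_cat /fsum big_cons /= big_seq1 mulr1.
by rewrite !linearP hk IHs.
Qed.

Lemma free_projective : projective (freemod : lmodType R).
Proof.
move=> M N p h pS; have [s sE] := choice pS.
have [k kE] := free_universal (fun x => s (h (fgen x))).
exists k; apply: (@free_unique _ (p \o k)) => x /=.
by rewrite kE sE.
Qed.
End Free.

Section Enough.
Variable R : nzRingType.

Lemma enough_projectives (N : lmodType R) :
  exists N', linked (@projective R) N' N.
Proof.
have [p pE] := free_universal (fun x : N => x).
have pS : surj p by move=> x; exists (fgen R x).
exists (mker p), (freemod R N), (kin p), p; split; last exact: ses_kin.
exact: free_projective.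
Qed.

(** [K] embeds in its double character module, hence in the characters of a
    free module that covers its character module. *)
Lemma enough_injectives (K : lmodType R) : exists K', linked (@injmod R) K K'.
Proof.
have [p pE] := free_universal (fun x : charR K => x).
have pS : surj p by move=> x; exists (fgen R^c x).
have [j jE] := chr_swap (fun x => erefl : amR R (amL R x) = x)
  (idfun : {linear charR K -> charR K}).
pose i : {linear K -> charL (freemod R^c (charR K))} := chrmap (amL R) p \o j.
have iI : injective i.
  apply: lin_inj => x ix; apply: (@chr_sep _ _ (amR R) K) => f.
  have [y yf] := pS f; have := congr1 (fun c : chrmod (amL R) _ => c y) ix.
  by rewrite /= jE yf.
exists (mcoker i), (charL (freemod R^c (charR K))), i, (cpi i); split.
  exact/charL_projective/free_projective.
exact: ses_cpi.
Qed.
End Enough.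

Lemma linked_sub (R : nzRingType) (T T' : lmodType R -> Prop) M N :
  (forall P, T P -> T' P) -> linked T M N -> linked T' M N.
Proof. by move=> TT' [P [i [p [TP ip]]]]; exists P, i, p; split=> //; apply: TT'. Qed.

Lemma resolution_of (R : nzRingType) (T : lmodType R -> Prop) Z : syzseq T Z ->
  exists P : resolution (Z 0), forall i, T (P i).
Proof.
move=> ZT.
have {}ZT i : {P : lmodType R & {a : {linear Z i.+1 -> P} &
    {b : {linear P -> Z i} | T P /\ ses a b}}}.
  by have [P /cid[a /cid[b h]]] := cid (ZT i); exists P, a, b.
pose P i := projT1 (ZT i); pose a i : {linear _ -> P i} := projT1 (projT2 (ZT i)).
pose b i : {linear P i -> _} := sval (projT2 (projT2 (ZT i))).
have ab i : T (P i) /\ ses (a i) (b i) := svalP (projT2 (projT2 (ZT i))).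
clearbody b; clearbody a; clearbody P => {ZT}.
have bS i : surj (b i) by have [_ []] := ab i.
have aI i : injective (a i) by have [_ []] := ab i.
have ex i x : b i x = 0 <-> exists y, a i y = x by have [_ []] := ab i.
have ex0 x : b 0 x = 0 <-> exists y, a 0 (b 1 y) = x.
  rewrite ex; split=> -[y yE]; last by exists (b 1 y).
  by have [z zE] := bS 1 y; exists z; rewrite zE.
have exn n x : a n (b n.+1 x) = 0 <-> exists y, a n.+1 (b n.+2 y) = x.
  have -> : a n (b n.+1 x) = 0 <-> b n.+1 x = 0.
    by split=> [/(lin_inj0 (aI n))|->]; rewrite ?linear0.
  rewrite ex; split=> -[y yE]; last by exists (b n.+2 y).
  by have [z zE] := bS n.+2 y; exists z; rewrite zE.
exists (@Resolution R (Z 0) P (fun n => a n \o b n.+1) (b 0) (bS 0) ex0 exn).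
by move=> i; have [] := ab i.
Qed.

Lemma projective_syzseq (R : nzRingType) (N : lmodType R) :
  exists2 Z, Z 0 = N & syzseq (@projective R) Z.
Proof.
have [|Z [Z0 Zs _]] := @syzseq_exists R (@projective R) (fun=> True) N I.
  by move=> M _; have [M' h] := enough_projectives M; exists M'.
by exists Z.
Qed.

Lemma injective_cosyzseq (R : nzRingType) (N : lmodType R) :
  exists2 Z, Z 0 = N & cosyzseq (@injmod R) Z.
Proof.
have [|Z [Z0 Zs _]] := @cosyzseq_exists R (@injmod R) (fun=> True) N I.
  by move=> M _; have [M' h] := enough_injectives M; exists M'.
by exists Z.
Qed.

Lemma projective_resolution (R : nzRingType) (N : lmodType R) :
  exists P : resolution N, forall i, projective (P i).
Proof. by have [Z <- /resolution_of] := projective_syzseq N. Qed.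

(** Tor_(k+1)(V, N) is Tor_1 of V with the k-th syzygy of N. *)
Lemma Tor_zero_rsyz (R : nzRingType) (V : lmodType R^c) (N : lmodType R)
    (P : resolution N) : (forall i, projective (P i)) ->
    (forall j, (1 <= j)%N -> Tor_zero j V N) ->
  forall k, ext1z (rsyz P k) (charL V).
Proof.
move=> PP VN k; have [q [qs qE]] := rsyz_out P k.
apply: (tens_ext1z qs) => //.
have [q' [q's q'E]] := rsyz_out P k.+1; have [_ q'S _] := q's.
set I := (I in tens_map I _).
have dE x : tens_map I (rsyz_in P k) (tens_map I q' x) = tens_map I (rdiff P k) x.
  move: x; apply: tens_ext => [x y|x y|v x]; rewrite ?tens_mapD //.
  by rewrite !tens_mapE; congr (tpure _ _); apply: q'E.
have d0 : (fun x => tens_map I q' (tens_map I (rdiff P k.+1) x)) =1 (fun=> 0).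
  apply: tens_ext => [x y|x y|v x]; rewrite ?tens_mapD ?addr0 //.
  rewrite !tens_mapE; have -> : q' (rdiff P k.+1 x) = 0.
    by apply: (@iin_inj _ _ _ (rdiff P k)); rewrite linear0 [LHS]q'E rexact; exists x.
  have [_ bDr _] := tpure_balanced V (rsyz P k.+1); exact: (morph_add0 (bDr v)).
suff inj0 x : tens_map I (rsyz_in P k) x = 0 -> x = 0.
  move=> x y xy; apply/eqP; rewrite -subr_eq0; apply/eqP/inj0.
  by rewrite tens_mapD (morph_addN (tens_mapD _ _)) xy subrr.
have IS : surj I by move=> y; exists y.
have [y <-] := tens_map_surj IS q'S x; rewrite dE.
by move=> /(VN k.+1 isT P PP)[z <-]; apply: d0.
Qed.

(** * Tensor products with a bimodule and Hom out of it *)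

Section BimoduleFunctors.
Variables (R S : nzRingType) (U : bimod R S).

Fact tmap_linear (X X' : lmodType S) (h : {linear X -> X'}) :
  linear (tens_map (idfun : {linear rmod U -> rmod U}) h
    : tens (rmod U) X -> tens (rmod U) X').
Proof.
move=> r x y; rewrite tens_mapD; congr (_ + _); move: x.
apply: tens_ext => [x y'|x y'|u x]; rewrite ?tens_mapD ?scalerDr ?tens_mapD //.
by rewrite scale_tpure !tens_mapE scale_tpure.
Qed.
Definition tmap (X X' : lmodType S) (h : {linear X -> X'}) :
  {linear tens (rmod U) X -> tens (rmod U) X'} := mklin (tmap_linear h).

Lemma tmapE (X X' : lmodType S) (h : {linear X -> X'}) u x :
  tmap h (tpure (u : rmod U) x) = tpure (u : rmod U) (h x).
Proof. exact: tens_mapE. Qed.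

Lemma tens_lin_ext (X : lmodType S) (Y : lmodType R)
    (f g : {linear tens (rmod U) X -> Y}) :
  (forall u x, f (tpure (u : rmod U) x) = g (tpure (u : rmod U) x)) -> f =1 g.
Proof. by move=> fg; apply: tens_ext => //; exact: linearD. Qed.

Lemma tmap_comp (X X' X'' : lmodType S) (h : {linear X -> X'})
    (k : {linear X' -> X''}) z : tmap k (tmap h z) = tmap (k \o h) z.
Proof.
move: z; apply: (@tens_lin_ext _ _ (tmap k \o tmap h)) => u x.
by rewrite -[LHS]/(tmap k (tmap h _)) !tmapE.
Qed.

Lemma eq_tmap (X X' : lmodType S) (h k : {linear X -> X'}) :
  h =1 k -> tmap h =1 tmap k.
Proof. by move=> hk; apply: tens_lin_ext => u x; rewrite !tmapE hk. Qed.

Lemma tmap0 (X X' : lmodType S) (h : {linear X -> X'}) :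
  (forall x, h x = 0) -> forall z, tmap h z = 0.
Proof.
move=> h0; apply: (@tens_lin_ext _ _ (tmap h) \0) => u x.
rewrite tmapE h0 /=; have [_ bDr _] := tpure_balanced (rmod U) X';
  exact: (morph_add0 (bDr u)).
Qed.

Lemma tmap_id (X : lmodType S) (h : {linear X -> X}) :
  (forall x, h x = x) -> forall z, tmap h z = z.
Proof. by move=> hid; apply: (@tens_lin_ext _ _ (tmap h) idfun) => u x; rewrite tmapE hid. Qed.

Lemma tmap_surj (X X' : lmodType S) (h : {linear X -> X'}) : surj h -> surj (tmap h).
Proof. by move=> hS; apply: tens_map_surj => // y; exists y. Qed.

Lemma tmap_ker (K P L : lmodType S) (i : {linear K -> P}) (p : {linear P -> L}) z :
    surj p -> (forall x, p x = 0 -> exists y, i y = x) -> tmap p z = 0 ->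
  exists w, tmap i w = z.
Proof. exact: tens_right_exact. Qed.

Lemma tmap_ses (K P L : lmodType S) (i : {linear K -> P}) (p : {linear P -> L}) :
  ses i p -> ext1z L (charL (rmod U)) -> ses (tmap i) (tmap p).
Proof.
move=> ip LU; have [iI pS ex] := ip; split; first exact: ext1z_tens ip LU.
  exact: tmap_surj.
move=> x; split=> [|[y <-]]; first by apply: tmap_ker => // z /ex.
by rewrite tmap_comp tmap0 // => z /=; rewrite (ses0 _ ip).
Qed.

Lemma tens_univ (X : lmodType S) (Y : lmodType R) (b : U -> X -> Y) :
    balanced (b : rmod U -> X -> Y) -> (forall r u x, b (r *: u) x = r *: b u x) ->
  exists h : {linear tens (rmod U) X -> Y}, forall u x, h (tpure (u : rmod U) x) = b u x.
Proof.
move=> bb bZ.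
have hL : linear (tens_lift (b : rmod U -> X -> Y)).
  move=> r x y; rewrite tens_liftD //; congr (_ + _); move: x.
  apply: tens_ext => [x y'|x y'|u x]; rewrite ?scalerDr ?tens_liftD ?scalerDr //.
  by rewrite scale_tpure !tens_liftE.
by exists (mklin hL) => u x; apply: tens_liftE.
Qed.

Definition hcomp (W W' : lmodType S^c) (h : {linear W -> W'}) (k : homr U W) : homr U W' :=
  (h \o (k : {linear rmod U -> W}) : {linear rmod U -> W'}).
Fact hmap_linear (W W' : lmodType S^c) (h : {linear W -> W'}) : linear (hcomp h).
Proof. by move=> r k k'; apply: linear_eq => u; rewrite /= linearD. Qed.
Definition hmap (W W' : lmodType S^c) (h : {linear W -> W'}) :
  {linear homr U W -> homr U W'} := mklin (hmap_linear h).
Lemma hmapE (W W' : lmodType S^c) (h : {linear W -> W'}) k u : hmap h k u = h (k u).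
Proof. by []. Qed.

Lemma homr_ext (W : lmodType S^c) (h k : homr U W) : h =1 k -> h = k.
Proof. exact: linear_eq. Qed.
Lemma homrD (W : lmodType S^c) (h : homr U W) u u' : h (u + u') = h u + h u'.
Proof. exact: (linearD (h : {linear rmod U -> W})). Qed.
Lemma homrZ (W : lmodType S^c) (h : homr U W) (s : S) u :
  h (bract (u : U) s) = (s : S^c) *: h u.
Proof. exact: (linearZ_LR (h : {linear rmod U -> W}) (s : S^c) (u : rmod U)). Qed.

Lemma hmap_ses (K P L : lmodType S^c) (i : {linear K -> P}) (p : {linear P -> L}) :
  ses i p -> ext1z (rmod U) K -> ses (hmap i) (hmap p).
Proof.
move=> ip UK; have [iI pS ex] := ip; split=> [h k e|h|h].
- by apply: homr_ext => u; apply: iI; rewrite -!hmapE e.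
- have [k kE] := ext1z_lift (h : {linear rmod U -> L}) UK ip.
  by exists (k : homr U P); apply: homr_ext => u; apply: kE.
- split=> [hp|[k <-]]; last first.
    by apply: homr_ext => u; apply: (ses0 _ ip).
  have [|k kE] := ses_lift (h := h : {linear rmod U -> P}) ip.
    by move=> u; rewrite -[LHS]/(hmap p h u) hp.
  by exists (k : homr U K); apply: homr_ext => u; apply: kE.
Qed.

(** ** The right module G (x) U and its adjunction with [homr] *)

Definition tensr (G : lmodType R^c) : Type := tens G U.

Section TensorRight.
Variable G : lmodType R^c.
HB.instance Definition _ := GRing.Zmodule.on (tensr G).

Definition ract (s : S) (g : G) (u : U) : tens G U := tpure g (bract u s).
Lemma ract_balanced s : balanced (ract s).
Proof.
have [bDl bDr bZ] := tpure_balanced G U.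
rewrite /ract; split=> [g g' u|g u u'|r g u]; rewrite ?bDl //.
  by rewrite bractDl bDr.
by rewrite bZ bractZ.
Qed.
Definition tensr_scale (s : S^c) : tensr G -> tensr G := tens_lift (ract (s : S)).
Lemma tensr_scaleE s g u : tensr_scale s (tpure g u) = tpure g (bract u (s : S)).
Proof. exact/tens_liftE/ract_balanced. Qed.
Fact tensr_scaleDr : right_distributive tensr_scale +%R.
Proof. by move=> r; exact/tens_liftD/ract_balanced. Qed.
Fact tensr_scaleA r s t : tensr_scale r (tensr_scale s t) = tensr_scale (r * s) t.
Proof.
move: t; apply: tens_ext => [t t'|t t'|u x]; rewrite ?tensr_scaleDr //.
by rewrite !tensr_scaleE -bractA.
Qed.
Fact tensr_scale1 : left_id 1 tensr_scale.
Proof.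
apply: tens_ext => [t t'|t t'|u x]; rewrite ?tensr_scaleDr //.
by rewrite tensr_scaleE bract1.
Qed.
Fact tensr_scaleDl t : {morph tensr_scale^~ t : r s / r + s}.
Proof.
move=> r s; move: t.
apply: tens_ext => [t t'|t t'|g u]; rewrite ?tensr_scaleDr //.
  by rewrite addrACA.
by have [_ bDr _] := tpure_balanced G U; rewrite !tensr_scaleE bractDr bDr.
Qed.
HB.instance Definition _ := GRing.Zmodule_isLmodule.Build S^c (tensr G)
  tensr_scaleA tensr_scale1 tensr_scaleDr tensr_scaleDl.
End TensorRight.

Lemma tensrD (G G' : lmodType R^c) (i : {linear G -> G'}) :
  linear (tens_map i (idfun : {linear U -> U}) : tensr G -> tensr G').
Proof.
move=> s x y; rewrite [LHS]tens_mapD; congr (_ + _); move: x.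
apply: tens_ext => [x y'|x y'|g u].
- by rewrite [s *: _]tensr_scaleDr [LHS]tens_mapD.
- by rewrite tens_mapD [LHS]tensr_scaleDr.
- by rewrite [s *: _]tensr_scaleE !tens_mapE [RHS]tensr_scaleE.
Qed.
Definition tensr_map (G G' : lmodType R^c) (i : {linear G -> G'}) :
  {linear tensr G -> tensr G'} := mklin (tensrD i).

(** Extending maps to Hom(U, E) amounts by adjunction to extending maps to E. *)
Lemma homr_extend (G G' : lmodType R^c) (i : {linear G -> G'}) (E : lmodType S^c)
    (h : {linear G -> homr U E}) :
    (forall k : {linear tensr G -> E}, exists k' : {linear tensr G' -> E},
       forall x, k' (tensr_map i x) = k x) ->
  exists h' : {linear G' -> homr U E}, forall x, h' (i x) = h x.
Proof.
move=> ext.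
have bb : balanced (fun g u => h g u).
  split=> [g g' u|g u u'|r g u]; [by rewrite linearD|exact: homrD|by rewrite linearZ].
have kL : linear (tens_lift (fun g u => h g u) : tensr G -> E).
  move=> s x y; rewrite [LHS]tens_liftD //; congr (_ + _); move: x.
  apply: tens_ext => [x y'|x y'|g u].
  - by rewrite [s *: _]tensr_scaleDr [LHS]tens_liftD.
  - by rewrite tens_liftD // scalerDr.
  - by rewrite [s *: _]tensr_scaleE !tens_liftE //; apply: homrZ.
have [k kE] := ext (mklin kL).
have [bDl bDr bZ] := tpure_balanced G' U.
have rL g : linear (fun u : rmod U => k (tpure g (u : U) : tensr G')).
  move=> s u u'; rewrite -linearZ -linearD; congr (k _).
  by rewrite bDr; congr (_ + _); rewrite [RHS]tensr_scaleE.
have h'L : linear (fun g => (mklin (rL g) : {linear rmod U -> E}) : homr U E).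
  move=> r g g'; apply: homr_ext => u /=.
  rewrite -[LHS]/(k _) -[RHS]/(k _ + k _) -linearD; congr (k _).
  by rewrite [LHS]bDl; congr (_ + _); rewrite [LHS]bZ.
exists (mklin h'L) => x; apply: homr_ext => u.
rewrite -[LHS]/(k (tpure (i x) u)).
have := kE (tpure x u : tensr G); rewrite /= tens_mapE /= => ->.
by rewrite tens_liftE.
Qed.

Lemma ext1z_homr_inj (L : lmodType R^c) (E : lmodType S^c) :
  ext1z L (charR U) -> injmod E -> ext1z L (homr U E).
Proof.
move=> LU EI; have [L' [P [i [p [PP ip]]]]] := enough_projectives L.
apply: (ext1z_pres ip PP) => h; apply: homr_extend => k.
by apply: EI; apply: (ext1z_tensR ip LU).
Qed.

(** Both sides are the balanced maps from U and F to the cogenerator. *)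
Lemma charR_tens (F : lmodType S) :
  isomorphic (charR (tens (rmod U) F)) (homr U (charR F)).
Proof.
have [bDl bDr bZ] := tpure_balanced (rmod U) F.
have cD (c : charR (tens (rmod U) F)) (u : rmod U) :
    {morph (fun x => c (tpure u x)) : x y / x + y}.
  by move=> x y; rewrite bDr chrD.
have cL c : linear (fun u : rmod U => Chr (cD c u) : charR F).
  by move=> s u u'; apply: chr_ext => x /=; rewrite bDl chrD bZ.
have hL : linear (fun c => (mklin (cL c) : {linear rmod U -> charR F}) : homr U (charR F)).
  move=> r c c'; apply: homr_ext => u; apply: chr_ext => x /=.
  by rewrite -[LHS]/((r *: c + c') (tpure u x)) chrDE chrZE scale_tpure.
apply: (iso_bij (f := mklin hL)) => [c c' cc'|h].
  apply: chr_ext; apply: tens_ext; [exact: chrD|exact: chrD|move=> u x].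
  by have := congr1 (fun h : homr U (charR F) => h u x) cc'.
have bb : balanced (fun (u : rmod U) (x : F) => h u x).
  split=> [u u' x|u x x'|s u x]; last 1 first.
  - exact: (congr1 (fun c : charR F => c x) (homrZ h s u)).
  - exact: (congr1 (fun c : charR F => c x) (homrD h u u')).
  - exact: chrD.
exists (Chr (tens_liftD bb)); apply: homr_ext => u; apply: chr_ext => x /=.
exact: tens_liftE.
Qed.

End BimoduleFunctors.

Lemma flat_iso (R : nzRingType) (F F' : lmodType R) :
  isomorphic F F' -> flat F -> flat F'.
Proof. by move=> /iso_sym/iso_retract; apply: flat_retract. Qed.
Lemma rflat_iso (R : nzRingType) (F F' : lmodType R^c) :
  isomorphic F F' -> rflat F -> rflat F'.
Proof.
move=> /iso_sym/iso_retract FF' /rflatP F'f; apply/rflatP.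
exact: injmod_retract (chrmap_retract (amL R) FF') F'f.
Qed.
Lemma proj_iso (R : nzRingType) (P P' : lmodType R) :
  isomorphic P P' -> projective P -> projective P'.
Proof. by move=> /iso_sym/iso_retract; apply: projective_retract. Qed.

Lemma chr_cosyzseq (S R : nzRingType) (sigma : antimor S R)
    (T : lmodType R -> Prop) Z : (forall P, T P -> injmod (chrmod sigma P)) ->
  syzseq T Z -> cosyzseq (@injmod S) (fun i => chrmod sigma (Z i)).
Proof.
move=> TI ZT i; have [P [a [b [TP ab]]]] := ZT i.
by exists (chrmod sigma P), (chrmap sigma b), (chrmap sigma a); split;
  [apply: TI|apply: chrmap_ses].
Qed.

Lemma rfd_charL (R : nzRingType) (V : lmodType R^c) : rfd_finite V ->
  exists K n, [/\ K 0 = charL V, cosyzseq (@injmod R) K & injmod (K n)].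
Proof.
move=> /(finite_dimP (@rflat_iso R))[Z [n [Z0 Zf Zn]]].
exists (fun i => charL (Z i)), n; rewrite Z0; split=> //; last exact/rflatP.
by apply: chr_cosyzseq Zf => P /rflatP.
Qed.

(** The characters of a finite flat resolution of U form a finite injective
    coresolution of U^+. *)
Lemma fd_syzygy (R : nzRingType) (U : lmodType R) : fd_finite U ->
  exists n, forall (L : nat -> lmodType R^c) m, syzseq (@projective R^c) L ->
    (n <= m)%N -> ext1z (L m) (charR U).
Proof.
move=> /(finite_dimP (@flat_iso R))[Z [n [<- Zf Zn]]]; exists n => L m Lp le_nm.
have KI : cosyzseq (@injmod R^c) (fun i => charR (Z i)).
  by apply: chr_cosyzseq Zf => P /flatP.
have := (ext1z_balanceD (m - n) 0 n Lp KI).2; rewrite subnK //; apply.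
by rewrite add0n; apply: ext1z_inj; apply/flatP.
Qed.

Section TensorFlatDimension.
Variables (B A : nzRingType) (U : bimod B A).

(** With F flat, F^+ is injective, so that the characters of the syzygies of
    U (x) F are the cosyzygies of Hom(U, F^+); those far enough are injective
    because Tor_1 of U vanishes on far syzygies. *)
Lemma tens_flat_syzygy : fd_finite U ->
  exists n, forall (F : lmodType A) (Z : nat -> lmodType B) m, flat F ->
    isomorphic (Z 0) (tens (rmod U) F) -> syzseq (@projective B) Z ->
    (n <= m)%N -> flat (Z m).
Proof.
move=> /fd_syzygy[n nP]; exists n => F Z m /flatP FI Z0 ZP le_nm.
apply/flatP/injmodP => G.
have CI := chr_cosyzseq (@charR_projective B) ZP.
have [L L0 LP] := projective_syzseq G.
rewrite -L0; apply: (ext1z_balanceD 0 0 m LP CI).1; rewrite add0n.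
have iso0 : retract (charR (Z 0)) (homr U (charR F)).
  have [f [g fK]] := chrmap_retract (amR B) (iso_retract Z0).
  have [f' [g' [fK' gK']]] := (isoP _ _).1 (charR_tens U F).
  by exists (f' \o f), (g \o g'); apply: can_comp.
exact: ext1z_retractr iso0 (ext1z_homr_inj (nP L m LP le_nm) FI).
Qed.

(** U (x) F has finite flat dimension, and Ext^1(L, -) vanishes on flat modules
    for all cosyzygies of L. *)
Lemma DP_ext_tens (C : lmodType B -> Prop) L (F : lmodType A) :
  DP_class C -> C L -> fd_finite U -> flat F -> ext1z L (tens (rmod U) F).
Proof.
move=> Cclass CL /tens_flat_syzygy[n nP] Ff.
have [Z Z0 ZP] := projective_syzseq (tens (rmod U) F).
rewrite -Z0; apply: (@ext1z_syzygy_dim _ C (@flat B) Z n) => //.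
- by move=> Y /Cclass[[Y' [CY' lk]] _ _]; exists Y'.
- by move=> i; apply: linked_sub (ZP i) => P; apply: projective_flat.
- by move=> Q Y Qf /Cclass[_ _]; apply.
- by apply: (nP F Z n) => //; rewrite Z0; apply: iso_refl.
Qed.

(** V^+ has a finite injective coresolution, and Ext^1(L, V^+) is an Ext^1 of any
    cosyzygy of L with values in its members. *)
Lemma DP_ext_charL (C : lmodType B -> Prop) L (V : lmodType B^c) :
  DP_class C -> C L -> rfd_finite V -> ext1z L (charL V).
Proof.
move=> Cclass CL /rfd_charL[K [n [<- KI Kn]]].
apply: (@ext1z_coresolution _ C (@projective B) K n) CL => //.
- by move=> Y /Cclass[_ [Y' [CY' lk]] _]; exists Y'.
- by move=> Q i QP; apply: ext1z_proj.
Qed.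
End TensorFlatDimension.

(** * One half of a module over the Morita context ring *)

(** A module (X, Y, f, g) is symmetric in its two components. The lemmas of this
    part concern the component X only and are used twice, the second time with
    the two rings and the two bimodules exchanged. *)
Section LeftHalf.
Variables (A B : nzRingType) (V : bimod A B) (U : bimod B A).
Hypothesis VU0 : tens_zero (rmod V) U.

Lemma tmapD (Y Y' : lmodType B) (h k : {linear Y -> Y'}) z :
  tmap V (h \+ k) z = tmap V h z + tmap V k z.
Proof.
have [_ bDr _] := tpure_balanced (rmod V) Y'.
move: z; apply: (@tens_lin_ext _ _ _ _ _ (tmap V (h \+ k)) (tmap V h \+ tmap V k)) => v y.
by rewrite -[RHS]/(tmap V h _ + tmap V k _) !tmapE bDr.
Qed.

Lemma tens_tens0 (X : lmodType A) (t : tens (rmod V) (tens (rmod U) X)) : t = 0.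
Proof.
have [bDl bDr bZ] := tpure_balanced (rmod V) (tens (rmod U) X).
have [bDl' bDr' bZ'] := tpure_balanced (rmod U) X.
have p0 v w : tpure (v : rmod V) (w : tens (rmod U) X) = 0.
  move: w; apply: tens_ind => [|u x w IH]; first exact: (morph_add0 (bDr v)).
  rewrite bDr IH addr0.
  apply: (@balanced_eq0 _ _ _ _ (fun (v : rmod V) (u : U) => tpure v (tpure (u : rmod U) x)) VU0).
  split=> [m m' n|m n n'|r m n].
  - by rewrite bDl.
  - by rewrite -bDr -bDl'.
  - by rewrite bZ scale_tpure.
by move: t; apply: tens_ind => // v w x ->; rewrite p0 addr0.
Qed.

(** V (x) Y and V (x) coker(f) agree, as V (x) U = 0. *)
Lemma tmap_coker_inj (X : lmodType A) (Y L : lmodType B)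
    (f : {linear tens (rmod U) X -> Y}) (q : {linear Y -> L}) :
  surj q -> (forall y, q y = 0 -> exists t, f t = y) -> injective (tmap V q).
Proof.
move=> qS ex; apply: lin_inj => z /(tmap_ker qS ex)[w <-].
by rewrite (tens_tens0 w) linear0.
Qed.

Lemma tmap_section_surj (X : lmodType A) (Y L Q : lmodType B)
    (f : {linear tens (rmod U) X -> Y}) (q : {linear Y -> L})
    (b : {linear Q -> Y}) (r : {linear Q -> L}) :
  surj q -> (forall y, q y = 0 -> exists t, f t = y) -> surj r ->
  (forall x, q (b x) = r x) -> surj (tmap V b).
Proof.
move=> qS ex rS qb z; have [w wE] := tmap_surj (U := V) rS (tmap V q z).
exists w; apply: (tmap_coker_inj qS ex).
by rewrite tmap_comp (eq_tmap (k := r)).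
Qed.

Section Induced.
Variables (P : lmodType A) (Q : lmodType B).

(** The structure map V (x) (Q + U (x) P) -> P + V (x) Q of the module induced
    from the pair (P, Q); it kills V (x) U (x) P. *)
Definition Tg_fun (z : tens (rmod V) (Q * tens (rmod U) P)%type) :
  P * tens (rmod V) Q := (0, tmap V fst z).
Fact Tg_linear : linear Tg_fun.
Proof.
move=> a x y; rewrite /Tg_fun linearP.
by rewrite [RHS]surjective_pairing /= scaler0 addr0.
Qed.
Definition Tg : {linear tens (rmod V) (Q * tens (rmod U) P)%type ->
  (P * tens (rmod V) Q)%type} := mklin Tg_linear.

Definition inl_lin : {linear Q -> (Q * tens (rmod U) P)%type} := pinl Q _.

Lemma TgE z : Tg z = (0, tmap V fst z). Proof. by []. Qed.

Lemma tmap_inlK z : tmap V fst (tmap V inl_lin z) = z.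
Proof. by rewrite tmap_comp tmap_id. Qed.

Lemma tmap_fstK z : tmap V inl_lin (tmap V (fst : {linear (Q * tens (rmod U) P)%type -> Q}) z) = z.
Proof.
pose inr_lin := pinr Q (tens (rmod U) P).
rewrite -[RHS](@tmap_id _ _ V _ ((inl_lin \o fst) \+ (inr_lin \o snd))).
  rewrite tmapD tmap_comp -[X in _ = _ + X]tmap_comp (tens_tens0 (tmap V snd z)).
  by rewrite linear0 addr0.
by case=> a b /=; rewrite [LHS]surjective_pairing /= addr0 add0r.
Qed.

Lemma Tg_inj : injective Tg.
Proof. by move=> x y [] /(congr1 (tmap V inl_lin)); rewrite !tmap_fstK. Qed.

Lemma Tg_onto w : exists z, Tg z = (0, w).
Proof. by exists (tmap V inl_lin w); rewrite TgE tmap_inlK. Qed.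
End Induced.

Section Resolutions.
Variables (X LA P LA' : lmodType A) (Y LB Q LB' : lmodType B).
Variables (f : {linear tens (rmod U) X -> Y}) (g : {linear tens (rmod V) Y -> X}).
Variables (p : {linear X -> LA}) (q : {linear Y -> LB}).
Hypotheses (gp : ses g p) (fq : ses f q).

(** Embedding X into P + V (x) Q, from embeddings of the cokernels: the second
    component extends V (x) Y -> V (x) Q along g. *)
Lemma half_embed (i : {linear LA -> P}) (pi : {linear P -> LA'})
    (j : {linear LB -> Q}) (rho : {linear Q -> LB'}) :
    ses i pi -> ses j rho -> ext1z LA (tens (rmod V) Q) ->
    ext1z LB' (charL (rmod V)) ->
  exists phi : {linear X -> (P * tens (rmod V) Q)%type},
    [/\ injective phi, forall x, (phi x).1 = i (p x) &
        forall z, phi (g z) = (0, tmap V (j \o q) z)].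
Proof.
move=> ipi jrho LAQ LBV.
have [e eE] := LAQ _ _ _ _ gp (tmap V (j \o q)).
have phiL : linear (fun x => (i (p x), e x)).
  by move=> a x y; rewrite [RHS]surjective_pairing /= !linearP.
exists (mklin phiL); split=> // [|z]; last by rewrite /= (ses0 _ gp) linear0 eE.
apply: lin_inj => x /= [ip0 ex0].
have [iI _ _] := ipi; have [_ _ exg] := gp.
have [z zx] := (exg x).1 (lin_inj0 iI ip0); subst x.
move: ex0; rewrite eE -tmap_comp.
have [jI _ _] := tmap_ses jrho LBV; move/(lin_inj0 jI).
have [_ qS exf] := fq.
have qI := tmap_coker_inj qS (fun y => (exf y).1).
by move/(lin_inj0 qI) => ->; rewrite linear0.
Qed.

Lemma half_embed_coker (i : {linear LA -> P}) (pi : {linear P -> LA'})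
    (X' : lmodType A) (Y' : lmodType B)
    (phi : {linear X -> (P * tens (rmod V) Q)%type})
    (phi2 : {linear Y -> (Q * tens (rmod U) P)%type})
    (c1 : {linear (P * tens (rmod V) Q)%type -> X'})
    (c2 : {linear (Q * tens (rmod U) P)%type -> Y'})
    (g' : {linear tens (rmod V) Y' -> X'}) :
    ses i pi -> ses phi c1 -> ses phi2 c2 ->
    (forall x, (phi x).1 = i (p x)) ->
    (forall z, phi (g z) = Tg P Q (tmap V phi2 z)) ->
    (forall z, c1 (Tg P Q z) = g' (tmap V c2 z)) ->
  exists p' : {linear X' -> LA'}, ses g' p'.
Proof.
move=> ipi phic phic2 phi1 phig cg.
have [iI piS expi] := ipi; have [phiI c1S exc1] := phic; have [_ c2S exc2] := phic2.
have [_ pS exg] := gp.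
have [|p' p'E] := ses_desc (h := pi \o fst) phic.
  by move=> x /=; rewrite phi1 (ses0 _ ipi).
exists p'; split.
- apply: lin_inj => z'; have [z <-] := tmap_surj (U := V) c2S z'.
  rewrite -cg => /exc1[x xE].
  have /(lin_inj0 iI)/exg[y yx] : i (p x) = 0 by rewrite -phi1 xE.
  have zE : z = tmap V phi2 y by apply: (@Tg_inj P Q); rewrite -xE -yx phig.
  by rewrite zE tmap_comp tmap0 // => t /=; rewrite (ses0 _ phic2).
- move=> l; have [a <-] := piS l; exists (c1 (a, 0)); exact: p'E.
- move=> x'; split=> [|[z' <-]]; last first.
    by have [z <-] := tmap_surj (U := V) c2S z'; rewrite -cg p'E /= linear0.
  have [[a w] <-] := c1S x'; rewrite p'E /= => /expi[l la].
  have [x xl] := pS l.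
  have [z zE] := Tg_onto P (w - (phi x).2).
  exists (tmap V c2 z); rewrite -cg zE; apply/eqP; rewrite -subr_eq0 -linearB.
  apply/eqP/exc1; exists (- x); rewrite linearN.
  rewrite [LHS]surjective_pairing [RHS]surjective_pairing /= phi1 xl la sub0r.
  by rewrite addrAC subrr add0r.
Qed.

Section Cover.
Variables (i : {linear LA' -> P}) (pi : {linear P -> LA}).
Variables (j : {linear LB' -> Q}) (rho : {linear Q -> LB}).
Hypotheses (ipi : ses i pi) (jrho : ses j rho).
Hypothesis LBV : ext1z LB (charL (rmod V)).
Variables (a : {linear P -> X}) (b : {linear Q -> Y}).
Hypotheses (paE : forall x, p (a x) = pi x) (qbE : forall y, q (b y) = rho y).
Variable psi : {linear (P * tens (rmod V) Q)%type -> X}.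
Hypothesis psiE : forall x w, psi (x, w) = a x + g (tmap V b w).

(** The horseshoe cover of X by P + V (x) Q: the second summand reaches the image
    of g as V (x) Q -> V (x) LB is onto and V (x) LB is V (x) Y. *)
Lemma half_cover_surj : surj psi.
Proof.
move=> x; have [_ piS _] := ipi; have [y yx] := piS (p x).
have [_ _ exg] := gp.
have [|z zE] := (exg (x - a y)).1; first by rewrite linearB paE yx subrr.
have [_ qS exf] := fq; have [_ rhoS _] := jrho.
have [w wz] := tmap_section_surj qS (fun y => (exf y).1) rhoS qbE z.
by exists (y, w); rewrite psiE wz zE addrC subrK.
Qed.

Variables (X' : lmodType A) (Y' : lmodType B).
Variables (k1 : {linear X' -> (P * tens (rmod V) Q)%type}).
Variables (k2 : {linear Y' -> (Q * tens (rmod U) P)%type}).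
Variable psi2 : {linear (Q * tens (rmod U) P)%type -> Y}.
Hypotheses (kpsi : ses k1 psi) (kpsi2 : ses k2 psi2).
Variables (f' : {linear tens (rmod U) X' -> Y'}) (g' : {linear tens (rmod V) Y' -> X'}).
Hypothesis kg : forall z, k1 (g' z) = Tg P Q (tmap V k2 z).

Lemma half_cover_ker : exists p' : {linear X' -> LA'},
  [/\ forall x, i (p' x) = (k1 x).1, surj p' & forall z, p' (g' z) = 0].
Proof.
have [iI _ expi] := ipi; have [_ _ exg] := gp; have [k1I _ exk] := kpsi.
have [|p' p'E] := ses_lift (h := fst \o k1) ipi.
  move=> x /=; have := ses0 x kpsi; case: (k1 x) => y w; rewrite psiE /=.
  by move/(congr1 p); rewrite linearD paE (ses0 _ gp) addr0 linear0.
exists p'; split=> // [l|z]; last first.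
  by apply: iI; rewrite p'E /= kg linear0.
have [|z zE] := (exg (a (i l))).1; first by rewrite paE (ses0 _ ipi).
have [_ qS exf] := fq; have [_ rhoS _] := jrho.
have [w wz] := tmap_section_surj qS (fun y => (exf y).1) rhoS qbE z.
have [|x xE] := (exk (i l, - w)).1.
  by rewrite psiE linearN linearN wz zE subrr.
by exists x; apply: iI; rewrite p'E /= xE.
Qed.

Variables (p' : {linear X' -> LA'}) (q' : {linear Y' -> LB'}).
Hypotheses (p'E : forall x, i (p' x) = (k1 x).1) (q'E : forall y, j (q' y) = (k2 y).1).

Lemma tmap_cover z : tmap V fst (tmap V k2 z) = tmap V j (tmap V q' z).
Proof. by rewrite !tmap_comp; apply: eq_tmap => y /=; rewrite q'E. Qed.

Lemma half_cover_exact : surj q' -> forall x, p' x = 0 -> exists z, g' z = x.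
Proof.
move=> q'S x px; have [k1I _ _] := kpsi; have [gI _ _] := gp.
have := ses0 x kpsi; have := p'E x; rewrite px linear0.
case kx: (k1 x) => [y w] /= <-; rewrite psiE linear0 add0r.
move/(lin_inj0 gI)/(congr1 (tmap V q)); rewrite linear0 tmap_comp.
rewrite (eq_tmap (k := rho)) //.
have [_ _ exV] := tmap_ses jrho LBV; move/exV => [l lw].
have [z zl] := tmap_surj (U := V) q'S l.
exists z; apply: k1I; rewrite kg TgE kx tmap_cover zl lw; congr pair.
by have := p'E x; rewrite px linear0 kx.
Qed.

Lemma half_cover_inj : surj q' -> (forall y, q' y = 0 -> exists t, f' t = y) ->
  injective g'.
Proof.
move=> q'S exf'; apply: lin_inj => z gz.
have : tmap V fst (tmap V k2 z) = 0.
  by have := kg z; rewrite gz linear0 => /(congr1 snd)/esym.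
rewrite tmap_cover.
have [jI _ _] := tmap_ses jrho LBV; move/(lin_inj0 jI).
exact/lin_inj0/(tmap_coker_inj q'S exf').
Qed.
End Cover.
End Resolutions.

(** By the snake lemma, in which the kernel of g vanishes. *)
Lemma half_coker_ses (X X' XE : lmodType A) (Y Y' YE : lmodType B)
    (g : {linear tens (rmod V) Y -> X}) (g' : {linear tens (rmod V) Y' -> X'})
    (gE : {linear tens (rmod V) YE -> XE})
    (i1 : {linear X' -> XE}) (r1 : {linear XE -> X})
    (i2 : {linear Y' -> YE}) (r2 : {linear YE -> Y}) :
    ses i1 r1 -> ses i2 r2 -> injective g ->
    (forall z, i1 (g' z) = gE (tmap V i2 z)) ->
    (forall z, r1 (gE z) = g (tmap V r2 z)) ->
  exists (j : {linear mcoker g' -> mcoker gE}) (r : {linear mcoker gE -> mcoker g}),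
    [/\ ses j r, forall x, j (cpi g' x) = cpi gE (i1 x) & forall x, r (cpi gE x) = cpi g (r1 x)].
Proof.
move=> ir1 ir2 gI ig rg.
have [i1I r1S ex1] := ir1; have [_ r2S ex2] := ir2.
have [|j jE] := coker_desc (f := g') (h := cpi gE \o i1).
  by move=> z /=; rewrite ig; apply/cpiP; exists (tmap V i2 z).
have [|r rE] := coker_desc (f := gE) (h := cpi g \o r1).
  by move=> z /=; rewrite rg; apply/cpiP; exists (tmap V r2 z).
exists j, r; split=> //; split.
- apply: lin_inj => c; have [x <-] := cpi_surj c; rewrite jE /= => /cpiP[z zE].
  have : g (tmap V r2 z) = 0 by rewrite -rg zE (ses0 _ ir1).
  move/(lin_inj0 gI)/(tmap_ker r2S (fun y => (ex2 y).1)) => [w wz].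
  by apply/cpiP; exists w; apply: i1I; rewrite ig wz zE.
- move=> c; have [x <-] := cpi_surj c; have [e eE] := r1S x.
  by exists (cpi gE e); rewrite rE /= eE.
- move=> c; have [x <-] := cpi_surj c; rewrite rE /=; split=> [/cpiP[z zE]|[c' c'E]].
    have [w wz] := tmap_surj (U := V) r2S z.
    have [|y yE] := (ex1 (x - gE w)).1; first by rewrite linearB rg wz zE subrr.
    exists (cpi g' y); rewrite jE -[LHS]/(cpi gE (i1 y)) yE linearB.
    have -> : cpi gE (gE w) = 0 by apply/cpiP; exists w.
    by rewrite subr0.
  have [y yc] := cpi_surj c'; subst c'; move: c'E; rewrite jE -[X in X = _ -> _]/(cpi gE (i1 y)).
  move/eqP; rewrite -subr_eq0 -linearB => /eqP/cpiP[z zE].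
  apply/cpiP; exists (- tmap V r2 z); rewrite linearN -rg zE linearB (ses0 _ ir1).
  by rewrite sub0r opprK.
Qed.
End LeftHalf.

(** * Modules over the Morita context ring as quadruples *)

(** The part of a module cut out by the idempotent rho(1), for a multiplicative
    additive map rho that need not preserve 1. *)
Record cornermor (S R : nzRingType) := Cornermor {
  cmf :> S -> R;
  cmD : {morph cmf : x y / x + y};
  cmM : {morph cmf : x y / x * y}
}.

Section Corner.
Variables (S R : nzRingType) (rho : cornermor S R) (N : lmodType R).

Definition in_corner : pred N := [pred x | rho 1 *: x == x].
Record corner := Corner { cval :> N; cornerP : in_corner cval }.
HB.instance Definition _ := [isSub for cval].
HB.instance Definition _ := [Choice of corner by <:].
Fact corner_zmod_closed : zmod_closed in_corner.
Proof.
split=> [|x y]; rewrite !inE ?scaler0 // => /eqP ex /eqP ey.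
by rewrite scalerBr ex ey.
Qed.
HB.instance Definition _ :=
  GRing.SubChoice_isSubZmodule.Build N in_corner corner corner_zmod_closed.

Lemma corner_scale_subproof (s : S) (x : corner) : in_corner (rho s *: cval x).
Proof. by apply/eqP; rewrite scalerA -cmM mul1r. Qed.
Definition corner_scale s x := Corner (corner_scale_subproof s x).
Fact corner_scaleA s t x : corner_scale s (corner_scale t x) = corner_scale (s * t) x.
Proof. by apply: val_inj; rewrite /= scalerA cmM. Qed.
Fact corner_scale1 : left_id 1 corner_scale.
Proof. by move=> x; apply: val_inj => /=; apply/eqP; case: x. Qed.
Fact corner_scaleDr : right_distributive corner_scale +%R.
Proof. by move=> s x y; apply: val_inj; rewrite /= scalerDr. Qed.
Fact corner_scaleDl x : {morph corner_scale^~ x : s t / s + t}.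
Proof. by move=> s t; apply: val_inj; rewrite /= cmD scalerDl. Qed.
HB.instance Definition _ := GRing.Zmodule_isLmodule.Build S corner
  corner_scaleA corner_scale1 corner_scaleDr corner_scaleDl.

Definition cornermod : lmodType S := corner.
Lemma cval_inj : injective (cval : cornermod -> N). Proof. exact: val_inj. Qed.
Lemma cvalD (x y : cornermod) : cval (x + y) = cval x + cval y. Proof. by []. Qed.
Lemma cval1 (x : cornermod) : rho 1 *: cval x = cval x.
Proof. by apply/eqP; case: x. Qed.
Definition incorner (x : N) (h : rho 1 *: x = x) : cornermod := Corner (introT eqP h).
End Corner.

Section LambdaRing.
Variables (A B : nzRingType) (V : bimod A B) (U : bimod B A).
Local Notation L := (Lambda00 V U).

Definition lA (a : A) : L := Lmk a 0 0 0.
Definition lV (v : V) : L := Lmk 0 v 0 0.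
Definition lU (u : U) : L := Lmk 0 0 u 0.
Definition lB (b : B) : L := Lmk 0 0 0 b.

Lemma LmkM a v u b a' v' u' b' :
  Lmk a v u b * Lmk a' v' u' b' =
  Lmk (a * a') (a *: v' + bract v b') (bract u a' + b *: u') (b * b') :> L.
Proof. by []. Qed.
Lemma LmkD a v u b a' v' u' b' :
  Lmk a v u b + Lmk a' v' u' b' = Lmk (a + a') (v + v') (u + u') (b + b') :> L.
Proof. by []. Qed.

Definition Lsimp := (LmkM, LmkD, mul0r, mulr0, scale0r, scaler0, bract0l, bract0r,
  addr0, add0r, mul1r, mulr1, scale1r, bract1).

Fact lA_D : {morph lA : x y / x + y}.
Proof. by move=> x y; rewrite /lA !Lsimp. Qed.
Fact lA_M : {morph lA : x y / x * y}.
Proof. by move=> x y; rewrite /lA !Lsimp. Qed.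
Fact lB_D : {morph lB : x y / x + y}.
Proof. by move=> x y; rewrite /lB !Lsimp. Qed.
Fact lB_M : {morph lB : x y / x * y}.
Proof. by move=> x y; rewrite /lB !Lsimp. Qed.
Definition lAm := Cornermor lA_D lA_M.
Definition lBm := Cornermor lB_D lB_M.

Lemma L1E : (1 : L) = lA 1 + lB 1.
Proof. by rewrite /lA /lB !Lsimp. Qed.
End LambdaRing.

Definition LLm (A B : nzRingType) (V : bimod A B) (U : bimod B A)
    (UV0 : tens_zero (rmod U) V) (VU0 : tens_zero (rmod V) U)
    (X : lmodType A) (Y : lmodType B) (f : {linear tens (rmod U) X -> Y})
    (g : {linear tens (rmod V) Y -> X}) : lmodType (Lambda00 V U) :=
  LambdaL UV0 VU0 f g.

Section LeftModules.
Variables (A B : nzRingType) (V : bimod A B) (U : bimod B A).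
Variables (UV0 : tens_zero (rmod U) V) (VU0 : tens_zero (rmod V) U).
Local Notation L := (Lambda00 V U).
Local Notation LL f g := (LLm UV0 VU0 f g).

Lemma LLZ (X : lmodType A) (Y : lmodType B) (f : {linear tens (rmod U) X -> Y})
    (g : {linear tens (rmod V) Y -> X}) (l : L) x y :
  l *: ((x, y) : LL f g) =
  (La l *: x + g (tpure (Lv l : rmod V) y), f (tpure (Lu l : rmod U) x) + Lb l *: y).
Proof. by []. Qed.
Lemma LLD (X : lmodType A) (Y : lmodType B) (f : {linear tens (rmod U) X -> Y})
    (g : {linear tens (rmod V) Y -> X}) x y x' y' :
  ((x, y) : LL f g) + ((x', y') : LL f g) = (x + x', y + y').
Proof. by []. Qed.

Lemma quadL (N : lmodType L) : exists (X : lmodType A) (Y : lmodType B)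
  (f : {linear tens (rmod U) X -> Y}) (g : {linear tens (rmod V) Y -> X}),
  isomorphic N (LL f g).
Proof.
pose X := cornermod (lAm V U) N; pose Y := cornermod (lBm V U) N.
have uP (u : U) (x : X) : lB V U 1 *: (lU V u *: cval x) = lU V u *: cval x.
  by rewrite scalerA /lB /lU !Lsimp.
have vP (v : V) (y : Y) : lA V U 1 *: (lV U v *: cval y) = lV U v *: cval y.
  by rewrite scalerA /lA /lV !Lsimp.
have [||f fE] := @tens_univ _ _ U X Y (fun u x => incorner (rho := lBm V U) (uP u x)).
- split=> [u u' x|u x x'|a u x]; apply: cval_inj; rewrite ?cvalD /=.
  + by rewrite -scalerDl /lU !Lsimp.
  + by rewrite scalerDr.
  + by rewrite !scalerA; congr (_ *: _); rewrite /lU /lA !Lsimp.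
- move=> b u x; apply: cval_inj; rewrite /= scalerA; congr (_ *: _).
  by rewrite /lU /lB !Lsimp.
have [||g gE] := @tens_univ _ _ V Y X (fun v y => incorner (rho := lAm V U) (vP v y)).
- split=> [v v' y|v y y'|b v y]; apply: cval_inj; rewrite ?cvalD /=.
  + by rewrite -scalerDl /lV !Lsimp.
  + by rewrite scalerDr.
  + by rewrite !scalerA; congr (_ *: _); rewrite /lV /lB !Lsimp.
- move=> b u x; apply: cval_inj; rewrite /= scalerA; congr (_ *: _).
  by rewrite /lV /lA !Lsimp.
have pA (n : N) : lA V U 1 *: (lA V U 1 *: n) = lA V U 1 *: n.
  by rewrite scalerA /lA !Lsimp.
have pB (n : N) : lB V U 1 *: (lB V U 1 *: n) = lB V U 1 *: n.
  by rewrite scalerA /lB !Lsimp.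
exists X, Y, f, g; pose h (n : N) : LL f g :=
  (incorner (rho := lAm V U) (pA n), incorner (rho := lBm V U) (pB n)).
have hL : linear h.
  move=> l n n'; rewrite /h [X in _ = X + _]LLZ fE gE LLD.
  congr pair; apply: cval_inj => /=.
  - rewrite scalerDr !scalerA -scalerDl; congr (_ *: n + _).
    by case: l => [[a v] [u b]]; rewrite /lA /lV /lB /La /Lv /= [l in lA _ _ _ * l](_ : _ = Lmk a v u b) // !Lsimp.
  - rewrite scalerDr !scalerA -scalerDl; congr (_ *: n + _).
    by case: l => [[a v] [u b]]; rewrite /lA /lU /lB /Lu /Lb /= [l in lB _ _ _ * l](_ : _ = Lmk a v u b) // !Lsimp.
apply: (iso_bij (f := mklin hL)) => [n n' [e1 e2]|[x y]].
  by rewrite -[n]scale1r -[n']scale1r L1E !scalerDl e1 e2.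
have ex : lA V U 1 *: cval x = cval x := cval1 x.
have ey : lB V U 1 *: cval y = cval y := cval1 y.
have AB0 : lA V U 1 * lB V U 1 = 0 by rewrite /lA /lB !Lsimp.
have BA0 : lB V U 1 * lA V U 1 = 0 by rewrite /lA /lB !Lsimp.
exists (cval x + cval y); rewrite /= /h; congr pair; apply: cval_inj => /=.
- by rewrite scalerDr ex -ey scalerA AB0 scale0r addr0.
- by rewrite scalerDr ey -ex scalerA BA0 scale0r add0r.
Qed.

Section Maps.
Variables (X X' : lmodType A) (Y Y' : lmodType B).
Variables (f : {linear tens (rmod U) X -> Y}) (g : {linear tens (rmod V) Y -> X}).
Variables (f' : {linear tens (rmod U) X' -> Y'}) (g' : {linear tens (rmod V) Y' -> X'}).

Lemma LL_mk (h1 : {linear X -> X'}) (h2 : {linear Y -> Y'}) :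
  (forall z, h1 (g z) = g' (tmap V h2 z)) -> (forall z, h2 (f z) = f' (tmap U h1 z)) ->
  exists h : {linear LL f g -> LL f' g'}, forall x y, h (x, y) = (h1 x, h2 y).
Proof.
move=> hg hf.
have hL : linear ((fun m => (h1 m.1, h2 m.2)) : LL f g -> LL f' g').
  move=> l [x y] [x' y']; rewrite LLZ [(l *: _)%R]LLZ !LLD /=.
  by rewrite !linearD !linearZ /= hg hf !tmapE.
by exists (mklin hL).
Qed.

Lemma LL_comp (h : {linear LL f g -> LL f' g'}) :
  exists (h1 : {linear X -> X'}) (h2 : {linear Y -> Y'}),
  [/\ forall x y, h (x, y) = (h1 x, h2 y),
      forall z, h1 (g z) = g' (tmap V h2 z) & forall z, h2 (f z) = f' (tmap U h1 z)].
Proof.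
have t0V y : tpure (0 : rmod V) (y : Y) = 0 by apply: tpure0l.
have t0U x : tpure (0 : rmod U) (x : X) = 0 by apply: tpure0l.
have t0V' y : tpure (0 : rmod V) (y : Y') = 0 by apply: tpure0l.
have t0U' x : tpure (0 : rmod U) (x : X') = 0 by apply: tpure0l.
have tV0 (v : V) : tpure (v : rmod V) (0 : Y') = 0.
  by have [_ bDr _] := tpure_balanced (rmod V) Y'; apply: (morph_add0 (bDr _)).
have tU0 (u : U) : tpure (u : rmod U) (0 : X') = 0.
  by have [_ bDr _] := tpure_balanced (rmod U) X'; apply: (morph_add0 (bDr _)).
have tV0' (v : V) : tpure (v : rmod V) (0 : Y) = 0.
  by have [_ bDr _] := tpure_balanced (rmod V) Y; apply: (morph_add0 (bDr _)).
have tU0' (u : U) : tpure (u : rmod U) (0 : X) = 0.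
  by have [_ bDr _] := tpure_balanced (rmod U) X; apply: (morph_add0 (bDr _)).
have keyA (m : LL f' g') : lA V U 1 *: m = (m.1, 0).
  by case: m => a b; rewrite LLZ /= t0V' t0U' !linear0 !Lsimp.
have keyB (m : LL f' g') : lB V U 1 *: m = (0, m.2).
  by case: m => a b; rewrite LLZ /= t0V' t0U' !linear0 !Lsimp.
have e1 x : h (x, 0) = ((h (x, 0)).1, 0).
  have e : (x, 0) = lA V U 1 *: ((x, 0) : LL f g).
    by rewrite LLZ /= t0V t0U !linear0 !Lsimp.
  by rewrite {1}e linearZ_LR keyA.
have e2 y : h (0, y) = (0, (h (0, y)).2).
  have e : (0, y) = lB V U 1 *: ((0, y) : LL f g).
    by rewrite LLZ /= t0V t0U !linear0 !Lsimp.
  by rewrite {1}e linearZ_LR keyB.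
have h1L : linear (fun x => (h (x, 0)).1).
  move=> a x x'.
  have -> : (a *: x + x', 0) = lA V U a *: ((x, 0) : LL f g) + ((x', 0) : LL f g).
    by rewrite LLZ LLD /= t0V t0U linear0 linear0 !Lsimp.
  rewrite linearP e1 (e1 x') [lA V U a *: _]LLZ LLD /=.
  by rewrite t0V' linear0 !Lsimp.
have h2L : linear (fun y => (h (0, y)).2).
  move=> a x x'.
  have -> : (0, a *: x + x') = lB V U a *: ((0, x) : LL f g) + ((0, x') : LL f g).
    by rewrite LLZ LLD /= t0V t0U linear0 linear0 !Lsimp.
  rewrite linearP e2 (e2 x') [lB V U a *: _]LLZ LLD /=.
  by rewrite t0U' linear0 !Lsimp.
exists (mklin h1L), (mklin h2L); split=> [x y|z|z].
- have -> : (x, y) = ((x, 0) : LL f g) + ((0, y) : LL f g) by rewrite LLD !Lsimp.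
  by rewrite linearD e1 e2 LLD !Lsimp.
- move: z; apply: (@tens_lin_ext _ _ V _ _ (mklin h1L \o g) (g' \o tmap V (mklin h2L))) => v y.
  rewrite -[RHS]/(g' (tmap V (mklin h2L) _)) tmapE -[LHS]/(h (g (tpure (v : rmod V) y), 0)).1.
  have -> : (g (tpure (v : rmod V) y), 0) = lV U v *: ((0, y) : LL f g).
    by rewrite LLZ /= t0U linear0 !Lsimp.
  by rewrite linearZ_LR e2 [_ *: _]LLZ /= !Lsimp.
- move: z; apply: (@tens_lin_ext _ _ U _ _ (mklin h2L \o f) (f' \o tmap U (mklin h1L))) => u x.
  rewrite -[RHS]/(f' (tmap U (mklin h1L) _)) tmapE -[LHS]/(h (0, f (tpure (u : rmod U) x))).2.
  have -> : (0, f (tpure (u : rmod U) x)) = lU V u *: ((x, 0) : LL f g).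
    by rewrite LLZ /= t0V linear0 !Lsimp.
  by rewrite linearZ_LR e1 [_ *: _]LLZ /= !Lsimp.
Qed.
End Maps.

Section Sequences.
Variables (X1 X2 X3 : lmodType A) (Y1 Y2 Y3 : lmodType B).
Variables (f1 : {linear tens (rmod U) X1 -> Y1}) (g1 : {linear tens (rmod V) Y1 -> X1}).
Variables (f2 : {linear tens (rmod U) X2 -> Y2}) (g2 : {linear tens (rmod V) Y2 -> X2}).
Variables (f3 : {linear tens (rmod U) X3 -> Y3}) (g3 : {linear tens (rmod V) Y3 -> X3}).
Variables (h : {linear LL f1 g1 -> LL f2 g2}) (k : {linear LL f2 g2 -> LL f3 g3}).
Variables (h1 : {linear X1 -> X2}) (h2 : {linear Y1 -> Y2}).
Variables (k1 : {linear X2 -> X3}) (k2 : {linear Y2 -> Y3}).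
Hypotheses (hE : forall x y, h (x, y) = (h1 x, h2 y)).
Hypotheses (kE : forall x y, k (x, y) = (k1 x, k2 y)).

Lemma LL_ses : ses h k <-> ses h1 k1 /\ ses h2 k2.
Proof. exact: (pair_exact 0 0 0 0 hE kE). Qed.
End Sequences.

(** ** Modules with zero structure maps and induced modules *)

Definition ZL (K : lmodType A) (J : lmodType B) : lmodType L :=
  LL (\0 : {linear tens (rmod U) K -> J}) (\0 : {linear tens (rmod V) J -> K}).

Definition TL (P : lmodType A) (Q : lmodType B) : lmodType L :=
  LL (Tg U V Q P) (Tg V U P Q).

Section InducedMaps.
Variables (X P : lmodType A) (Y Q : lmodType B).
Variables (f : {linear tens (rmod U) X -> Y}) (g : {linear tens (rmod V) Y -> X}).

Lemma g_tmapf z : g (tmap V f z) = 0.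
Proof. by rewrite (tens_tens0 VU0 z) !linear0. Qed.
Lemma f_tmapg z : f (tmap U g z) = 0.
Proof. by rewrite (tens_tens0 UV0 z) !linear0. Qed.

Lemma TL_map (a : {linear P -> X}) (b : {linear Q -> Y}) :
  exists h : {linear TL P Q -> LL f g}, forall p w q z,
    h ((p, w), (q, z)) = (a p + g (tmap V b w), b q + f (tmap U a z)).
Proof.
pose h1 : {linear (P * tens (rmod V) Q)%type -> X} :=
  (a \o fst) \+ (g \o tmap V b \o snd).
pose h2 : {linear (Q * tens (rmod U) P)%type -> Y} :=
  (b \o fst) \+ (f \o tmap U a \o snd).
have [||h hE] := @LL_mk _ _ _ _ (Tg U V Q P) (Tg V U P Q) f g h1 h2.
- move=> z; rewrite /h2 tmapD -tmap_comp linearD -[X in _ = _ + g X]tmap_comp.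
  rewrite -[X in _ = _ + g X]tmap_comp g_tmapf addr0.
  by rewrite /h1 /= linear0 add0r.
- move=> z; rewrite /h1 tmapD -tmap_comp linearD -[X in _ = _ + f X]tmap_comp.
  rewrite -[X in _ = _ + f X]tmap_comp f_tmapg addr0.
  by rewrite /h2 /= linear0 add0r.
by exists h => p w q z; rewrite hE.
Qed.

Lemma TL_hom (h : {linear TL P Q -> LL f g}) :
  exists (a : {linear P -> X}) (b : {linear Q -> Y}), forall p w q z,
    h ((p, w), (q, z)) = (a p + g (tmap V b w), b q + f (tmap U a z)).
Proof.
have [h1 [h2 [hE hg hf]]] := LL_comp h.
exists (h1 \o inl_lin _ _ _), (h2 \o inl_lin _ _ _) => p w q z.
rewrite hE; congr pair.
- have -> : (p, w) = inl_lin V Q P p + Tg V U P Q (tmap V (inl_lin U P Q) w).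
    rewrite TgE tmap_inlK [RHS]surjective_pairing /=.
    by rewrite addr0 add0r.
  by rewrite linearD hg tmap_comp.
- have -> : (q, z) = inl_lin U P Q q + Tg U V Q P (tmap U (inl_lin V Q P) z).
    rewrite TgE tmap_inlK [RHS]surjective_pairing /=.
    by rewrite addr0 add0r.
  by rewrite linearD hf tmap_comp.
Qed.
End InducedMaps.

(** The tensor products with V and U keep the sequences exact, as Tor_1 vanishes. *)
Lemma TL_ses (K1 P1 L1 : lmodType A) (K2 P2 L2 : lmodType B)
    (i1 : {linear K1 -> P1}) (p1 : {linear P1 -> L1})
    (i2 : {linear K2 -> P2}) (p2 : {linear P2 -> L2}) :
  ses i1 p1 -> ses i2 p2 -> ext1z L2 (charL (rmod V)) -> ext1z L1 (charL (rmod U)) ->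
  exists (i : {linear TL K1 K2 -> TL P1 P2}) (p : {linear TL P1 P2 -> TL L1 L2}), ses i p.
Proof.
move=> ip1 ip2 LV LU.
have mapE (P P' : lmodType A) (Q Q' : lmodType B) (a : {linear P -> P'}) (b : {linear Q -> Q'}) :
    exists (h : {linear TL P Q -> TL P' Q'})
      (h1 : {linear (P * tens (rmod V) Q)%type -> (P' * tens (rmod V) Q')%type})
      (h2 : {linear (Q * tens (rmod U) P)%type -> (Q' * tens (rmod U) P')%type}),
    [/\ forall x y, h (x, y) = (h1 x, h2 y),
        forall p w, h1 (p, w) = (a p, tmap V b w) & forall q z, h2 (q, z) = (b q, tmap U a z)].
  have [h hE] := TL_map (Tg U V Q' P') (Tg V U P' Q') (inl_lin V Q' P' \o a) (inl_lin U P' Q' \o b).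
  have [h1 [h2 [h12 _ _]]] := LL_comp h.
  exists h, h1, h2; split=> // [p w|q z].
  - rewrite -[LHS]/((h1 (p, w), h2 0).1) -h12 (hE p w 0 0).
    rewrite -[LHS]/(inl_lin V Q' P' (a p) + Tg V U P' Q' (tmap V (inl_lin U P' Q' \o b) w)).
    by rewrite TgE -tmap_comp tmap_inlK [LHS]surjective_pairing /= addr0 add0r.
  - rewrite -[LHS]/((h1 0, h2 (q, z)).2) -h12 (hE 0 0 q z).
    rewrite -[LHS]/(inl_lin U P' Q' (b q) + Tg U V Q' P' (tmap U (inl_lin V Q' P' \o a) z)).
    by rewrite TgE -tmap_comp tmap_inlK [LHS]surjective_pairing /= addr0 add0r.
have [i [h1 [h2 [iE h1E h2E]]]] := mapE _ _ _ _ i1 i2.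
have [p [k1 [k2 [pE k1E k2E]]]] := mapE _ _ _ _ p1 p2.
exists i, p; apply: ((LL_ses iE pE).2 _).
have sesV := tmap_ses ip2 LV; have sesU := tmap_ses ip1 LU.
by split; [apply: ses_prod2 ip1 sesV _ _|apply: ses_prod2 ip2 sesU _ _].
Qed.

Lemma ZL_TL_ses K J : exists (i : {linear ZL (tens (rmod V) J) (tens (rmod U) K) -> TL K J})
  (p : {linear TL K J -> ZL K J}), ses i p.
Proof.
have t0 (R S : nzRingType) (W : bimod R S) (M N : lmodType S) z :
   tmap W (fst : {linear (M * N)%type -> M}) (tmap W (pinr M N) z) = 0.
  by rewrite tmap_comp tmap0.
have [||i iE] := @LL_mk _ _ _ _ (\0 : {linear tens (rmod U) (tens (rmod V) J) -> tens (rmod U) K})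
  (\0 : {linear tens (rmod V) (tens (rmod U) K) -> tens (rmod V) J}) (Tg U V J K) (Tg V U K J)
  (pinr K _) (pinr J _).
- by move=> z; rewrite TgE t0 linear0.
- by move=> z; rewrite TgE t0 linear0.
have [||p pE] := @LL_mk _ _ _ _ (Tg U V J K) (Tg V U K J)
  (\0 : {linear tens (rmod U) K -> J}) (\0 : {linear tens (rmod V) J -> K}) fst fst.
- by move=> z; rewrite TgE.
- by move=> z; rewrite TgE.
exists i, p; apply: ((LL_ses iE pE).2 _).
by split; apply: ses_pinr.
Qed.

(** Trivial modules on tensor products are induced, as V (x) U (x) K = 0. *)
Lemma ZL_TL_iso K J : isomorphic (ZL (tens (rmod V) J) (tens (rmod U) K))
  (TL (tens (rmod V) J) (tens (rmod U) K)).
Proof.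
have [i [p [_ pS ex]]] := ZL_TL_ses (tens (rmod V) J) (tens (rmod U) K).
apply: iso_sym; apply: (iso_bij (f := p)) => //; apply: lin_inj => x /ex[[w z] <-].
by rewrite (tens_tens0 VU0 w) (tens_tens0 UV0 z) -[(0, 0)]/(0 : ZL _ _) linear0.
Qed.

End LeftModules.

(** * Right modules over the Morita context ring *)

Section RightHalf.
Variables (A B : nzRingType) (V : bimod A B) (U : bimod B A).
Hypothesis VU0 : tens_zero (rmod V) U.

Lemma hom_hom0 (W : lmodType A^c) (h : homr V (homr U W)) : h = 0.
Proof.
apply: homr_ext => v; apply: homr_ext => u.
apply: (@balanced_eq0 _ _ _ _ (fun (v : rmod V) (u : U) => h v u) VU0).
split=> [m m' n|m n n'|r m n].
- exact: (congr1 (fun k : homr U W => k n) (homrD h m m')).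
- exact: (homrD (h m) n n').
- exact: (congr1 (fun k : homr U W => k n) (homrZ h r m)).
Qed.

(** Hom(V, N) and Hom(V, ker(s)) agree, as V (x) U = 0. *)
Lemma hmap_ker_surj (W : lmodType A^c) (N LB : lmodType B^c)
    (s : {linear N -> homr U W}) (q : {linear LB -> N}) :
  injective q -> (forall n, s n = 0 -> exists l, q l = n) -> surj (hmap V q).
Proof.
move=> qI ex h.
have sh v : s (h v) = 0.
  have /(congr1 (fun k : homr V (homr U W) => k v)) := hom_hom0 (hmap V s h).
  by [].
have [k kE] : exists k : {linear rmod V -> LB}, forall v, q (k v) = h v.
  apply: (ses_lift (i := q) (p := cpi q) (h := h : {linear rmod V -> N})).
    exact: ses_cpi.
  by move=> v; apply/cpiP/ex/sh.
by exists (k : homr V LB); apply: homr_ext => v; apply: kE.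
Qed.

Lemma hmap_inj (N N' : lmodType B^c) (q : {linear N -> N'}) :
  injective q -> injective (hmap V q).
Proof. by move=> qI h k e; apply: homr_ext => v; apply: qI; rewrite -!hmapE e. Qed.

Lemma hmap_retract_inj (W : lmodType A^c) (N LB J : lmodType B^c)
    (s : {linear N -> homr U W}) (q : {linear LB -> N}) (b : {linear N -> J})
    (j : {linear LB -> J}) :
  injective q -> (forall n, s n = 0 -> exists l, q l = n) -> injective j ->
  (forall x, b (q x) = j x) -> injective (hmap V b).
Proof.
move=> qI ex jI bq; apply: lin_inj => h hb.
have [k kE] := hmap_ker_surj qI ex h; subst h.
suff -> : k = 0 by rewrite linear0.
apply: (lin_inj0 (hmap_inj jI)); apply: homr_ext => v; rewrite -[LHS]/(j (k v)) -bq.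
exact: (congr1 (fun k : homr V J => k v) hb).
Qed.

Section Coinduced.
Variables (I : lmodType A^c) (J : lmodType B^c).

Definition inlR : {linear J -> (J * homr U I)%type} := pinl J _.

(** The structure map I + Hom(V, J) -> Hom(V, J + Hom(U, I)) of the module
    coinduced from the pair (I, J). *)
Definition Ht : {linear (I * homr V J)%type -> homr V (J * homr U I)%type} :=
  hmap V inlR \o snd.

Lemma Ht_onto h : exists k, forall i, Ht (i, k) = h.
Proof.
exists (hmap V fst h) => i; apply: homr_ext => v.
rewrite -[LHS]/((h v).1, 0) [RHS]surjective_pairing.
congr pair; have := hom_hom0 (hmap V snd h).
by move/(congr1 (fun k : homr V (homr U I) => k v)).
Qed.

Lemma Ht_eq0 z : Ht z = 0 -> z.2 = 0.
Proof.
move=> e; apply: homr_ext => v; have := congr1 (fun k : homr V _ => (k v).1) e.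
by [].
Qed.
End Coinduced.

Section Coresolutions.
Variables (W LA I LA' : lmodType A^c) (N LB J LB' : lmodType B^c).
Variables (s : {linear N -> homr U W}) (t : {linear W -> homr V N}).
Variables (p : {linear LA -> W}) (q : {linear LB -> N}).
Hypotheses (pt : ses p t) (qs : ses q s).

Let qI : injective q. Proof. by case: qs. Qed.
Let qex n : s n = 0 -> exists l, q l = n. Proof. by case: qs => _ _ ex /ex. Qed.

(** The dual horseshoe. On Hom(V, J) the map lifts Hom(V, J) -> Hom(V, N) along t,
    which is possible as Ext^1(Hom(V, J), LA) = 0. *)
Lemma rhalf_cover (i : {linear LA' -> I}) (pi : {linear I -> LA})
    (j : {linear LB' -> J}) (rho : {linear J -> LB}) :
    ses i pi -> ses j rho -> ext1z (R := A^c) (homr V J) LA -> ext1z (rmod V) LB' ->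
  exists psi : {linear (I * homr V J)%type -> W},
    [/\ surj psi, forall x, psi (x, 0) = p (pi x) &
        forall x h, t (psi (x, h)) = hmap V (q \o rho) h].
Proof.
move=> ipi jrho JLA VLB'.
have [e eE] := ext1z_lift (hmap V (q \o rho)) JLA pt.
pose psi : {linear (I * homr V J)%type -> W} := (p \o pi \o fst) \+ (e \o snd).
have psiE x h : psi (x, h) = p (pi x) + e h by [].
have tpsi x h : t (psi (x, h)) = hmap V (q \o rho) h.
  by rewrite psiE linearD (ses0 _ pt) add0r eE.
exists psi; split=> // [w|x]; last by rewrite psiE linear0 addr0.
have [h0 h0E] := hmap_ker_surj qI qex (t w).
have [_ rS _] := hmap_ses jrho VLB'; have [h hE] := rS h0.
have [_ piS _] := ipi; have [_ _ ext] := pt.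
have [|l lE] := (ext (w - e h)).1.
  rewrite linearB eE -h0E -hE; apply/eqP; rewrite subr_eq0; apply/eqP.
  exact: homr_ext.
have [x xl] := piS l; exists (x, h).
by rewrite psiE xl lE subrK.
Qed.

Lemma rhalf_cover_ker (i : {linear LA' -> I}) (pi : {linear I -> LA})
    (W' : lmodType A^c) (N' : lmodType B^c)
    (psi : {linear (I * homr V J)%type -> W})
    (psi2 : {linear (J * homr U I)%type -> N})
    (k1 : {linear W' -> (I * homr V J)%type})
    (k2 : {linear N' -> (J * homr U I)%type})
    (t' : {linear W' -> homr V N'}) :
    ses i pi -> ses k1 psi -> ses k2 psi2 ->
    (forall x, psi (x, 0) = p (pi x)) ->
    (forall z, t (psi z) = hmap V psi2 (Ht I J z)) ->
    (forall w, Ht I J (k1 w) = hmap V k2 (t' w)) ->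
  exists p' : {linear LA' -> W'}, ses p' t'.
Proof.
move=> ipi kpsi kpsi2 psi1 psit kt.
have [iI piS expi] := ipi; have [k1I psiS exk1] := kpsi; have [k2I _ exk2] := kpsi2.
have [pI _ ext] := pt.
have [|p' p'E] := ses_lift (h := pinl I (homr V J) \o i) kpsi.
  by move=> x; rewrite /= psi1 (ses0 _ ipi) linear0.
exists p'; split.
- apply: lin_inj => x e; have := p'E x; rewrite e linear0 => /(congr1 fst)/esym ix.
  exact: (lin_inj0 iI ix).
- move=> h'; have [h hE] := Ht_onto (hmap V k2 h').
  have : t (psi (0, h)) = 0.
    rewrite psit hE; apply: homr_ext => v.
    by rewrite -[LHS]/(psi2 (k2 (h' v))) (ses0 _ kpsi2).
  move/ext => [l lE]; have [x xl] := piS l.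
  have [|w wE] := (exk1 (- x, h)).1.
    have -> : (- x, h) = (0, h) - (x, 0).
      by rewrite [RHS]surjective_pairing /= sub0r subr0.
    by rewrite linearB psi1 xl -lE subrr.
  by exists w; apply: (hmap_inj k2I); rewrite -kt wE hE.
- move=> w; split=> [tw|[x <-]]; last first.
    by apply: (hmap_inj k2I); rewrite -kt p'E linear0; apply: homr_ext.
  have : Ht I J (k1 w) = 0 by rewrite kt tw linear0.
  move/Ht_eq0 => k2w.
  have := ses0 w kpsi; case kw: (k1 w) k2w => [x h] /= ->; rewrite psi1.
  move/(lin_inj0 pI)/expi => [l lx].
  exists l; apply: k1I; rewrite p'E kw /= lx; congr pair.
  by have := k2I; have : Ht I J (k1 w) = 0; [rewrite kt tw linear0|move/Ht_eq0; rewrite kw].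
Qed.

Section Embed.
Variables (i : {linear LA -> I}) (pi : {linear I -> LA'}).
Variables (j : {linear LB -> J}) (rho : {linear J -> LB'}).
Hypotheses (ipi : ses i pi) (jrho : ses j rho).
Hypothesis VLB : ext1z (rmod V) LB.
Variables (a : {linear W -> I}) (b : {linear N -> J}).
Hypotheses (apE : forall x, a (p x) = i x) (bqE : forall y, b (q y) = j y).
Variable phi : {linear W -> (I * homr V J)%type}.
Hypothesis phiE : forall w, phi w = (a w, hmap V b (t w)).

Let jI : injective j. Proof. by case: jrho. Qed.
Let bI : injective (hmap V b). Proof. exact: hmap_retract_inj qI qex jI bqE. Qed.

Lemma rhalf_embed_inj : injective phi.
Proof.
have [_ _ ext] := pt; have [iI _ _] := ipi.
apply: lin_inj => w; rewrite phiE => e.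
have aw : a w = 0 := congr1 fst e.
have tw : hmap V b (t w) = 0 := congr1 snd e.
have [l lw] := (ext w).1 (lin_inj0 bI tw); subst w.
by move: aw; rewrite apE => /(lin_inj0 iI) ->; rewrite linear0.
Qed.

Variables (W' : lmodType A^c) (N' : lmodType B^c).
Variables (c1 : {linear (I * homr V J)%type -> W'}).
Variables (c2 : {linear (J * homr U I)%type -> N'}).
Variable phi2 : {linear N -> (J * homr U I)%type}.
Hypotheses (phic : ses phi c1) (phic2 : ses phi2 c2).
Variables (s' : {linear N' -> homr U W'}) (t' : {linear W' -> homr V N'}).
Hypothesis ct : forall z, t' (c1 z) = hmap V c2 (Ht I J z).

Lemma rhalf_embed_coker : exists p' : {linear LA' -> W'},
  [/\ forall x, p' (pi x) = c1 (x, 0), injective p' & forall l, t' (p' l) = 0].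
Proof.
have [iI piS expi] := ipi; have [_ _ ext] := pt; have [_ _ exc] := phic.
have phip l : phi (p l) = (i l, 0) by rewrite phiE apE (ses0 _ pt) linear0.
have [|p' p'E] := ses_desc (h := c1 \o pinl I (homr V J)) ipi.
  by move=> l; rewrite /= -phip (ses0 _ phic).
exists p'; split=> // [|l].
- apply: lin_inj => l; have [x <-] := piS l; rewrite p'E /= => /exc[w].
  rewrite phiE => e; have aw : a w = x := congr1 fst e.
  have tw : hmap V b (t w) = 0 := congr1 snd e.
  have [l' lw] := (ext w).1 (lin_inj0 bI tw); subst w.
  by rewrite -aw apE (ses0 _ ipi).
- have [x <-] := piS l; rewrite p'E /= ct; apply: homr_ext => v.
  by rewrite -[LHS]/(c2 (0, 0)) linear0.
Qed.

Variables (p' : {linear LA' -> W'}) (q' : {linear LB' -> N'}).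
Hypotheses (p'E : forall x, p' (pi x) = c1 (x, 0)) (q'E : forall y, q' (rho y) = c2 (y, 0)).

Lemma rhalf_embed_exact : injective q' -> forall w, t' w = 0 -> exists l, p' l = w.
Proof.
move=> q'I w'; have [_ c1S _] := phic; have [_ tS _] := pt.
have [[x h] <-] := c1S w'; rewrite ct => e.
have rh : hmap V rho h = 0.
  apply: homr_ext => v; apply: q'I.
  rewrite -[LHS]/(q' (rho (h v))) q'E [RHS]linear0.
  exact: (congr1 (fun k : homr V N' => k v) e).
have [_ _ exV] := hmap_ses jrho VLB; have [h0 h0E] := (exV h).1 rh.
have [w wE] := tS (hmap V q h0).
have -> : c1 (x, h) = c1 (x - a w, 0).
  apply/eqP; rewrite -subr_eq0 -linearB; apply/eqP.
  have -> : (x, h) - (x - a w, 0) = phi w.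
    rewrite phiE wE [LHS]surjective_pairing /= opprB addrC subrK subr0; congr pair.
    by rewrite -h0E; apply: homr_ext => v; exact: (esym (bqE (h0 v))).
  exact: (ses0 _ phic).
by exists (pi (x - a w)).
Qed.

Lemma rhalf_embed_surj : injective q' -> (forall n, s' n = 0 -> exists l, q' l = n) ->
  surj t'.
Proof.
move=> q'I exs' h'; have [h1 <-] := hmap_ker_surj q'I exs' h'.
have [_ rS _] := hmap_ses jrho VLB; have [h <-] := rS h1.
exists (c1 (0, h)); rewrite ct; apply: homr_ext => v.
by rewrite -[LHS]/(c2 (h v, 0)) -q'E.
Qed.
End Embed.
End Coresolutions.

(** By the snake lemma, in which the cokernel of t' vanishes. *)
Lemma rhalf_ker_ses (W W' WE : lmodType A^c) (N N' NE : lmodType B^c)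
    (t : {linear W -> homr V N}) (t' : {linear W' -> homr V N'})
    (tE : {linear WE -> homr V NE})
    (i1 : {linear W' -> WE}) (r1 : {linear WE -> W})
    (i2 : {linear N' -> NE}) (r2 : {linear NE -> N}) :
  ses i1 r1 -> ses i2 r2 -> surj t' ->
  (forall w, tE (i1 w) = hmap V i2 (t' w)) ->
  (forall w, t (r1 w) = hmap V r2 (tE w)) ->
  exists (j : {linear mker t' -> mker tE}) (r : {linear mker tE -> mker t}),
    [/\ ses j r, forall x, kin tE (j x) = i1 (kin t' x) &
        forall x, kin t (r x) = r1 (kin tE x)].
Proof.
move=> ir1 ir2 t'S it rt.
have [i1I r1S ex1] := ir1; have [i2I r2S ex2] := ir2.
have [|j jE] := ker_lift (f := tE) (h := i1 \o kin t').
  by move=> x; rewrite -[LHS]/(tE (i1 (kin t' x))) it kin0 linear0.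
have [|r rE] := ker_lift (f := t) (h := r1 \o kin tE).
  by move=> x; rewrite -[LHS]/(t (r1 (kin tE x))) rt kin0 linear0.
exists j, r; split=> //; split.
- move=> x y e; apply: kin_inj; apply: i1I.
  by rewrite -[LHS]/((i1 \o kin t') x) -jE e jE.
- move=> y; have [w wE] := r1S (kin t y).
  have [h hE] : exists h, hmap V i2 h = tE w.
    have [|k kE] := ses_lift (h := tE w : {linear rmod V -> NE}) ir2.
      move=> v; rewrite -[LHS]/(hmap V r2 (tE w) v) -rt wE kin0; reflexivity.
    by exists (k : homr V N'); apply: homr_ext => v; apply: kE.
  have [w' w'E] := t'S h.
  have [|x xE] := (kinP tE (w - i1 w')).1; first by rewrite linearB it w'E hE subrr.
  exists x; apply: kin_inj; rewrite rE /= -[mker_val x]/(kin tE x) xE linearB wE.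
  by rewrite (ses0 _ ir1) subr0.
- move=> x; split=> [rx|[y <-]]; last first.
    by apply: kin_inj; rewrite rE linear0 -[LHS]/(r1 (kin tE (j y))) jE (ses0 _ ir1).
  have := rE x; rewrite rx linear0 => /esym/ex1[w wE].
  have [|y yE] := (kinP t' w).1.
    by apply: (hmap_inj i2I); rewrite -it wE kin0 linear0.
  by exists y; apply: kin_inj; rewrite jE /= -[mker_val y]/(kin t' y) yE.
Qed.
End RightHalf.

Definition RRm (A B : nzRingType) (V : bimod A B) (U : bimod B A)
    (UV0 : tens_zero (rmod U) V) (VU0 : tens_zero (rmod V) U)
    (W : lmodType A^c) (N : lmodType B^c) (s : {linear N -> homr U W})
    (t : {linear W -> homr V N}) : lmodType (Lambda00 V U)^c :=
  LambdaR UV0 VU0 s t.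

Section RightModules.
Variables (A B : nzRingType) (V : bimod A B) (U : bimod B A).
Variables (UV0 : tens_zero (rmod U) V) (VU0 : tens_zero (rmod V) U).
Local Notation Lc := ((Lambda00 V U)^c).
Local Notation RR s t := (RRm UV0 VU0 s t).

Lemma LmkMc a v u b a' v' u' b' :
  (Lmk a v u b : Lc) * (Lmk a' v' u' b' : Lc) =
  Lmk (a' * a) (a' *: v + bract v' b) (bract u' a + b' *: u) (b' * b) :> Lc.
Proof. by []. Qed.
Lemma LmkDc a v u b a' v' u' b' :
  (Lmk a v u b : Lc) + (Lmk a' v' u' b' : Lc) = Lmk (a + a') (v + v') (u + u') (b + b') :> Lc.
Proof. by []. Qed.
Definition Lcsimp := (LmkMc, LmkDc, mul0r, mulr0, scale0r, scaler0, bract0l, bract0r,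
  addr0, add0r, mul1r, mulr1, scale1r, bract1).

Definition lAc (a : A^c) : Lc := Lmk (a : A) 0 0 0.
Definition lVc (v : V) : Lc := Lmk 0 v 0 0.
Definition lUc (u : U) : Lc := Lmk 0 0 u 0.
Definition lBc (b : B^c) : Lc := Lmk 0 0 0 (b : B).

Fact lAc_D : {morph lAc : x y / x + y}.
Proof. by move=> x y; rewrite /lAc !Lcsimp. Qed.
Fact lAc_M : {morph lAc : x y / x * y}.
Proof. by move=> x y; rewrite /lAc !Lcsimp. Qed.
Fact lBc_D : {morph lBc : x y / x + y}.
Proof. by move=> x y; rewrite /lBc !Lcsimp. Qed.
Fact lBc_M : {morph lBc : x y / x * y}.
Proof. by move=> x y; rewrite /lBc !Lcsimp. Qed.
Definition lAcm := Cornermor lAc_D lAc_M.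
Definition lBcm := Cornermor lBc_D lBc_M.

Fact La_Ac (x : A^c) : La (lAc x) = x. Proof. by []. Qed.
Fact Lv_Ac (x : A^c) : Lv (lAc x) = 0. Proof. by []. Qed.
Fact Lu_Ac (x : A^c) : Lu (lAc x) = 0. Proof. by []. Qed.
Fact Lb_Ac (x : A^c) : Lb (lAc x) = 0. Proof. by []. Qed.
Fact La_Vc (x : V) : La (lVc x) = 0. Proof. by []. Qed.
Fact Lv_Vc (x : V) : Lv (lVc x) = x. Proof. by []. Qed.
Fact Lu_Vc (x : V) : Lu (lVc x) = 0. Proof. by []. Qed.
Fact Lb_Vc (x : V) : Lb (lVc x) = 0. Proof. by []. Qed.
Fact La_Uc (x : U) : La (lUc x) = 0. Proof. by []. Qed.
Fact Lv_Uc (x : U) : Lv (lUc x) = 0. Proof. by []. Qed.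
Fact Lu_Uc (x : U) : Lu (lUc x) = x. Proof. by []. Qed.
Fact Lb_Uc (x : U) : Lb (lUc x) = 0. Proof. by []. Qed.
Fact La_Bc (x : B^c) : La (lBc x) = 0. Proof. by []. Qed.
Fact Lv_Bc (x : B^c) : Lv (lBc x) = 0. Proof. by []. Qed.
Fact Lu_Bc (x : B^c) : Lu (lBc x) = 0. Proof. by []. Qed.
Fact Lb_Bc (x : B^c) : Lb (lBc x) = x. Proof. by []. Qed.
Definition LcE := (La_Ac, Lv_Ac, Lu_Ac, Lb_Ac, La_Vc, Lv_Vc, Lu_Vc, Lb_Vc,
  La_Uc, Lv_Uc, Lu_Uc, Lb_Uc, La_Bc, Lv_Bc, Lu_Bc, Lb_Bc).

Lemma RRZ (W : lmodType A^c) (N : lmodType B^c) (s : {linear N -> homr U W})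
    (t : {linear W -> homr V N}) (l : Lc) w n :
  l *: ((w, n) : RR s t) =
  ((La l : A^c) *: w + s n (Lu l), t w (Lv l) + (Lb l : B^c) *: n).
Proof. by []. Qed.
Lemma RRD (W : lmodType A^c) (N : lmodType B^c) (s : {linear N -> homr U W})
    (t : {linear W -> homr V N}) w n w' n' :
  ((w, n) : RR s t) + ((w', n') : RR s t) = (w + w', n + n').
Proof. by []. Qed.

Lemma quadR (M : lmodType Lc) : exists (W : lmodType A^c) (N : lmodType B^c)
  (s : {linear N -> homr U W}) (t : {linear W -> homr V N}), isomorphic M (RR s t).
Proof.
pose W := cornermod lAcm M; pose N := cornermod lBcm M.
have uP (n : N) (u : U) : lAc 1 *: (lUc u *: cval n) = lUc u *: cval n.
  by rewrite scalerA /lAc /lUc !Lcsimp.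
have vP (w : W) (v : V) : lBc 1 *: (lVc v *: cval w) = lVc v *: cval w.
  by rewrite scalerA /lBc /lVc !Lcsimp.
have suL n : linear (fun u : rmod U => incorner (rho := lAcm) (uP n u) : W).
  move=> a u u'; apply: cval_inj; rewrite [RHS]/= scalerA -scalerDl; congr (_ *: _).
  by rewrite /= /lUc /lAc !Lcsimp.
have tvL w : linear (fun v : rmod V => incorner (rho := lBcm) (vP w v) : N).
  move=> a u u'; apply: cval_inj; rewrite [RHS]/= scalerA -scalerDl; congr (_ *: _).
  by rewrite /= /lVc /lBc !Lcsimp.
have sL : linear (fun n : N => (mklin (suL n) : {linear rmod U -> W}) : homr U W).
  move=> b n n'; apply: homr_ext => u; apply: cval_inj.
  rewrite -[LHS]/(lUc u *: (lBc b *: cval n + cval n')) scalerDr scalerA.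
  rewrite -[RHS]/(lUc ((b : B) *: u) *: cval n + lUc u *: cval n').
  by congr (_ *: _ + _); rewrite /lUc /lBc !Lcsimp.
have tL : linear (fun n : W => (mklin (tvL n) : {linear rmod V -> N}) : homr V N).
  move=> b n n'; apply: homr_ext => u; apply: cval_inj.
  rewrite -[LHS]/(lVc u *: (lAc b *: cval n + cval n')) scalerDr scalerA.
  rewrite -[RHS]/(lVc ((b : A) *: u) *: cval n + lVc u *: cval n').
  by congr (_ *: _ + _); rewrite /lVc /lAc !Lcsimp.
have pA (n : M) : lAc 1 *: (lAc 1 *: n) = lAc 1 *: n.
  by rewrite scalerA /lAc !Lcsimp.
have pB (n : M) : lBc 1 *: (lBc 1 *: n) = lBc 1 *: n.
  by rewrite scalerA /lBc !Lcsimp.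
pose h (n : M) : RR (mklin sL) (mklin tL) :=
  (incorner (rho := lAcm) (pA n), incorner (rho := lBcm) (pB n)).
exists W, N, (mklin sL), (mklin tL).
have hL : linear h.
  move=> l n n'; rewrite /h [X in _ = X + _]RRZ RRD.
  congr pair; apply: cval_inj.
  - rewrite -[LHS]/(lAc 1 *: (l *: n + n')) scalerDr.
    rewrite -[RHS]/(lAc (La l) *: (lAc 1 *: n) + lUc (Lu l) *: (lBc 1 *: n) + lAc 1 *: n').
    rewrite !scalerA -scalerDl; congr (_ *: n + _).
    case: l => [[a v] [u b]]; rewrite /lAc /lUc /lBc /La /Lu /=.
    by rewrite [l in _ * l = _](_ : _ = Lmk a v u b) // !Lcsimp.
  - rewrite -[LHS]/(lBc 1 *: (l *: n + n')) scalerDr.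
    rewrite -[RHS]/(lVc (Lv l) *: (lAc 1 *: n) + lBc (Lb l) *: (lBc 1 *: n) + lBc 1 *: n').
    rewrite !scalerA -scalerDl; congr (_ *: n + _).
    case: l => [[a v] [u b]]; rewrite /lAc /lVc /lBc /Lb /Lv /=.
    by rewrite [l in _ * l = _](_ : _ = Lmk a v u b) // !Lcsimp.
have L1c : (1 : Lc) = lAc 1 + lBc 1 by rewrite /lAc /lBc !Lcsimp.
apply: (iso_bij (f := mklin hL)) => [n n' [e1 e2]|[x y]].
  by rewrite -[n]scale1r -[n']scale1r L1c !scalerDl e1 e2.
have ex : lAc 1 *: cval x = cval x := cval1 x.
have ey : lBc 1 *: cval y = cval y := cval1 y.
have AB0 : lAc 1 * lBc 1 = 0 by rewrite /lAc /lBc !Lcsimp.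
have BA0 : lBc 1 * lAc 1 = 0 by rewrite /lAc /lBc !Lcsimp.
exists (cval x + cval y); rewrite /= /h; congr pair; apply: cval_inj => /=.
- by rewrite scalerDr ex -ey scalerA AB0 scale0r addr0.
- by rewrite scalerDr ey -ex scalerA BA0 scale0r add0r.
Qed.

Lemma homrU0 (R S : nzRingType) (M : bimod R S) (W : lmodType S^c)
  (h : {linear rmod M -> W}) : h (0 : M) = 0.
Proof. exact: linear0. Qed.

Lemma homr_lin0 (R S : nzRingType) (M : bimod R S) (W : lmodType S^c)
  (X : lmodType R^c) (h : {linear X -> homr M W}) (v : M) : h 0 v = 0.
Proof. by rewrite linear0. Qed.

Section Maps.
Variables (W W' : lmodType A^c) (N N' : lmodType B^c).
Variables (s : {linear N -> homr U W}) (t : {linear W -> homr V N}).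
Variables (s' : {linear N' -> homr U W'}) (t' : {linear W' -> homr V N'}).

Lemma RR_mk (h1 : {linear W -> W'}) (h2 : {linear N -> N'}) :
  (forall w, t' (h1 w) = hmap V h2 (t w)) -> (forall n, s' (h2 n) = hmap U h1 (s n)) ->
  exists h : {linear RR s t -> RR s' t'}, forall w n, h (w, n) = (h1 w, h2 n).
Proof.
move=> ht hs.
have hL : linear ((fun m => (h1 m.1, h2 m.2)) : RR s t -> RR s' t').
  move=> l [w n] [w' n']; rewrite RRZ [(l *: _)%R]RRZ !RRD /=.
  by rewrite ht hs !linearD !linearZ.
by exists (mklin hL).
Qed.

Lemma RR_comp (h : {linear RR s t -> RR s' t'}) :
  exists (h1 : {linear W -> W'}) (h2 : {linear N -> N'}),
  [/\ forall w n, h (w, n) = (h1 w, h2 n),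
      forall w, t' (h1 w) = hmap V h2 (t w) & forall n, s' (h2 n) = hmap U h1 (s n)].
Proof.
have keyA (m : RR s' t') : lAc 1 *: m = (m.1, 0).
  by case: m => a b; rewrite RRZ !LcE !homrU0 !Lcsimp.
have keyB (m : RR s' t') : lBc 1 *: m = (0, m.2).
  by case: m => a b; rewrite RRZ !LcE !homrU0 !Lcsimp.
have e1 w : h (w, 0) = ((h (w, 0)).1, 0).
  have e : (w, 0) = lAc 1 *: ((w, 0) : RR s t).
    by rewrite RRZ !LcE !homrU0 !Lcsimp.
  by rewrite {1}e linearZ_LR keyA.
have e2 n : h (0, n) = (0, (h (0, n)).2).
  have e : (0, n) = lBc 1 *: ((0, n) : RR s t).
    by rewrite RRZ !LcE !homrU0 !Lcsimp.
  by rewrite {1}e linearZ_LR keyB.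
have h1L : linear (fun w => (h (w, 0)).1).
  move=> a w w'.
  have -> : (a *: w + w', 0) = lAc a *: ((w, 0) : RR s t) + ((w', 0) : RR s t).
    by rewrite RRZ RRD !LcE !homrU0 !Lcsimp.
  rewrite linearP e1 (e1 w') [lAc a *: _]RRZ RRD !LcE.
  by rewrite !homrU0 !Lcsimp.
have h2L : linear (fun n => (h (0, n)).2).
  move=> a w w'.
  have -> : (0, a *: w + w') = lBc a *: ((0, w) : RR s t) + ((0, w') : RR s t).
    by rewrite RRZ RRD !LcE !homrU0 !Lcsimp.
  rewrite linearP e2 (e2 w') [lBc a *: _]RRZ RRD !LcE.
  by rewrite !homrU0 !Lcsimp.
exists (mklin h1L), (mklin h2L); split=> [w n|w|n].
- have -> : (w, n) = ((w, 0) : RR s t) + ((0, n) : RR s t) by rewrite RRD !Lcsimp.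
  by rewrite linearD e1 e2 RRD !Lcsimp.
- apply: homr_ext => v; rewrite -[RHS]/(h (0, t w v)).2.
  have -> : (0, t w v) = lVc v *: ((w, 0) : RR s t).
    by rewrite RRZ !LcE !homr_lin0 ?linear0 !Lcsimp.
  by rewrite linearZ_LR e1 RRZ !LcE !Lcsimp.
- apply: homr_ext => u; rewrite -[RHS]/(h (s n u, 0)).1.
  have -> : (s n u, 0) = lUc u *: ((0, n) : RR s t).
    by rewrite RRZ !LcE !homr_lin0 ?linear0 !Lcsimp.
  by rewrite linearZ_LR e2 RRZ !LcE !Lcsimp.
Qed.
End Maps.

Section Sequences.
Variables (X1 X2 X3 : lmodType A^c) (Y1 Y2 Y3 : lmodType B^c).
Variables (s1 : {linear Y1 -> homr U X1}) (t1 : {linear X1 -> homr V Y1}).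
Variables (s2 : {linear Y2 -> homr U X2}) (t2 : {linear X2 -> homr V Y2}).
Variables (s3 : {linear Y3 -> homr U X3}) (t3 : {linear X3 -> homr V Y3}).
Variables (h : {linear RR s1 t1 -> RR s2 t2}) (k : {linear RR s2 t2 -> RR s3 t3}).
Variables (h1 : {linear X1 -> X2}) (h2 : {linear Y1 -> Y2}).
Variables (k1 : {linear X2 -> X3}) (k2 : {linear Y2 -> Y3}).
Hypotheses (hE : forall x y, h (x, y) = (h1 x, h2 y)).
Hypotheses (kE : forall x y, k (x, y) = (k1 x, k2 y)).

Lemma RR_ses : ses h k <-> ses h1 k1 /\ ses h2 k2.
Proof. exact: (pair_exact 0 0 0 0 hE kE). Qed.
End Sequences.

End RightModules.

(** ** Trivial and coinduced right modules *)

Section Coinduction.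
Variables (A B : nzRingType) (V : bimod A B) (U : bimod B A).
Variables (UV0 : tens_zero (rmod U) V) (VU0 : tens_zero (rmod V) U).
Local Notation Lc := ((Lambda00 V U)^c).
Local Notation RR s t := (RRm UV0 VU0 s t).

Definition ZR (K : lmodType A^c) (J : lmodType B^c) : lmodType Lc :=
  RR (\0 : {linear J -> homr U K}) (\0 : {linear K -> homr V J}).

Definition HR (I : lmodType A^c) (J : lmodType B^c) : lmodType Lc :=
  RR (Ht U V J I) (Ht V U I J).

Section CoinducedMaps.
Variables (W I : lmodType A^c) (N J : lmodType B^c).
Variables (s : {linear N -> homr U W}) (t : {linear W -> homr V N}).

Lemma hmap_s0 w : hmap V s (t w) = 0. Proof. exact: (hom_hom0 VU0). Qed.
Lemma hmap_t0 n : hmap U t (s n) = 0. Proof. exact: (hom_hom0 UV0). Qed.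

Lemma HR_map (a : {linear W -> I}) (b : {linear N -> J}) :
  exists h : {linear RR s t -> HR I J}, forall w n,
    h (w, n) = ((a w, hmap V b (t w)), (b n, hmap U a (s n))).
Proof.
have h1L : linear (fun w => (a w, hmap V b (t w)) : (I * homr V J)%type).
  by move=> r x y; rewrite [RHS]surjective_pairing !linearP.
have h2L : linear (fun n => (b n, hmap U a (s n)) : (J * homr U I)%type).
  by move=> r x y; rewrite [RHS]surjective_pairing !linearP.
have [||h hE] := @RR_mk _ _ _ _ UV0 VU0 _ _ _ _ s t (Ht U V J I) (Ht V U I J) (mklin h1L) (mklin h2L).
- move=> w; apply: homr_ext => v.
  rewrite -[RHS]/(b (t w v), hmap U a (s (t w v))).
  have -> : s (t w v) = 0 by exact: (congr1 (fun k : homr V (homr U W) => k v) (hmap_s0 w)).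
  by rewrite linear0.
- move=> n; apply: homr_ext => u.
  rewrite -[RHS]/(a (s n u), hmap V b (t (s n u))).
  have -> : t (s n u) = 0 by exact: (congr1 (fun k : homr U (homr V N) => k u) (hmap_t0 n)).
  by rewrite linear0.
by exists h => w n; rewrite hE.
Qed.

Lemma HR_hom (h : {linear RR s t -> HR I J}) :
  exists (a : {linear W -> I}) (b : {linear N -> J}), forall w n,
    h (w, n) = ((a w, hmap V b (t w)), (b n, hmap U a (s n))).
Proof.
have [h1 [h2 [hE ht hs]]] := RR_comp h.
exists (fst \o h1), (fst \o h2) => w n; rewrite hE.
rewrite [h1 w]surjective_pairing [h2 n]surjective_pairing; congr ((_, _), (_, _)).
- apply: homr_ext => v.
  exact: (congr1 (fun k : homr V (J * homr U I)%type => (k v).1) (ht w)).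
- apply: homr_ext => u.
  exact: (congr1 (fun k : homr U (I * homr V J)%type => (k u).1) (hs n)).
Qed.
End CoinducedMaps.

Lemma HR_ses (K1 P1 L1 : lmodType A^c) (K2 P2 L2 : lmodType B^c)
    (i1 : {linear K1 -> P1}) (p1 : {linear P1 -> L1})
    (i2 : {linear K2 -> P2}) (p2 : {linear P2 -> L2}) :
  ses i1 p1 -> ses i2 p2 -> ext1z (rmod V) K2 -> ext1z (rmod U) K1 ->
  exists (i : {linear HR K1 K2 -> HR P1 P2}) (p : {linear HR P1 P2 -> HR L1 L2}), ses i p.
Proof.
move=> ip1 ip2 VK UK.
have mapE (P P' : lmodType A^c) (Q Q' : lmodType B^c) (a : {linear P -> P'}) (b : {linear Q -> Q'}) :
    exists (h : {linear HR P Q -> HR P' Q'})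
      (h1 : {linear (P * homr V Q)%type -> (P' * homr V Q')%type})
      (h2 : {linear (Q * homr U P)%type -> (Q' * homr U P')%type}),
    [/\ forall x y, h (x, y) = (h1 x, h2 y),
        forall p w, h1 (p, w) = (a p, hmap V b w) & forall q z, h2 (q, z) = (b q, hmap U a z)].
  have [h hE] := HR_map (Ht U V Q P) (Ht V U P Q) (a \o fst) (b \o fst).
  have [h1 [h2 [h12 _ _]]] := RR_comp h.
  exists h, h1, h2; split=> // [p w|q z].
  - rewrite -[LHS]/((h1 (p, w), h2 0).1) -h12 hE -[LHS]/(a p, hmap V (b \o fst) (Ht V U P Q (p, w))).
    by congr pair; apply: homr_ext.
  - rewrite -[LHS]/((h1 0, h2 (q, z)).2) -h12 hE -[LHS]/(b q, hmap U (a \o fst) (Ht U V Q P (q, z))).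
    by congr pair; apply: homr_ext.
have [i [h1 [h2 [iE h1E h2E]]]] := mapE _ _ _ _ i1 i2.
have [p [k1 [k2 [pE k1E k2E]]]] := mapE _ _ _ _ p1 p2.
exists i, p; apply/(RR_ses iE pE).
have sesV := hmap_ses ip2 VK; have sesU := hmap_ses ip1 UK.
by split; [apply: ses_prod2 ip1 sesV _ _|apply: ses_prod2 ip2 sesU _ _].
Qed.

Lemma ZR_HR_ses K J : exists (i : {linear ZR K J -> HR K J})
  (p : {linear HR K J -> ZR (homr V J) (homr U K)}), ses i p.
Proof.
have [||i iE] := @RR_mk _ _ _ _ UV0 VU0 _ _ _ _ (\0 : {linear J -> homr U K}) (\0 : {linear K -> homr V J})
  (Ht U V J K) (Ht V U K J) (pinl K (homr V J)) (pinl J (homr U K)).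
- by move=> w; apply: homr_ext => v.
- by move=> w; apply: homr_ext => v.
have [||p pE] := @RR_mk _ _ _ _ UV0 VU0 _ _ _ _ (Ht U V J K) (Ht V U K J)
  (\0 : {linear homr U K -> homr U (homr V J)}) (\0 : {linear homr V J -> homr V (homr U K)})
  snd snd.
- by move=> w; apply: homr_ext => v.
- by move=> w; apply: homr_ext => v.
exists i, p; apply/(RR_ses iE pE).
by split; apply: ses_pinl.
Qed.

Lemma ZR_HR_iso K J : isomorphic (ZR (homr V J) (homr U K)) (HR (homr V J) (homr U K)).
Proof.
have [i [p [iI _ ex]]] := ZR_HR_ses (homr V J) (homr U K).
apply: (iso_bij (f := i)) => // x; apply/ex; case: (p x) => w n.
by rewrite (hom_hom0 VU0 w) (hom_hom0 UV0 n).
Qed.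

End Coinduction.

(** * Orthogonality and flatness over the Morita context ring *)

Lemma projective_of_ext (R : nzRingType) (P : lmodType R) :
  (forall K, ext1z P K) -> projective P.
Proof. by move=> PK M N p h pS; apply: ext1z_lift (PK _) (ses_kin pS). Qed.

(** Symmetry of Tor_1(G, N), read through characters. *)
Lemma ext1z_swap (R : nzRingType) (G : lmodType R^c) (N : lmodType R) :
  ext1z G (charR N) -> ext1z N (charL G).
Proof.
move=> GN; have [G' [Q [i [p [QP ip]]]]] := enough_projectives G.
apply: (ext1z_copres (chrmap_ses (amL R) ip)) => [|h]; first exact: charL_projective.
have [h' h'E] := chr_swap (fun x => erefl : amL R (amR R x) = x) h.
have [k kE] := GN _ _ _ _ ip h'.
have [k' k'E] := chr_swap (fun x => erefl : amR R (amL R x) = x) k.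
exists k' => n; apply: chr_ext => g.
by rewrite [LHS](k'E (i g) n) kE h'E.
Qed.

Lemma flat_ext (R : nzRingType) (F : lmodType R) G : flat F -> ext1z F (charL G).
Proof. by move=> /flatP FI; apply/ext1z_swap/ext1z_inj. Qed.

Lemma flat_of_ext (R : nzRingType) (F : lmodType R) :
  (forall G, ext1z F (charL G)) -> flat F.
Proof.
move=> FG; apply/flatP => M N i h iI.
have [h' h'E] := chr_swap (fun x => erefl : amR R (amL R x) = x) h.
have [k kE] := ext1z_lift h' (FG _) (chrmap_ses (amL R) (ses_cpi iI)).
have [k' k'E] := chr_swap (fun x => erefl : amL R (amR R x) = x) k.
exists k' => x; apply: chr_ext => y.
by rewrite [LHS](k'E y (i x)) -h'E -kE.
Qed.

Section LeftLambda.
Variables (A B : nzRingType) (V : bimod A B) (U : bimod B A).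
Variables (UV0 : tens_zero (rmod U) V) (VU0 : tens_zero (rmod V) U).
Local Notation L := (Lambda00 V U).
Local Notation LL f g := (LLm UV0 VU0 f g).

Lemma quadL_ses (M1 M2 M3 : lmodType L) (i : {linear M1 -> M2}) (p : {linear M2 -> M3})
    (X1 X2 X3 : lmodType A) (Y1 Y2 Y3 : lmodType B)
    (f1 : {linear tens (rmod U) X1 -> Y1}) (g1 : {linear tens (rmod V) Y1 -> X1})
    (f2 : {linear tens (rmod U) X2 -> Y2}) (g2 : {linear tens (rmod V) Y2 -> X2})
    (f3 : {linear tens (rmod U) X3 -> Y3}) (g3 : {linear tens (rmod V) Y3 -> X3}) :
  isomorphic M1 (LL f1 g1) -> isomorphic M2 (LL f2 g2) -> isomorphic M3 (LL f3 g3) ->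
  ses i p ->
  exists (i1 : {linear X1 -> X2}) (i2 : {linear Y1 -> Y2})
    (p1 : {linear X2 -> X3}) (p2 : {linear Y2 -> Y3}),
  [/\ ses i1 p1 /\ ses i2 p2,
      forall z, i1 (g1 z) = g2 (tmap V i2 z), forall z, i2 (f1 z) = f2 (tmap U i1 z),
      forall z, p1 (g2 z) = g3 (tmap V p2 z) & forall z, p2 (f2 z) = f3 (tmap U p1 z)].
Proof.
move=> iso1 iso2 iso3 ip.
have [i' ip'] := ses_iso_sub (iso_sym iso1) ip.
have [p' ip''] := ses_iso_quo iso3 ip'.
have [i'' [p'' s'']] := ses_iso_mid iso2 ip''.
have [i1 [i2 [iE ig if']]] := LL_comp i''; have [p1 [p2 [pE pg pf]]] := LL_comp p''.
by exists i1, i2, p1, p2; split=> //; apply/(LL_ses iE pE).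
Qed.

Lemma ZL_ses (K1 K2 K3 : lmodType A) (J1 J2 J3 : lmodType B)
    (i : {linear K1 -> K2}) (p : {linear K2 -> K3}) (j : {linear J1 -> J2})
    (q : {linear J2 -> J3}) : ses i p -> ses j q ->
  exists (a : {linear ZL UV0 VU0 K1 J1 -> ZL UV0 VU0 K2 J2})
    (b : {linear ZL UV0 VU0 K2 J2 -> ZL UV0 VU0 K3 J3}),
    ses a b /\ forall x y, b (x, y) = (p x, q y).
Proof.
move=> ip jq.
have zmap (K K' : lmodType A) (J J' : lmodType B) (h : {linear K -> K'}) (k : {linear J -> J'}) :
    exists l : {linear ZL UV0 VU0 K J -> ZL UV0 VU0 K' J'}, forall x y, l (x, y) = (h x, k y).
  by apply: LL_mk => z; rewrite linear0.
have [a aE] := zmap _ _ _ _ i j; have [b bE] := zmap _ _ _ _ p q.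
by exists a, b; split=> //; apply/(LL_ses aE bE).
Qed.

Section Ext.
Variables (X : lmodType A) (Y : lmodType B).
Variables (f : {linear tens (rmod U) X -> Y}) (g : {linear tens (rmod V) Y -> X}).

Lemma TL_ext (P : lmodType A) (Q : lmodType B) :
  ext1z P X -> ext1z Q Y -> ext1z (TL UV0 VU0 P Q) (LL f g).
Proof.
move=> PX QY; have [C [I [i [p [II ip]]]]] := enough_injectives (LL f g).
have [XI [YI [fI [gI isoI]]]] := quadL UV0 VU0 I.
have [XC [YC [fC [gC isoC]]]] := quadL UV0 VU0 C.
have [p' ip'] := ses_iso_quo isoC ip; have [i2 [p2 ip2]] := ses_iso_mid isoI ip'.
have II' : injmod (LL fI gI) := injmod_retract (iso_retract (iso_sym isoI)) II.
have [k1 [k2 [pE pg pf]]] := LL_comp p2; have [j1 [j2 [iE ig if']]] := LL_comp i2.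
have [s1 s2] := (LL_ses iE pE).1 ip2.
apply: (ext1z_copres ip2 II') => h.
have [a [b hE]] := TL_hom h.
have [a' a'E] := ext1z_lift a PX s1; have [b' b'E] := ext1z_lift b QY s2.
have [k kE] := TL_map UV0 VU0 fI gI a' b'.
exists k => -[[x w] [q z]].
rewrite kE pE hE !linearD pg pf !tmap_comp a'E b'E.
by rewrite (eq_tmap (h := k1 \o a') (k := a) a'E) (eq_tmap (h := k2 \o b') (k := b) b'E).
Qed.

Lemma ZL_ext (LA K : lmodType A) (LB J : lmodType B) (p : {linear X -> LA})
    (q : {linear Y -> LB}) : ses g p -> ses f q -> ext1z LA K -> ext1z LB J ->
  ext1z (LL f g) (ZL UV0 VU0 K J).
Proof.
move=> gp fq LAK LBJ; have [N' [P [i [r [PP ir]]]]] := enough_projectives (LL f g).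
have [XP [YP [fP [gP isoP]]]] := quadL UV0 VU0 P.
have [X1 [Y1 [f1 [g1 iso1]]]] := quadL UV0 VU0 N'.
have [i' ir'] := ses_iso_sub (iso_sym iso1) ir; have [i2 [r2 ir2]] := ses_iso_mid isoP ir'.
have PP' : projective (LL fP gP) := proj_iso isoP PP.
have [i1' [i2' [iE ig if']]] := LL_comp i2; have [r1' [r2' [rE rg rf]]] := LL_comp r2.
have [s1 s2] := (LL_ses iE rE).1 ir2.
apply: (ext1z_pres ir2 PP') => h; have [h1 [h2 [hE hg hf]]] := LL_comp h.
have ext (A' B' : nzRingType) (V' : bimod A' B') (X' X1' XP' LA' K' : lmodType A')
    (Y' Y1' YP' : lmodType B')
    (g' : {linear tens (rmod V') Y' -> X'}) (g1' : {linear tens (rmod V') Y1' -> X1'})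
    (gP' : {linear tens (rmod V') YP' -> XP'}) (p' : {linear X' -> LA'})
    (a1 : {linear X1' -> XP'}) (b1 : {linear XP' -> X'})
    (a2 : {linear Y1' -> YP'}) (b2 : {linear YP' -> Y'}) (k : {linear X1' -> K'}) :
    ses g' p' -> ses a1 b1 -> ses a2 b2 ->
    (forall z, a1 (g1' z) = gP' (tmap V' a2 z)) ->
    (forall z, b1 (gP' z) = g' (tmap V' b2 z)) ->
    (forall z, k (g1' z) = 0) -> ext1z LA' K' ->
    exists k' : {linear XP' -> K'}, (forall x, k' (a1 x) = k x) /\ forall z, k' (gP' z) = 0.
  move=> gp' ab1 ab2 ag bg kg LK; have [g'I p'S ex] := gp'.
  have [c [d [cd cE dE]]] := half_coker_ses ab1 ab2 g'I ag bg.
  have [m mE] := coker_desc kg.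
  have CK : ext1z (mcoker g') K'.
    have [u uE] := ses_desc (h := cpi g') gp' (fun y => (cpiP g' (g' y)).2 (ex_intro _ y erefl)).
    apply: (ext1z_retractl _ LK); apply: iso_retract; apply: iso_sym.
    apply: (iso_bij (f := u)) => [|y]; last first.
      by have [x <-] := cpi_surj y; exists (p' x).
    apply: lin_inj => l; have [x <-] := p'S l; rewrite uE => /cpiP[z <-].
    exact: (ses0 _ gp').
  have [m' m'E] := CK _ _ _ _ cd m.
  exists (m' \o cpi gP'); split=> [x|z] /=.
    by rewrite -[LHS]/(m' (cpi gP' (a1 x))) -cE m'E mE.
  by rewrite -[LHS]/(m' (cpi gP' (gP' z))) (cpiP gP' _).2 ?linear0 //; exists z.
have [k1 [k1E k1g]] := ext _ _ V _ _ _ _ _ _ _ _ _ _ _ _ _ _ _ _ h1 gp s1 s2 ig rg hg LAK.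
have [k2 [k2E k2g]] := ext _ _ U _ _ _ _ _ _ _ _ _ _ _ _ _ _ _ _ h2 fq s2 s1 if' rf hf LBJ.
have [||k kE] := @LL_mk _ _ _ _ UV0 VU0 _ _ _ _ fP gP
  (\0 : {linear tens (rmod U) K -> J}) (\0 : {linear tens (rmod V) J -> K}) k1 k2.
- exact: k1g.
- exact: k2g.
by exists k => -[x y]; rewrite iE kE hE k1E k2E.
Qed.

(** Maps from (X, Y, f, g) to a module with zero structure maps are the pairs of
    maps from the cokernels. *)
Lemma ZL_ext_coker (K : lmodType A) (J : lmodType B) :
  ext1z (LL f g) (ZL UV0 VU0 K J) -> ext1z (mcoker g) K /\ ext1z (mcoker f) J.
Proof.
move=> KJ; have [KC [KI [i [p [KII ip]]]]] := enough_injectives K.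
have [JC [JI [j [q [JII jq]]]]] := enough_injectives J.
have [a [b [ab bE]]] := ZL_ses ip jq.
have lift (h : {linear mcoker g -> KC}) (k : {linear mcoker f -> JC}) :
    exists (h' : {linear mcoker g -> KI}) (k' : {linear mcoker f -> JI}),
    (forall x, p (h' x) = h x) /\ (forall y, q (k' y) = k y).
  have [||l lE] := @LL_mk _ _ _ _ UV0 VU0 _ _ _ _ f g (\0 : {linear tens (rmod U) KC -> JC})
    (\0 : {linear tens (rmod V) JC -> KC}) (h \o cpi g) (k \o cpi f).
  - move=> z; rewrite -[LHS]/(h (cpi g (g z))) (cpiP g (g z)).2 ?linear0 //; by exists z.
  - move=> z; rewrite -[LHS]/(k (cpi f (f z))) (cpiP f (f z)).2 ?linear0 //; by exists z.
  have [l' l'E] := ext1z_lift l KJ ab.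
  have [l1 [l2 [l12 lg lf]]] := LL_comp l'.
  have [h' h'E] := coker_desc lg; have [k' k'E] := coker_desc lf.
  exists h', k'; split=> z; have [x <-] := cpi_surj z.
  - have := l'E (x, 0); rewrite l12 bE lE => /(congr1 fst) e.
    by rewrite h'E; exact: e.
  - have := l'E (0, x); rewrite l12 bE lE => /(congr1 snd) e.
    by rewrite k'E; exact: e.
split.
- by apply: (ext1z_copres ip KII) => h; have [h' [_ [h'E _]]] := lift h \0; exists h'.
- by apply: (ext1z_copres jq JII) => k; have [_ [k' [_ k'E]]] := lift \0 k; exists k'.
Qed.
End Ext.

Lemma TL_projective P Q : projective P -> projective Q -> projective (TL UV0 VU0 P Q).
Proof.
move=> PP QP; apply: projective_of_ext => K.
have [X [Y [f [g isoK]]]] := quadL UV0 VU0 K.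
apply: ext1z_retractr (iso_retract isoK) _.
by apply: TL_ext; apply: ext1z_proj.
Qed.

(** Characters of a right module are taken componentwise. *)
Lemma charL_RR (W : lmodType A^c) (N : lmodType B^c) (s : {linear N -> homr U W})
    (t : {linear W -> homr V N}) :
  exists (f : {linear tens (rmod U) (charL W) -> charL N})
    (g : {linear tens (rmod V) (charL N) -> charL W}),
  isomorphic (charL (RRm UV0 VU0 s t)) (LL f g).
Proof.
have suD u (c : charL W) : {morph (fun n => c (s n u)) : x y / x + y}.
  by move=> x y; rewrite linearD -chrD.
have tvD v (c : charL N) : {morph (fun w => c (t w v)) : x y / x + y}.
  by move=> x y; rewrite linearD -chrD.
have [||f fE] := @tens_univ _ _ U (charL W) (charL N) (fun u c => Chr (suD u c)).
- split=> [u u' c|u c c'|a u c]; apply: chr_ext => n //=.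
    by rewrite -chrD; congr (c _); exact: (homrD (s n) u u').
  by congr (c _); exact: (homrZ (s n) a u).
- by move=> b u c; apply: chr_ext => n /=; rewrite linearZ.
have [||g gE] := @tens_univ _ _ V (charL N) (charL W) (fun v c => Chr (tvD v c)).
- split=> [u u' c|u c c'|a u c]; apply: chr_ext => n //=.
    by rewrite -chrD; congr (c _); exact: (homrD (t n) u u').
  by congr (c _); exact: (homrZ (t n) a u).
- by move=> b u c; apply: chr_ext => n /=; rewrite linearZ.
exists f, g.
have inW (c : charL (RRm UV0 VU0 s t)) : {morph (fun w => c (w, 0)) : x y / x + y}.
  by move=> x y; rewrite -chrD RRD addr0.
have inN (c : charL (RRm UV0 VU0 s t)) : {morph (fun n => c (0, n)) : x y / x + y}.
  by move=> x y; rewrite -chrD RRD addr0.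
pose h (c : charL (RRm UV0 VU0 s t)) : LL f g :=
  (Chr (inW c) : charL W, Chr (inN c) : charL N).
have hL : linear h.
  move=> l c c'; rewrite /h [X in _ = X + _]LLZ LLD fE gE.
  congr pair; apply: chr_ext => w.
  - rewrite -[LHS]/(c ((l : L^c) *: ((w, 0) : RRm UV0 VU0 s t)) + c' (w, 0)).
    rewrite -[RHS]/(c ((La l : A^c) *: w, 0) + c (0, t w (Lv l)) + c' (w, 0)).
    congr (_ + _); rewrite RRZ homr_lin0 scaler0 !addr0 -chrD RRD.
    by rewrite addr0 add0r.
  - rewrite -[LHS]/(c ((l : L^c) *: ((0, w) : RRm UV0 VU0 s t)) + c' (0, w)).
    rewrite -[RHS]/(c (s w (Lu l), 0) + c (0, (Lb l : B^c) *: w) + c' (0, w)).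
    congr (_ + _); rewrite RRZ homr_lin0 scaler0 !add0r -chrD RRD.
    by rewrite addr0 add0r.
apply: (iso_bij (f := mklin hL)) => [c c' e|[c d]].
  apply: chr_ext => -[w n].
  have -> : (w, n) = ((w, 0) : RRm UV0 VU0 s t) + ((0, n) : RRm UV0 VU0 s t).
    by rewrite RRD addr0 add0r.
  rewrite !chrD; congr (_ + _).
  - exact: (congr1 (fun x : LL f g => (x.1 : charL W) w) e).
  - exact: (congr1 (fun x : LL f g => (x.2 : charL N) n) e).
have cdD : {morph (fun m : RRm UV0 VU0 s t => c m.1 + d m.2) : x y / x + y}.
  by move=> [x y] [x' y']; rewrite RRD /= !chrD addrACA.
exists (Chr cdD); rewrite /= /h; congr pair; apply: chr_ext => w /=.
- by rewrite chr0 addr0.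
- by rewrite chr0 add0r.
Qed.

Lemma TL_flat P Q : flat P -> flat Q -> flat (TL UV0 VU0 P Q).
Proof.
move=> Pf Qf; apply: flat_of_ext => G.
have [W [N [s [t isoG]]]] := quadR UV0 VU0 G.
have [f [g isoc]] := charL_RR s t.
apply: ext1z_retractr (chrmap_retract (amL L) (iso_retract isoG)) _.
apply: ext1z_retractr (iso_retract isoc) _.
by apply: TL_ext; apply: flat_ext.
Qed.

Lemma TL_surj_cover (X : lmodType A) (Y : lmodType B)
    (f : {linear tens (rmod U) X -> Y}) (g : {linear tens (rmod V) Y -> X})
    (a : {linear mcoker g -> X}) (b : {linear mcoker f -> Y})
    (h : {linear TL UV0 VU0 (mcoker g) (mcoker f) -> LL f g}) :
  (forall x, cpi g (a x) = x) -> (forall y, cpi f (b y) = y) ->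
  (forall p w q z, h ((p, w), (q, z)) = (a p + g (tmap V b w), b q + f (tmap U a z))) ->
  surj h.
Proof.
move=> aK bK hE [x y].
have half (A' B' : nzRingType) (V' : bimod A' B') (U' : bimod B' A')
    (VU0' : tens_zero (rmod V') U') (X' : lmodType A') (Y' : lmodType B')
    (f' : {linear tens (rmod U') X' -> Y'}) (g' : {linear tens (rmod V') Y' -> X'})
    (a' : {linear mcoker g' -> X'}) (b' : {linear mcoker f' -> Y'}) x' :
    (forall x, cpi g' (a' x) = x) -> (forall y, cpi f' (b' y) = y) ->
    exists p w, a' p + g' (tmap V' b' w) = x'.
  move=> a'K b'K.
  have [|z zE] := (cpiP g' (x' - a' (cpi g' x'))).1; first by rewrite linearB a'K subrr.
  have bS : surj (tmap V' b').
    exact: (tmap_section_surj VU0' (r := idfun) (@cpi_surj _ _ _ f')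
      (fun y => (cpiP f' y).1) (fun c => ex_intro _ c erefl) b'K).
  have [w wE] := bS z.
  by exists (cpi g' x'), w; rewrite wE zE addrC subrK.
have [p [w e1]] := half _ _ V U VU0 _ _ f g a b x aK bK.
have [q [z e2]] := half _ _ U V UV0 _ _ g f b a y bK aK.
by exists ((p, w), (q, z)); rewrite hE e1 e2.
Qed.

(** The projections to the cokernels split. Their sections give a surjection from
    the induced module on the cokernels, which splits as well. *)
Lemma LL_projective (X : lmodType A) (Y : lmodType B)
    (f : {linear tens (rmod U) X -> Y}) (g : {linear tens (rmod V) Y -> X}) :
  projective (LL f g) ->
  [/\ projective (mcoker g) /\ projective (mcoker f), injective f /\ injective g,
      retract X (mcoker g * tens (rmod V) (mcoker f))%type &
      retract Y (mcoker f * tens (rmod U) (mcoker g))%type].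
Proof.
move=> PP.
have coker K J := ZL_ext_coker (K := K) (J := J) (ext1z_proj PP).
have PA : projective (mcoker g) by apply: projective_of_ext => K; have [] := coker K 'rV[B]_0.
have PB : projective (mcoker f) by apply: projective_of_ext => J; have [] := coker 'rV[A]_0 J.
have [a aK] := PA _ _ (cpi g) idfun (@cpi_surj _ _ _ g).
have [b bK] := PB _ _ (cpi f) idfun (@cpi_surj _ _ _ f).
have [h hE] := TL_map UV0 VU0 f g a b.
have hS := TL_surj_cover aK bK hE.
have [k kE] := PP _ _ h idfun hS.
have [h1 [h2 [h12 hg hf]]] := LL_comp h; have [k1 [k2 [k12 kg kf]]] := LL_comp k.
have k1K : cancel k1 h1.
  by move=> x; have := kE (x, 0); rewrite k12 h12 => /(congr1 fst).
have k2K : cancel k2 h2.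
  by move=> y; have := kE (0, y); rewrite k12 h12 => /(congr1 snd).
split=> //; last by exists k2, h2.
  split.
  - move=> z z' e; have : Tg U V _ _ (tmap U k1 z) = Tg U V _ _ (tmap U k1 z').
      by rewrite -kf -kf e.
    move/(Tg_inj UV0)/(congr1 (tmap U h1)); rewrite !tmap_comp.
    by rewrite !(tmap_id (h := h1 \o k1)).
  - move=> z z' e; have : Tg V U _ _ (tmap V k2 z) = Tg V U _ _ (tmap V k2 z').
      by rewrite -kg -kg e.
    move/(Tg_inj VU0)/(congr1 (tmap V h2)); rewrite !tmap_comp.
    by rewrite !(tmap_id (h := h2 \o k2)).
by exists k1, h1.
Qed.

End LeftLambda.

(** * Orthogonality and injectivity of right modules *)

Lemma ext1z_prodr (R : nzRingType) (M N K : lmodType R) :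
  ext1z K M -> ext1z K N -> ext1z K (M * N)%type.
Proof. exact: ext1z_extr (ses_pinl M N). Qed.

Section RightLambda.
Variables (A B : nzRingType) (V : bimod A B) (U : bimod B A).
Variables (UV0 : tens_zero (rmod U) V) (VU0 : tens_zero (rmod V) U).
Local Notation L := (Lambda00 V U).
Local Notation Lc := ((Lambda00 V U)^c).
Local Notation RR s t := (RRm UV0 VU0 s t).
Local Notation ZR K J := (ZR UV0 VU0 K J).

Lemma ZR_map (K K' : lmodType A^c) (J J' : lmodType B^c) (h : {linear K -> K'})
    (k : {linear J -> J'}) :
  exists l : {linear ZR K J -> ZR K' J'}, forall x y, l (x, y) = (h x, k y).
Proof. by apply: RR_mk => z; symmetry; exact: linear0. Qed.

Lemma ZR_ses (K1 K2 K3 : lmodType A^c) (J1 J2 J3 : lmodType B^c)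
    (i : {linear K1 -> K2}) (p : {linear K2 -> K3}) (j : {linear J1 -> J2})
    (q : {linear J2 -> J3}) : ses i p -> ses j q ->
  exists (a : {linear ZR K1 J1 -> ZR K2 J2}) (b : {linear ZR K2 J2 -> ZR K3 J3}),
    [/\ ses a b, forall x y, a (x, y) = (i x, j y) & forall x y, b (x, y) = (p x, q y)].
Proof.
move=> ip jq; have [a aE] := ZR_map i j; have [b bE] := ZR_map p q.
by exists a, b; split=> //; apply/(RR_ses aE bE).
Qed.


Lemma quadR_ses (M1 M2 M3 : lmodType Lc) (i : {linear M1 -> M2}) (p : {linear M2 -> M3})
    (W1 W2 W3 : lmodType A^c) (N1 N2 N3 : lmodType B^c)
    (s1 : {linear N1 -> homr U W1}) (t1 : {linear W1 -> homr V N1})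
    (s2 : {linear N2 -> homr U W2}) (t2 : {linear W2 -> homr V N2})
    (s3 : {linear N3 -> homr U W3}) (t3 : {linear W3 -> homr V N3}) :
  isomorphic M1 (RR s1 t1) -> isomorphic M2 (RR s2 t2) -> isomorphic M3 (RR s3 t3) ->
  ses i p ->
  exists (i' : {linear RR s1 t1 -> RR s2 t2}) (p' : {linear RR s2 t2 -> RR s3 t3})
    (i1 : {linear W1 -> W2}) (i2 : {linear N1 -> N2})
    (p1 : {linear W2 -> W3}) (p2 : {linear N2 -> N3}),
  [/\ ses i' p' /\ (ses i1 p1 /\ ses i2 p2),
      forall w n, i' (w, n) = (i1 w, i2 n), forall w n, p' (w, n) = (p1 w, p2 n),
      (forall w, t2 (i1 w) = hmap V i2 (t1 w)) /\ (forall n, s2 (i2 n) = hmap U i1 (s1 n)) &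
      (forall w, t3 (p1 w) = hmap V p2 (t2 w)) /\ (forall n, s3 (p2 n) = hmap U p1 (s2 n))].
Proof.
move=> iso1 iso2 iso3 ip.
have [i' ip'] := ses_iso_sub (iso_sym iso1) ip.
have [p' ip''] := ses_iso_quo iso3 ip'.
have [i'' [p'' s'']] := ses_iso_mid iso2 ip''.
have [i1 [i2 [iE it is']]] := RR_comp i''; have [p1 [p2 [pE pt ps]]] := RR_comp p''.
by exists i'', p'', i1, i2, p1, p2; split=> //; split=> //; apply/(RR_ses iE pE).
Qed.

Section Ext.
Variables (W : lmodType A^c) (N : lmodType B^c).
Variables (s : {linear N -> homr U W}) (t : {linear W -> homr V N}).

Lemma HR_ext (I : lmodType A^c) (J : lmodType B^c) :
  ext1z W I -> ext1z N J -> ext1z (RR s t) (HR UV0 VU0 I J).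
Proof.
move=> WI NJ; have [K [P [i [p [PP ip]]]]] := enough_projectives (RR s t).
have [WP [NP [sP [tP isoP]]]] := quadR UV0 VU0 P.
have [WK [NK [sK [tK isoK]]]] := quadR UV0 VU0 K.
have [i' [p' [i1 [i2 [p1 [p2 [[ip' [s1 s2]] iE pE [it is'] _]]]]]]] :=
  quadR_ses isoK isoP (iso_refl _) ip.
apply: ext1z_pres ip' (proj_iso isoP PP) _ => h.
have [a [b hE]] := HR_hom h.
have [a' a'E] := WI _ _ _ _ s1 a; have [b' b'E] := NJ _ _ _ _ s2 b.
have [k kE] := HR_map UV0 VU0 sP tP a' b'.
exists k => -[w n]; rewrite iE kE hE it is' a'E b'E; congr ((_, _), (_, _)).
- by apply: homr_ext => v; exact: b'E.
- by apply: homr_ext => u; exact: a'E.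
Qed.

Lemma ZR_ext (LA K : lmodType A^c) (LB J : lmodType B^c) (p : {linear LA -> W})
    (q : {linear LB -> N}) : ses p t -> ses q s -> ext1z K LA -> ext1z J LB ->
  ext1z (ZR K J) (RR s t).
Proof.
move=> pt qs KLA JLB; have [C [I [i [r [II ir]]]]] := enough_injectives (RR s t).
have [WI [NI [sI [tI isoI]]]] := quadR UV0 VU0 I.
have [WC [NC [sC [tC isoC]]]] := quadR UV0 VU0 C.
have [i' [r' [i1 [i2 [r1 [r2 [[ir' [e1 e2]] iE rE [it is'] [rt rs]]]]]]]] :=
  quadR_ses (iso_refl _) isoI isoC ir.
apply: ext1z_copres ir' (injmod_retract (iso_retract (iso_sym isoI)) II) _ => h.
have [h1 [h2 [hE ht hs]]] := RR_comp h.
have ext (A' B' : nzRingType) (V' : bimod A' B') (W' WI' WC' LA' K' : lmodType A'^c)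
    (N' NI' NC' : lmodType B'^c)
    (t' : {linear W' -> homr V' N'}) (tI' : {linear WI' -> homr V' NI'})
    (tC' : {linear WC' -> homr V' NC'}) (p' : {linear LA' -> W'})
    (a1 : {linear W' -> WI'}) (b1 : {linear WI' -> WC'})
    (a2 : {linear N' -> NI'}) (b2 : {linear NI' -> NC'}) (k : {linear K' -> WC'}) :
    ses p' t' -> ses a1 b1 -> ses a2 b2 ->
    (forall w, tI' (a1 w) = hmap V' a2 (t' w)) ->
    (forall w, tC' (b1 w) = hmap V' b2 (tI' w)) ->
    (forall x, tC' (k x) = 0) -> ext1z K' LA' ->
    exists k' : {linear K' -> WI'}, (forall x, b1 (k' x) = k x) /\ forall x, tI' (k' x) = 0.
  move=> pt' ab1 ab2 ta tb tk KL; have [p'I t'S ex] := pt'.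
  have [c [d [cd cE dE]]] := rhalf_ker_ses ab1 ab2 t'S ta tb.
  have [m mE] := ker_lift tk.
  have KK : ext1z K' (mker t').
    have [u uE] := ses_lift (h := kin t') pt' (@kin0 _ _ _ t').
    apply: (ext1z_retractr _ KL); apply: iso_retract.
    apply: (iso_bij (f := u)) => [x y e|y]; first by apply: kin_inj; rewrite -!uE e.
    have [|x xE] := (kinP t' (p' y)).1; first by rewrite (ses0 _ pt').
    by exists x; apply: p'I; rewrite uE.
  have [m' m'E] := ext1z_lift m KK cd.
  exists (kin tI' \o m'); split=> x; last exact: (kin0 (m' x)).
  by rewrite -[LHS]/(b1 (kin tI' (m' x))) -dE m'E mE.
have ht0 w : tC (h1 w) = 0 by rewrite ht; exact: linear0.
have hs0 n : sC (h2 n) = 0 by rewrite hs; exact: linear0.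
have [k1 [k1E k1t]] := ext _ _ V _ _ _ _ _ _ _ _ _ _ _ _ _ _ _ _ h1 pt e1 e2 it rt ht0 KLA.
have [k2 [k2E k2s]] := ext _ _ U _ _ _ _ _ _ _ _ _ _ _ _ _ _ _ _ h2 qs e2 e1 is' rs hs0 JLB.
have [||k kE] := @RR_mk _ _ _ _ UV0 VU0 _ _ _ _
  (\0 : {linear J -> homr U K}) (\0 : {linear K -> homr V J}) sI tI k1 k2.
- by move=> w; rewrite k1t; symmetry; exact: linear0.
- by move=> w; rewrite k2s; symmetry; exact: linear0.
by exists k => -[x y]; rewrite kE rE hE k1E k2E.
Qed.
End Ext.

Lemma ZR_ext_ker (W K : lmodType A^c) (N J : lmodType B^c)
    (s : {linear N -> homr U W}) (t : {linear W -> homr V N}) :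
  ext1z (ZR K J) (RR s t) -> ext1z K (mker t) /\ ext1z J (mker s).
Proof.
move=> KJ.
have ext (K' K2 : lmodType A^c) (J' J2 : lmodType B^c) (i : {linear K' -> K2})
    (p : {linear K2 -> K}) (j : {linear J' -> J2})
    (q : {linear J2 -> J}) (h : {linear K' -> mker t}) (k : {linear J' -> mker s}) :
    ses i p -> ses j q -> exists (h' : {linear K2 -> mker t}) (k' : {linear J2 -> mker s}),
    (forall x, h' (i x) = h x) /\ (forall y, k' (j y) = k y).
  move=> ip jq; have [a [b [ab aE bE]]] := ZR_ses ip jq.
  have [||l lE] := @RR_mk _ _ _ _ UV0 VU0 _ _ _ _ (\0 : {linear J' -> homr U K'})
    (\0 : {linear K' -> homr V J'}) s t (kin t \o h) (kin s \o k).
  - by move=> z; rewrite -[LHS]/(t (kin t (h z))) kin0; symmetry; exact: linear0.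
  - by move=> z; rewrite -[LHS]/(s (kin s (k z))) kin0; symmetry; exact: linear0.
  have [l' l'E] := KJ _ _ _ _ ab l.
  have [l1 [l2 [l12 l1t l2s]]] := RR_comp l'.
  have [|h' h'E] := ker_lift (f := t) (h := l1).
    by move=> z; rewrite l1t; exact: linear0.
  have [|k' k'E] := ker_lift (f := s) (h := l2).
    by move=> z; rewrite l2s; exact: linear0.
  exists h', k'; split=> x; apply: kin_inj.
  - have := l'E (x, 0); rewrite aE l12 lE => /(congr1 fst) e.
    by rewrite h'E; exact: e.
  - have := l'E (0, x); rewrite aE l12 lE => /(congr1 snd) e.
    by rewrite k'E; exact: e.
have id (R : nzRingType) (M : lmodType R) : ses (\0 : {linear 'rV[R]_0 -> M}) idfun.
  by apply: (ses_can (g := idfun)) => x.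
split=> E' E i p ip h.
  by have [h' [_ [h'E _]]] := ext _ _ _ _ _ _ _ _ h \0 ip (id _ J); exists h'.
by have [_ [k' [_ k'E]]] := ext _ _ _ _ _ _ _ _ \0 h (id _ K) ip; exists k'.
Qed.

Lemma HR_injective I J : injmod I -> injmod J -> injmod (HR UV0 VU0 I J).
Proof.
move=> II JI; apply/injmodP => M; have [W [N [s [t isoM]]]] := quadR UV0 VU0 M.
by apply: ext1z_retractl (iso_retract isoM) _; apply: HR_ext; apply: ext1z_inj.
Qed.

(** The inclusions of the kernels split. Their retractions give an embedding into
    the coinduced module on the kernels, which splits as well. *)
Lemma RR_injective (W : lmodType A^c) (N : lmodType B^c)
    (s : {linear N -> homr U W}) (t : {linear W -> homr V N}) :
  injmod (RR s t) ->
  [/\ injmod (mker t) /\ injmod (mker s), surj s /\ surj t,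
      retract W (mker t * homr V (mker s))%type &
      retract N (mker s * homr U (mker t))%type].
Proof.
move=> II.
have ker K J : ext1z K (mker t) /\ ext1z J (mker s) := ZR_ext_ker (ext1z_inj II).
have PA : injmod (mker t) by apply/injmodP => K; have [] := ker K 'rV[B^c]_0.
have PB : injmod (mker s) by apply/injmodP => J; have [] := ker 'rV[A^c]_0 J.
have [a aK] := PA _ _ (kin t) idfun (@kin_inj _ _ _ t).
have [b bK] := PB _ _ (kin s) idfun (@kin_inj _ _ _ s).
have [h hE] := HR_map UV0 VU0 s t a b.
have inj (A' B' : nzRingType) (V' : bimod A' B') (U' : bimod B' A')
    (VU0' : tens_zero (rmod V') U') (W' : lmodType A'^c) (N' : lmodType B'^c)
    (s' : {linear N' -> homr U' W'}) (t' : {linear W' -> homr V' N'})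
    (a' : {linear W' -> mker t'}) (b' : {linear N' -> mker s'}) w :
    (forall x, a' (kin t' x) = x) -> (forall y, b' (kin s' y) = y) ->
    a' w = 0 -> hmap V' b' (t' w) = 0 -> w = 0.
  move=> a'K b'K aw bw.
  have bI : injective (hmap V' b').
    apply: (hmap_retract_inj VU0' (@kin_inj _ _ _ s') (fun n => (kinP s' n).1) (j := idfun)).
    - by move=> x y.
    - exact: b'K.
  have [y yw] := (kinP t' w).1 (lin_inj0 bI bw).
  by move: aw; rewrite -yw a'K => ->; rewrite linear0.
have hI : injective h.
  apply: lin_inj => -[w n]; rewrite hE => e; congr pair.
  - exact: (inj _ _ V U VU0 _ _ s t a b w aK bK (congr1 (fun x => x.1.1) e) (congr1 (fun x => x.1.2) e)).
  - exact: (inj _ _ U V UV0 _ _ t s b a n bK aK (congr1 (fun x => x.2.1) e) (congr1 (fun x => x.2.2) e)).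
have [k kE] := II _ _ h idfun hI.
have [h1 [h2 [h12 ht hs]]] := RR_comp h; have [k1 [k2 [k12 kt ks]]] := RR_comp k.
have k1K : cancel h1 k1.
  by move=> x; have := kE (x, 0); rewrite h12 k12 => /(congr1 fst).
have k2K : cancel h2 k2.
  by move=> y; have := kE (0, y); rewrite h12 k12 => /(congr1 snd).
split=> //; [|by exists h1, k1|by exists h2, k2].
split=> phi.
- have [c cE] := Ht_onto UV0 (hmap U h1 phi).
  exists (k2 (0, c)); rewrite ks cE; apply: homr_ext => u; exact: k1K.
- have [c cE] := Ht_onto VU0 (hmap V h2 phi).
  exists (k1 (0, c)); rewrite kt cE; apply: homr_ext => v; exact: k2K.
Qed.
(** ** Characters of modules over the Morita context ring *)

Section Characters.
Variables (X : lmodType A) (Y : lmodType B).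
Variables (f : {linear tens (rmod U) X -> Y}) (g : {linear tens (rmod V) Y -> X}).

Lemma charR_LL : exists (s : {linear charR Y -> homr U (charR X)})
    (t : {linear charR X -> homr V (charR Y)}),
  [/\ isomorphic (charR (LLm UV0 VU0 f g)) (RR s t),
      forall c u x, (s c u : charR X) x = c (f (tpure u x)) &
      forall c v y, (t c v : charR Y) y = c (g (tpure v y))].
Proof.
have half (A' B' : nzRingType) (U' : bimod B' A') (X' : lmodType A') (Y' : lmodType B')
    (f' : {linear tens (rmod U') X' -> Y'}) :
    exists s : {linear charR Y' -> homr U' (charR X')},
    forall c u x, (s c u : charR X') x = c (f' (tpure u x)).
  have [Dl Dr Z] := tpure_balanced (rmod U') X'.
  have cD (c : charR Y') (u : rmod U') : {morph (fun x => c (f' (tpure u x))) : x y / x + y}.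
    by move=> x y; rewrite Dr linearD chrD.
  have cL c : linear (fun u : rmod U' => Chr (cD c u) : charR X').
    by move=> a u u'; apply: chr_ext => x /=; rewrite Dl linearD chrD Z.
  have sL : linear (fun c => (mklin (cL c) : {linear rmod U' -> charR X'}) : homr U' (charR X')).
    move=> b c c'; apply: homr_ext => u; apply: chr_ext => x.
    rewrite -[LHS]/(c ((b : B') *: f' (tpure u x)) + c' (f' (tpure u x))).
    by rewrite -linearZ scale_tpure.
  by exists (mklin sL).
have [s sE] := half _ _ _ _ _ f; have [t tE] := half _ _ _ _ _ g.
exists s, t; split=> //.
have inX (c : charR (LLm UV0 VU0 f g)) : {morph (fun x => c (x, 0)) : x y / x + y}.
  by move=> x y; rewrite -chrD LLD addr0.
have inY (c : charR (LLm UV0 VU0 f g)) : {morph (fun y => c (0, y)) : x y / x + y}.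
  by move=> x y; rewrite -chrD LLD addr0.
pose h (c : charR (LLm UV0 VU0 f g)) : RR s t :=
  (Chr (inX c) : charR X, Chr (inY c) : charR Y).
have t0 (R S : nzRingType) (M : bimod R S) (Z : lmodType S) (m : M) :
    tpure (m : rmod M) (0 : Z) = 0.
  by have [_ Dr _] := tpure_balanced (rmod M) Z; apply: (morph_add0 (Dr m)).
have hL : linear h.
  move=> l c c'; rewrite /h [X in _ = X + _]RRZ RRD.
  congr pair; apply: chr_ext => w.
  - rewrite -[LHS]/(c ((l : L) *: ((w, 0) : LLm UV0 VU0 f g)) + c' (w, 0)).
    rewrite -[RHS]/(c ((La l : A) *: w, 0) + (s (Chr (inY c)) (Lu l) : charR X) w + c' (w, 0)).
    rewrite sE /= -chrD LLZ LLD t0 linear0 scaler0 !addr0 add0r.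
    by [].
  - rewrite -[LHS]/(c ((l : L) *: ((0, w) : LLm UV0 VU0 f g)) + c' (0, w)).
    rewrite -[RHS]/((t (Chr (inX c)) (Lv l) : charR Y) w + c (0, (Lb l : B) *: w) + c' (0, w)).
    rewrite tE /= -chrD LLZ LLD t0 linear0 scaler0 !addr0 !add0r.
    by [].
apply: (iso_bij (f := mklin hL)) => [c c' e|[c d]].
  apply: chr_ext => -[x y].
  have -> : (x, y) = ((x, 0) : LLm UV0 VU0 f g) + ((0, y) : LLm UV0 VU0 f g).
    by rewrite LLD addr0 add0r.
  rewrite !chrD; congr (_ + _).
  - exact: (congr1 (fun z : RR s t => (z.1 : charR X) x) e).
  - exact: (congr1 (fun z : RR s t => (z.2 : charR Y) y) e).
have cdD : {morph (fun m : LLm UV0 VU0 f g => c m.1 + d m.2) : x y / x + y}.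
  by move=> [x y] [x' y']; rewrite LLD /= !chrD addrACA.
exists (Chr cdD); rewrite /= /h; congr pair; apply: chr_ext => w /=.
- by rewrite chr0 addr0.
- by rewrite chr0 add0r.
Qed.

(** The structure maps of the character module are the characters of f and g; by
    the description of injective modules they are onto, with injective kernels,
    which are the characters of the cokernels of f and g. *)
Lemma LL_flat : flat (LLm UV0 VU0 f g) ->
  [/\ injective f, injective g, flat (mcoker f) & flat (mcoker g)].
Proof.
move=> /flatP FI; have [s [t [isoF sE tE]]] := charR_LL.
have [[KA KB] [sS tS] _ _] := RR_injective (injmod_retract (iso_retract (iso_sym isoF)) FI).
have half (A' B' : nzRingType) (U' : bimod B' A') (X' : lmodType A') (Y' : lmodType B')
    (f' : {linear tens (rmod U') X' -> Y'}) (s' : {linear charR Y' -> homr U' (charR X')}) :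
    (forall c u x, (s' c u : charR X') x = c (f' (tpure u x))) -> surj s' ->
    injmod (mker s') -> injective f' /\ flat (mcoker f').
  move=> s'E s'S K'.
  have f'I : injective f'.
    apply: lin_inj => z z0; apply: contrapT => /QZ_cogenerator[k [kD]]; apply.
    have kb : balanced (fun (u : rmod U') (x : X') => k (tpure u x)).
      have [Dl Dr Z] := tpure_balanced (rmod U') X'.
      by split=> *; rewrite ?Dl ?Dr ?kD ?Z.
    have [h hE] := bal_charR kb; have [c cE] := s'S (h : homr U' (charR X')).
    have -> : k z = c (f' z); last by rewrite z0 chr0.
    move: z {z0}; apply: tens_ext => [//|x y|u x]; first by rewrite linearD chrD.
    by rewrite -s'E cE -hE.
  split=> //; apply/flatP.
  have cs := chrmap_ses (amR B') (ses_cpi f'I); have [cI _ cex] := cs.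
  have s'0 c : s' c = 0 <-> chrmap (amR B') f' c = 0.
    split=> e; last first.
      apply: homr_ext => u; apply: chr_ext => x; rewrite s'E.
      exact: (congr1 (fun d : chrmod _ _ => d (tpure u x)) e).
    apply: chr_ext; apply: tens_ext => [x y|x y|u x]; [exact: chrD|by rewrite addr0|].
    by rewrite chrmapE -s'E e.
  have [|d dE] := ker_lift (f := s') (h := chrmap (amR B') (cpi f')).
    by move=> c; apply/s'0/cex; exists c.
  apply: injmod_retract (iso_retract _) K'.
  apply: (iso_bij (f := d)) => [c c' e|y]; first by apply: cI; rewrite -!dE e.
  have [c cE] := (cex _).1 ((s'0 _).1 (kin0 y)).
  by exists c; apply: kin_inj; rewrite dE cE.
have [fI fF] := half _ _ _ _ _ f s sE sS KB; have [gI gF] := half _ _ _ _ _ g t tE tS KA.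
by [].
Qed.
End Characters.
End RightLambda.

(** * Ding projective modules over the Morita context ring *)

Lemma ext1z_prodl (R : nzRingType) (M N K : lmodType R) :
  ext1z M K -> ext1z N K -> ext1z (M * N)%type K.
Proof. exact: ext1z_extl (ses_pinl M N). Qed.

Lemma flat0 (R : nzRingType) : flat ('rV[R]_0 : lmodType R).
Proof.
apply: projective_flat => M N p h pS; exists \0 => x /=.
by rewrite linear0 [x](_ : _ = 0) ?linear0 //; apply/matrixP => i [].
Qed.

Section MoritaDP.
Variables (A B : nzRingType) (V : bimod A B) (U : bimod B A).
Variables (UV0 : tens_zero (rmod U) V) (VU0 : tens_zero (rmod V) U).
Local Notation L := (Lambda00 V U).
Local Notation LL f g := (LLm UV0 VU0 f g).

Section Sufficient.
Hypotheses (fdU : fd_finite U) (rfdU : rfd_finite (rmod U)).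
Hypotheses (fdV : fd_finite V) (rfdV : rfd_finite (rmod V)).
Variables (CA : lmodType A -> Prop) (CB : lmodType B -> Prop).
Hypotheses (CAcl : DP_class CA) (CBcl : DP_class CB).

(** Closed under isomorphism, as the syzygies and cosyzygies arise as kernels and
    cokernels and not as quadruples. *)
Definition coker_class (M : lmodType L) : Prop :=
  exists (X : lmodType A) (Y : lmodType B)
    (f : {linear tens (rmod U) X -> Y}) (g : {linear tens (rmod V) Y -> X})
    (LA : lmodType A) (LB : lmodType B) (p : {linear X -> LA}) (q : {linear Y -> LB}),
    [/\ isomorphic M (LL f g), ses g p, ses f q, CA LA & CB LB].

Section Member.
Variables (X : lmodType A) (Y : lmodType B).
Variables (f : {linear tens (rmod U) X -> Y}) (g : {linear tens (rmod V) Y -> X}).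
Variables (LA : lmodType A) (LB : lmodType B).
Variables (p : {linear X -> LA}) (q : {linear Y -> LB}).
Hypotheses (gp : ses g p) (fq : ses f q) (CLA : CA LA) (CLB : CB LB).

Lemma coker_class_right : exists M', coker_class M' /\ linked (@projective L) (LL f g) M'.
Proof.
have [_ [LA' [CLA' [P [i [pi [PP ipi]]]]]] _] := CAcl CLA.
have [_ [LB' [CLB' [Q [j [rho [QP jrho]]]]]] _] := CBcl CLB.
have [phi1 [phi1I phi1p phi1g]] := half_embed VU0 gp fq ipi jrho
  (DP_ext_tens CAcl CLA fdV (projective_flat QP)) (DP_ext_charL CBcl CLB' rfdV).
have [phi2 [phi2I phi2q phi2f]] := half_embed UV0 fq gp jrho ipi
  (DP_ext_tens CBcl CLB fdU (projective_flat PP)) (DP_ext_charL CAcl CLA' rfdU).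
have cg z : phi1 (g z) = Tg V U P Q (tmap V phi2 z).
  by rewrite phi1g TgE tmap_comp (eq_tmap (h := fst \o phi2) (k := j \o q)).
have cf z : phi2 (f z) = Tg U V Q P (tmap U phi1 z).
  by rewrite phi2f TgE tmap_comp (eq_tmap (h := fst \o phi1) (k := i \o p)).
have [phi phiE] := LL_mk UV0 VU0 cg cf.
have phiI : injective phi.
  move=> [x y] [x' y']; rewrite !phiE => e.
  by rewrite (phi1I _ _ (congr1 fst e)) (phi2I _ _ (congr1 snd e)).
have [X' [Y' [f' [g' iso']]]] := quadL UV0 VU0 (mcoker phi).
have [c phic] := ses_iso_quo iso' (ses_cpi phiI).
have [c1 [c2 [cE c1g c2f]]] := LL_comp c.
have [s1 s2] := (LL_ses phiE cE).1 phic.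
have [p' gp'] := half_embed_coker VU0 gp ipi s1 s2 phi1p cg c1g.
have [q' fq'] := half_embed_coker UV0 fq jrho s2 s1 phi2q cf c2f.
exists (mcoker phi); split; first by exists X', Y', f', g', LA', LB', p', q'.
exists (TL UV0 VU0 P Q), phi, (cpi phi); split; first exact: TL_projective.
exact: ses_cpi.
Qed.

Lemma coker_class_left : exists M', coker_class M' /\ linked (@projective L) M' (LL f g).
Proof.
have [[LA' [CLA' [P [i [pi [PP ipi]]]]]] _ _] := CAcl CLA.
have [[LB' [CLB' [Q [j [rho [QP jrho]]]]]] _ _] := CBcl CLB.
have [_ pS _] := gp; have [_ qS _] := fq.
have [a aE] := PP _ _ p pi pS; have [b bE] := QP _ _ q rho qS.
have [h hE] := TL_map UV0 VU0 f g a b.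
have [h1 [h2 [h12 hg hf]]] := LL_comp h.
have h1E x w : h1 (x, w) = a x + g (tmap V b w).
  rewrite -[LHS]/((h1 (x, w), h2 0).1) -h12 (hE x w 0 0); exact: erefl.
have h2E y w : h2 (y, w) = b y + f (tmap U a w).
  rewrite -[LHS]/((h1 0, h2 (y, w)).2) -h12 (hE 0 0 y w); exact: erefl.
have h1S := half_cover_surj VU0 gp fq ipi jrho aE bE h1E.
have h2S := half_cover_surj UV0 fq gp jrho ipi bE aE h2E.
have hS : surj h.
  by move=> [x y]; have [x' <-] := h1S x; have [y' <-] := h2S y; exists (x', y').
have [X' [Y' [f' [g' iso']]]] := quadL UV0 VU0 (mker h).
have [k kh] := ses_iso_sub (iso_sym iso') (ses_kin hS).
have [k1 [k2 [kE kg kf]]] := LL_comp k.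
have [s1 s2] := (LL_ses kE h12).1 kh.
have LBV := DP_ext_charL CBcl CLB rfdV; have LAU := DP_ext_charL CAcl CLA rfdU.
have [p' [p'E p'S p'g]] := half_cover_ker VU0 gp fq ipi jrho aE bE h1E s1 kg.
have [q' [q'E q'S q'f]] := half_cover_ker UV0 fq gp jrho ipi bE aE h2E s2 kf.
have p'ex := half_cover_exact gp jrho LBV bE h1E s1 kg p'E q'E q'S.
have q'ex := half_cover_exact fq ipi LAU aE h2E s2 kf q'E p'E p'S.
have g'I := half_cover_inj VU0 jrho LBV kg q'E q'S q'ex.
have f'I := half_cover_inj UV0 ipi LAU kf p'E p'S p'ex.
exists (mker h); split.
  exists X', Y', f', g', LA', LB', p', q'; split=> //.
  - by split=> // x; split=> [/p'ex//|[z <-]].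
  - by split=> // x; split=> [/q'ex//|[z <-]].
exists (TL UV0 VU0 P Q), (kin h), h; split; first exact: TL_projective.
exact: ses_kin.
Qed.

(** A flat module is an extension of the trivial modules on its cokernels and on
    their tensor products, which have finite flat dimension. *)
Lemma coker_class_ext F : flat F -> ext1z (LL f g) F.
Proof.
move=> Ff; have [XF [YF [fF [gF isoF]]]] := quadL UV0 VU0 F.
have Ff' := flat_iso isoF Ff.
have [fI gI ff gf] := LL_flat Ff'.
apply: ext1z_retractr (iso_retract isoF) _.
have [||i iE] := @LL_mk _ _ _ _ UV0 VU0 _ _ _ _
  (\0 : {linear tens (rmod U) (tens (rmod V) YF) -> tens (rmod U) XF})
  (\0 : {linear tens (rmod V) (tens (rmod U) XF) -> tens (rmod V) YF}) fF gF gF fF.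
- by move=> z; rewrite (g_tmapf VU0) linear0.
- by move=> z; rewrite (f_tmapg UV0) linear0.
have [||c cE] := @LL_mk _ _ _ _ UV0 VU0 _ _ _ _ fF gF
  (\0 : {linear tens (rmod U) (mcoker gF) -> mcoker fF})
  (\0 : {linear tens (rmod V) (mcoker fF) -> mcoker gF}) (cpi gF) (cpi fF).
- by move=> z; apply/cpiP; exists z.
- by move=> z; apply/cpiP; exists z.
have ic : ses i c by apply/(LL_ses iE cE); split; apply: ses_cpi.
have isoV : isomorphic (tens (rmod V) YF) (tens (rmod V) (mcoker fF)).
  apply: (iso_bij (f := tmap V (cpi fF))); last exact: tmap_surj (@cpi_surj _ _ _ fF).
  exact: (tmap_coker_inj VU0 (@cpi_surj _ _ _ fF) (fun y => (cpiP fF y).1)).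
have isoU : isomorphic (tens (rmod U) XF) (tens (rmod U) (mcoker gF)).
  apply: (iso_bij (f := tmap U (cpi gF))); last exact: tmap_surj (@cpi_surj _ _ _ gF).
  exact: (tmap_coker_inj UV0 (@cpi_surj _ _ _ gF) (fun y => (cpiP gF y).1)).
apply: (ext1z_extr ic); apply: (ZL_ext gp fq).
- exact: ext1z_retractr (iso_retract isoV) (DP_ext_tens CAcl CLA fdV ff).
- exact: ext1z_retractr (iso_retract isoU) (DP_ext_tens CBcl CLB fdU gf).
- by have [_ _ h] := CAcl CLA; apply: h.
- by have [_ _ h] := CBcl CLB; apply: h.
Qed.
End Member.

Lemma coker_class_DP : DP_class coker_class.
Proof.
move=> M [X [Y [f [g [LA [LB [p [q [isoM gp fq CLA CLB]]]]]]]]]; split.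
- have [M' [CM' lk]] := coker_class_left gp fq CLA CLB; exists M'; split=> //.
  exact: linked_isor (iso_sym isoM) lk.
- have [M' [CM' lk]] := coker_class_right gp fq CLA CLB; exists M'; split=> //.
  exact: linked_isol isoM lk.
- move=> F Ff; apply: ext1z_retractl (iso_retract isoM) _.
  exact: coker_class_ext gp fq CLA CLB F Ff.
Qed.
End Sufficient.

Lemma DP_of_cokers (X : lmodType A) (Y : lmodType B)
    (f : {linear tens (rmod U) X -> Y}) (g : {linear tens (rmod V) Y -> X}) :
    fd_finite U -> rfd_finite (rmod U) -> fd_finite V -> rfd_finite (rmod V) ->
    injective f -> injective g -> DP (mcoker f) -> DP (mcoker g) ->
  DP (LL f g).
Proof.
move=> fdU rfdU fdV rfdV fI gI /DP_class_of[CB [CBcl _ Cf]] /DP_class_of[CA [CAcl _ Cg]].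
apply: (DP_of_class (coker_class_DP fdU rfdU fdV rfdV CAcl CBcl)).
exists X, Y, f, g, (mcoker g), (mcoker f), (cpi g), (cpi f).
by split=> //; [apply: iso_refl|apply: ses_cpi|apply: ses_cpi].
Qed.

Section Necessary.
Hypothesis TorV : forall (j : nat) (F1 : lmodType A), (1 <= j)%N -> flat F1 ->
  Tor_zero j (rmod V) (tens (rmod U) F1).
Hypothesis TorU : forall (j : nat) (F2 : lmodType B), (1 <= j)%N -> flat F2 ->
  Tor_zero j (rmod U) (tens (rmod V) F2).
Hypotheses (fdU : fd_finite U) (rfdU : rfd_finite (rmod U)).
Hypotheses (fdV : fd_finite V) (rfdV : rfd_finite (rmod V)).
Variable D : lmodType L -> Prop.
Hypothesis Dcl : DP_class D.
Hypothesis Diso : iso_closed D.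

Implicit Types (X XP : lmodType A) (Y YP : lmodType B).

Lemma DP_cosyzygy_quad X Y (f : {linear tens (rmod U) X -> Y}) (g : {linear tens (rmod V) Y -> X}) :
  D (LL f g) -> exists XP YP (fP : {linear tens (rmod U) XP -> YP})
    (gP : {linear tens (rmod V) YP -> XP}) X' Y'
    (f' : {linear tens (rmod U) X' -> Y'}) (g' : {linear tens (rmod V) Y' -> X'})
    (i1 : {linear X -> XP}) (i2 : {linear Y -> YP})
    (p1 : {linear XP -> X'}) (p2 : {linear YP -> Y'}),
  [/\ projective (LL fP gP), D (LL f' g'), ses i1 p1 /\ ses i2 p2,
      (forall z, i1 (g z) = gP (tmap V i2 z)) /\ (forall z, i2 (f z) = fP (tmap U i1 z)) &
      (forall z, p1 (gP z) = g' (tmap V p2 z)) /\ (forall z, p2 (fP z) = f' (tmap U p1 z))].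
Proof.
move=> /Dcl[_ [M' [DM' [P [i [p [PP ip]]]]]] _].
have [XP [YP [fP [gP isoP]]]] := quadL UV0 VU0 P.
have [X' [Y' [f' [g' iso']]]] := quadL UV0 VU0 M'.
have [i1 [i2 [p1 [p2 [s ig if' pg pf]]]]] := quadL_ses (iso_refl _) isoP iso' ip.
exists XP, YP, fP, gP, X', Y', f', g', i1, i2, p1, p2; split=> //.
  exact: proj_iso isoP PP.
exact: Diso iso' DM'.
Qed.

Lemma DP_syzygy_quad X Y (f : {linear tens (rmod U) X -> Y}) (g : {linear tens (rmod V) Y -> X}) :
  D (LL f g) -> exists XP YP (fP : {linear tens (rmod U) XP -> YP})
    (gP : {linear tens (rmod V) YP -> XP}) X' Y'
    (f' : {linear tens (rmod U) X' -> Y'}) (g' : {linear tens (rmod V) Y' -> X'})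
    (i1 : {linear X' -> XP}) (i2 : {linear Y' -> YP})
    (p1 : {linear XP -> X}) (p2 : {linear YP -> Y}),
  [/\ projective (LL fP gP), D (LL f' g'), ses i1 p1 /\ ses i2 p2,
      (forall z, i1 (g' z) = gP (tmap V i2 z)) /\ (forall z, i2 (f' z) = fP (tmap U i1 z)) &
      (forall z, p1 (gP z) = g (tmap V p2 z)) /\ (forall z, p2 (fP z) = f (tmap U p1 z))].
Proof.
move=> /Dcl[[M' [DM' [P [i [p [PP ip]]]]]] _ _].
have [XP [YP [fP [gP isoP]]]] := quadL UV0 VU0 P.
have [X' [Y' [f' [g' iso']]]] := quadL UV0 VU0 M'.
have [i1 [i2 [p1 [p2 [s ig if' pg pf]]]]] := quadL_ses iso' isoP (iso_refl _) ip.
exists XP, YP, fP, gP, X', Y', f', g', i1, i2, p1, p2; split=> //.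
  exact: proj_iso isoP PP.
exact: Diso iso' DM'.
Qed.

(** The second components of projective modules are summands of Q + U (x) P, on
    which the higher Tor of V vanishes. So Tor_1(V, Y) is a Tor of V with cosyzygies
    in degrees beyond its flat dimension. *)
Lemma DP_class_ext_charL X Y (f : {linear tens (rmod U) X -> Y})
    (g : {linear tens (rmod V) Y -> X}) : D (LL f g) ->
  ext1z Y (charL (rmod V)) /\ ext1z X (charL (rmod U)).
Proof.
move=> Dfg; split.
- have [K [n [K0 KI Kn]]] := rfd_charL rfdV; rewrite -K0.
  apply: (@ext1z_coresolution _
    (fun Y => exists X (f : {linear tens (rmod U) X -> Y}) (g : {linear tens (rmod V) Y -> X}), D (LL f g))
    (fun Y => exists X (f : {linear tens (rmod U) X -> Y}) (g : {linear tens (rmod V) Y -> X}),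
      projective (LL f g)) K n) => //.
  + move=> Y0 [X0 [f0 [g0
      /DP_cosyzygy_quad[XP [YP [fP [gP [X' [Y' [f' [g' [i1 [i2 [p1 [p2 [PP D' [_ s2] _ _]]]]]]]]]]]]]]]].
    exists Y'; first by exists X', f', g'.
    by exists YP, i2, p2; split=> //; exists XP, fP, gP.
  + move=> Q i [XP [fP [gP /LL_projective[[PA PB] _ _ ret]]]].
    apply: ext1z_retractl ret _; apply: ext1z_prodl; first exact: ext1z_proj.
    have [Pr PrP] := projective_resolution (tens (rmod U) (mcoker gP)).
    have Zs : syzseq (@projective B) (rsyz Pr) by exact: rsyz_seq.
    have := (ext1z_balanceD 0 0 i Zs KI).1; rewrite !add0n; apply.
    rewrite K0; apply: Tor_zero_rsyz => // j j1; apply: TorV => //.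
    exact: projective_flat.
  + by exists X, f, g.
- have [K [n [K0 KI Kn]]] := rfd_charL rfdU; rewrite -K0.
  apply: (@ext1z_coresolution _
    (fun X => exists Y (f : {linear tens (rmod U) X -> Y}) (g : {linear tens (rmod V) Y -> X}), D (LL f g))
    (fun X => exists Y (f : {linear tens (rmod U) X -> Y}) (g : {linear tens (rmod V) Y -> X}),
      projective (LL f g)) K n) => //.
  + move=> X0 [Y0 [f0 [g0
      /DP_cosyzygy_quad[XP [YP [fP [gP [X' [Y' [f' [g' [i1 [i2 [p1 [p2 [PP D' [s1 _] _ _]]]]]]]]]]]]]]]].
    exists X'; first by exists Y', f', g'.
    by exists XP, i1, p1; split=> //; exists YP, fP, gP.
  + move=> Q i [YP [fP [gP /LL_projective[[PA PB] _ ret _]]]].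
    apply: ext1z_retractl ret _; apply: ext1z_prodl; first exact: ext1z_proj.
    have [Pr PrP] := projective_resolution (tens (rmod V) (mcoker fP)).
    have Zs : syzseq (@projective A) (rsyz Pr) by exact: rsyz_seq.
    have := (ext1z_balanceD 0 0 i Zs KI).1; rewrite !add0n; apply.
    rewrite K0; apply: Tor_zero_rsyz => // j j1; apply: TorU => //.
    exact: projective_flat.
  + by exists Y, f, g.
Qed.

Lemma DP_class_inj X Y (f : {linear tens (rmod U) X -> Y}) (g : {linear tens (rmod V) Y -> X}) :
  D (LL f g) -> injective f /\ injective g.
Proof.
move=>
      /DP_cosyzygy_quad[XP [YP [fP [gP [X' [Y' [f' [g' [i1 [i2 [p1 [p2 [PP D' [s1 s2] [ig if'] _]]]]]]]]]]]]].
have [_ [fPI gPI] _ _] := LL_projective PP; have [Y'V X'U] := DP_class_ext_charL D'.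
have [tVI _ _] := tmap_ses s2 Y'V; have [tUI _ _] := tmap_ses s1 X'U.
split=> z z' e; [apply: tUI; apply: fPI; rewrite -!if' e|apply: tVI; apply: gPI; rewrite -!ig e];
  by [].
Qed.

(** Inducing flat resolutions of the tensor products shows that the module with
    zero structure maps on a flat pair has finite flat dimension. *)
Lemma DP_class_ext_ZL M (F1 : lmodType A) (F2 : lmodType B) : D M -> flat F1 -> flat F2 ->
  ext1z M (ZL UV0 VU0 F1 F2).
Proof.
move=> DM F1f F2f.
pose K0 : lmodType A := tens (rmod V) F2; pose J0 : lmodType B := tens (rmod U) F1.
have [Pr PrP] := projective_resolution K0; have [Qr QrP] := projective_resolution J0.
have Zs : syzseq (@projective A) (rsyz Pr) by exact: rsyz_seq.
have Zs' : syzseq (@projective B) (rsyz Qr) by exact: rsyz_seq.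
have ZU i : ext1z (rsyz Pr i) (charL (rmod U)).
  by apply: Tor_zero_rsyz => // j j1; apply: TorU.
have ZV i : ext1z (rsyz Qr i) (charL (rmod V)).
  by apply: Tor_zero_rsyz => // j j1; apply: TorV.
have [n1 n1P] := tens_flat_syzygy fdV; have [n2 n2P] := tens_flat_syzygy fdU.
pose n := maxn n1 n2.
have Zn : flat (rsyz Pr n) by apply: (n1P F2 _ n F2f (iso_refl _) Zs); exact: leq_maxl.
have Zn' : flat (rsyz Qr n) by apply: (n2P F1 _ n F1f (iso_refl _) Zs'); exact: leq_maxr.
have ext0 N : D N -> ext1z N (TL UV0 VU0 K0 J0).
  apply: (@ext1z_syzygy_dim _ D (@flat L) (fun i => TL UV0 VU0 (rsyz Pr i) (rsyz Qr i)) n).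
  - by move=> Y /Dcl[[Y' [DY' lk]] _ _]; exists Y'.
  - move=> i; have [P [a [b [PP ab]]]] := Zs i; have [Q [c [d [QP cd]]]] := Zs' i.
    have [u [v uv]] := TL_ses UV0 VU0 ab cd (ZV i) (ZU i).
    exists (TL UV0 VU0 P Q), u, v; split=> //.
    by apply: TL_flat; apply: projective_flat.
  - by move=> Q Y Qf /Dcl[_ _ h]; apply: h.
  - exact: TL_flat.
have [[M' [DM' [P [i [p [PP ip]]]]]] _ extM] := Dcl DM.
have [u [v uv]] := ZL_TL_ses UV0 VU0 F1 F2.
apply: (ext1z_shift ip PP uv); last by apply: extM; apply: TL_flat.
exact: ext1z_retractr (iso_retract (ZL_TL_iso UV0 VU0 F1 F2)) (ext0 _ DM').
Qed.

Lemma DP_class_ext_coker X Y (f : {linear tens (rmod U) X -> Y}) (g : {linear tens (rmod V) Y -> X})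
    (F1 : lmodType A) (F2 : lmodType B) : D (LL f g) -> flat F1 -> flat F2 ->
  ext1z (mcoker g) F1 /\ ext1z (mcoker f) F2.
Proof. by move=> Dfg F1f F2f; apply: ZL_ext_coker (DP_class_ext_ZL Dfg F1f F2f). Qed.

Definition cokers_g (K : lmodType A) : Prop := exists X Y
  (f : {linear tens (rmod U) X -> Y}) (g : {linear tens (rmod V) Y -> X}),
  D (LL f g) /\ isomorphic K (mcoker g).
Definition cokers_f (K : lmodType B) : Prop := exists X Y
  (f : {linear tens (rmod U) X -> Y}) (g : {linear tens (rmod V) Y -> X}),
  D (LL f g) /\ isomorphic K (mcoker f).

Lemma cokers_g_DP : DP_class cokers_g.
Proof.
move=> K [X [Y [f [g [Dfg isoK]]]]]; have [fI gI] := DP_class_inj Dfg; split.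
- have [XP [YP [fP [gP [X' [Y' [f' [g' [i1 [i2 [p1 [p2 [PP D' [s1 s2] [ig _] [pg _]]]]]]]]]]]]]] :=
    DP_syzygy_quad Dfg.
  have [[PA _] _ _ _] := LL_projective PP.
  have [j [r [jr _ _]]] := half_coker_ses s1 s2 gI ig pg.
  exists (mcoker g'); split; first by exists X', Y', f', g'; split=> //; apply: iso_refl.
  by apply: linked_isor (iso_sym isoK) _; exists (mcoker gP), j, r.
- have [XP [YP [fP [gP [X' [Y' [f' [g' [i1 [i2 [p1 [p2 [PP D' [s1 s2] [ig _] [pg _]]]]]]]]]]]]]] :=
    DP_cosyzygy_quad Dfg.
  have [[PA _] _ _ _] := LL_projective PP; have [_ g'I] := DP_class_inj D'.
  have [j [r [jr _ _]]] := half_coker_ses s1 s2 g'I ig pg.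
  exists (mcoker g'); split; first by exists X', Y', f', g'; split=> //; apply: iso_refl.
  by apply: linked_isol isoK _; exists (mcoker gP), j, r.
- move=> F Ff; apply: ext1z_retractl (iso_retract isoK) _.
  by have [] := DP_class_ext_coker Dfg Ff (@flat0 B).
Qed.

Lemma cokers_f_DP : DP_class cokers_f.
Proof.
move=> K [X [Y [f [g [Dfg isoK]]]]]; have [fI gI] := DP_class_inj Dfg; split.
- have [XP [YP [fP [gP [X' [Y' [f' [g' [i1 [i2 [p1 [p2 [PP D' [s1 s2] [_ ig] [_ pg]]]]]]]]]]]]]] :=
    DP_syzygy_quad Dfg.
  have [[_ PA] _ _ _] := LL_projective PP.
  have [j [r [jr _ _]]] := half_coker_ses s2 s1 fI ig pg.
  exists (mcoker f'); split; first by exists X', Y', f', g'; split=> //; apply: iso_refl.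
  by apply: linked_isor (iso_sym isoK) _; exists (mcoker fP), j, r.
- have [XP [YP [fP [gP [X' [Y' [f' [g' [i1 [i2 [p1 [p2 [PP D' [s1 s2] [_ ig] [_ pg]]]]]]]]]]]]]] :=
    DP_cosyzygy_quad Dfg.
  have [[_ PA] _ _ _] := LL_projective PP; have [f'I _] := DP_class_inj D'.
  have [j [r [jr _ _]]] := half_coker_ses s2 s1 f'I ig pg.
  exists (mcoker f'); split; first by exists X', Y', f', g'; split=> //; apply: iso_refl.
  by apply: linked_isol isoK _; exists (mcoker fP), j, r.
- move=> F Ff; apply: ext1z_retractl (iso_retract isoK) _.
  by have [] := DP_class_ext_coker Dfg (@flat0 A) Ff.
Qed.
End Necessary.

Lemma DP_morita (X : lmodType A) (Y : lmodType B)
    (f : {linear tens (rmod U) X -> Y}) (g : {linear tens (rmod V) Y -> X}) :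
  (forall (j : nat) (F1 : lmodType A), (1 <= j)%N -> flat F1 ->
      Tor_zero j (rmod V) (tens (rmod U) F1)) ->
  (forall (j : nat) (F2 : lmodType B), (1 <= j)%N -> flat F2 ->
      Tor_zero j (rmod U) (tens (rmod V) F2)) ->
  fd_finite U -> rfd_finite (rmod U) -> fd_finite V -> rfd_finite (rmod V) ->
  DP (LL f g) <-> [/\ injective f, injective g, DP (mcoker f) & DP (mcoker g)].
Proof.
move=> TorV TorU fdU rfdU fdV rfdV; split=> [/DP_class_of[D [Dcl Diso Dfg]]|[fI gI]]; last exact: DP_of_cokers.
have [fI gI] := DP_class_inj TorV TorU rfdU rfdV Dcl Diso Dfg.
split=> //.
- apply: (DP_of_class (cokers_f_DP TorV TorU fdU rfdU fdV rfdV Dcl Diso)).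
  by exists X, Y, f, g; split=> //; apply: iso_refl.
- apply: (DP_of_class (cokers_g_DP TorV TorU fdU rfdU fdV rfdV Dcl Diso)).
  by exists X, Y, f, g; split=> //; apply: iso_refl.
Qed.
End MoritaDP.

(** * Finitely presented modules, coherence and FP-injectivity *)

Section Finiteness.
Variable R : nzRingType.
Implicit Types K L M N E P : lmodType R.

Lemma rV_universal n M (e : 'I_n -> M) :
  exists h : {linear 'rV[R]_n -> M}, forall x, h x = \sum_i x 0 i *: e i.
Proof.
have hL : linear (fun x : 'rV[R]_n => \sum_i x 0 i *: e i).
  move=> a x y; rewrite scaler_sumr -big_split; apply: eq_bigr => i _ /=.
  by rewrite !mxE scalerDl scalerA.
by exists (mklin hL).
Qed.

Lemma rV_linE n M (h : {linear 'rV[R]_n -> M}) x :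
  h x = \sum_i x 0 i *: h (delta_mx 0 i).
Proof. by rewrite {1}(row_sum_delta x) linear_sum; apply: eq_bigr => i _; rewrite linearZ_LR. Qed.

Lemma rV_projective n : projective ('rV[R]_n : lmodType R).
Proof.
move=> M N p h pS; have [s sE] := choice pS.
have [k kE] := rV_universal (fun i : 'I_n => s (h (delta_mx 0 i))).
exists k => x; rewrite kE linear_sum [RHS]rV_linE; apply: eq_bigr => i _.
by rewrite linearZ_LR sE.
Qed.

Lemma fingenP M : fingen M <-> exists n (p : {linear 'rV[R]_n -> M}), surj p.
Proof.
split=> [[n [e eE]]|[n [p pS]]].
  have [p pE] := rV_universal e; exists n, p => m; have [c ->] := eE m.
  by exists (\row_i c i); rewrite pE; apply: eq_bigr => i _; rewrite mxE.
exists n, (fun i => p (delta_mx 0 i)) => m; have [x <-] := pS m.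
by exists (fun i => x 0 i); rewrite rV_linE.
Qed.

Lemma fingen_surj M N (p : {linear M -> N}) : surj p -> fingen M -> fingen N.
Proof.
move=> pS /fingenP[n [q qS]]; apply/fingenP; exists n, (p \o q) => y.
by have [x <-] := pS y; have [z <-] := qS x; exists z.
Qed.

Lemma fingen_rV n : fingen ('rV[R]_n : lmodType R).
Proof. by apply/fingenP; exists n, idfun => x; exists x. Qed.

Lemma rV_glue m n M (a : {linear 'rV[R]_m -> M}) (b : {linear 'rV[R]_n -> M}) :
  exists c : {linear 'rV[R]_(m + n) -> M}, forall x y, c (row_mx x y) = a x + b y.
Proof.
have cL : linear (fun z : 'rV[R]_(m + n) => a (lsubmx z) + b (rsubmx z)).
  by move=> r x y; rewrite !linearP /= scalerDr addrACA.
by exists (mklin cL) => x y; rewrite /= row_mxKl row_mxKr.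
Qed.

Lemma fingen_ext K E L (i : {linear K -> E}) (p : {linear E -> L}) :
  ses i p -> fingen K -> fingen L -> fingen E.
Proof.
move=> [_ pS ex] /fingenP[m [a aS]] /fingenP[n [b bS]].
have [b' b'E] := rV_projective b pS.
have [c cE] := rV_glue (i \o a) b'.
apply/fingenP; exists (m + n)%N, c => e.
have [y yE] := bS (p e).
have [|k kE] := (ex (e - b' y)).1; first by rewrite linearB b'E yE subrr.
have [x xE] := aS k.
by exists (row_mx x y); rewrite cE /= xE kE subrK.
Qed.

Lemma fingen_pad n m M (p : {linear 'rV[R]_n -> M}) : surj p ->
  exists q : {linear 'rV[R]_(n + m) -> M}, surj q.
Proof.
move=> pS; have [c cE] := rV_glue p (\0 : {linear 'rV[R]_m -> M}).
by exists c => y; have [x <-] := pS y; exists (row_mx x 0); rewrite cE addr0.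
Qed.

Lemma finpres_fingen M : finpres M -> fingen M.
Proof. by move=> [n [p [pS _]]]; apply/fingenP; exists n, p. Qed.

(** Schanuel's argument: comparing E with a finite presentation of L by maps in
    both directions, the kernel is generated by the images of the relations and by
    the differences between generators of E and their images under the two maps. *)
Lemma finpres_ker K E L (i : {linear K -> E}) (p : {linear E -> L}) :
  ses i p -> finpres L -> fingen E -> fingen K.
Proof.
move=> ip [n [q [qS /fingenP[k [u uS]]]]] /fingenP[m [e eS]].
have [iI pS ex] := ip.
have [phi phiE] := rV_projective q pS.
have [al alE] := rV_projective (p \o e) qS.
have [|psi psiE] := ses_lift (h := phi \o kin q) ip.
  by move=> x; rewrite /= phiE -[LHS]/(q (kin q x)); apply/kinP; exists x.
have [|be beE] := ses_lift (h := e \- (phi \o al)) ip.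
  by move=> x; rewrite /= linearB phiE alE subrr.
have [c cE] := rV_glue (psi \o u) be.
apply/fingenP; exists (k + m)%N, c => kap.
have [x xE] := eS (i kap).
have [|y yE] := (kinP q (al x)).1; first by rewrite alE /= xE (ses0 _ ip).
have [z zE] := uS y.
exists (row_mx z x); apply: iI; rewrite cE linearD /= zE psiE beE /=.
by rewrite -[mker_val y]/(kin q y) yE addrC subrK xE.
Qed.

Lemma finpres_quot K E L (i : {linear K -> E}) (p : {linear E -> L}) :
  ses i p -> finpres E -> fingen K -> finpres L.
Proof.
move=> ip [n [q [qS qk]]] Kf; have [iI pS ex] := ip; exists n, (p \o q); split.
  by move=> y; have [e <-] := pS y; have [x <-] := qS e; exists x.
have [|r rE] := ses_lift (h := q \o kin (p \o q)) ip.
  by move=> x; apply/(kinP (p \o q)); exists x.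
have rS : surj r.
  move=> k; have [x xE] := qS (i k).
  have [|y yE] := (kinP (p \o q) x).1; first by rewrite /= xE (ses0 _ ip).
  by exists y; apply: iI; rewrite rE -[LHS]/(q (kin _ y)) yE.
apply: fingen_ext (ses_kin rS) _ Kf.
have [|t tE] := ses_lift (i := kin q) (p := q) (h := kin (p \o q) \o kin r) (ses_kin qS).
  move=> x; rewrite -[LHS]/((q \o kin (p \o q)) (kin r x)) -rE.
  have -> : r (kin r x) = 0 by apply/kinP; exists x.
  exact: linear0.
have tI : injective t.
  move=> x y e; do 2!apply: kin_inj.
  by have := tE x; rewrite e tE.
have tS : surj t.
  move=> x; have qx : q (kin q x) = 0 by apply/kinP; exists x.
  have [|y yE] := (kinP (p \o q) (kin q x)).1; first by rewrite /= qx linear0.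
  have [|z zE] := (kinP r y).1.
    by apply: iI; rewrite rE linear0 -[LHS]/(q (kin _ y)) yE.
  by exists z; apply: kin_inj; rewrite tE -[LHS]/(kin _ (kin r z)) zE yE.
have [u [v [tK uK]]] := (isoP _ _).1 (iso_bij tI tS).
by apply: (fingen_surj (p := v)) qk => x; exists (u x).
Qed.

Lemma finpres_iso M N : isomorphic M N -> finpres M -> finpres N.
Proof.
move=> /isoP[f [g [fK gK]]] Mf.
exact: finpres_quot (ses_can fK gK) Mf (fingen_rV 0).
Qed.

Lemma finpres_rV n : finpres ('rV[R]_n : lmodType R).
Proof.
exists n, idfun; split=> [x|]; first by exists x.
apply/fingenP; exists 0%N, \0 => x; exists 0; apply: kin_inj.
have : (idfun : {linear 'rV[R]_n -> 'rV[R]_n}) (kin _ x) = 0 by apply/kinP; exists x.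
by move=> e; rewrite linear0; symmetry; exact: e.
Qed.

Lemma finpres_ext K E L (i : {linear K -> E}) (p : {linear E -> L}) :
  ses i p -> finpres K -> finpres L -> finpres E.
Proof.
move=> ip [m [a [aS ak]]] [n [b [bS bk]]]; have [iI pS ex] := ip.
have [b' b'E] := rV_projective b pS.
(* First the product of K with a free module, then E as a quotient of it. *)
pose F := (K * 'rV[R]_n)%type.
have Ff : finpres (F : lmodType R).
  have cL : linear (fun z : 'rV[R]_(m + n) => (a (lsubmx z), rsubmx z) : F).
    by move=> r x y; rewrite [RHS]surjective_pairing /= !linearP.
  exists (m + n)%N, (mklin cL); split.
    by move=> [k y]; have [x <-] := aS k; exists (row_mx x y); rewrite /= row_mxKl row_mxKr.
  have rowL : linear (fun x : mker a => row_mx (kin a x) 0 : 'rV[R]_(m + n)).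
    move=> r x y; apply/rowP => j; rewrite !mxE; case: split => j'; rewrite !mxE //.
    by rewrite mulr0 addr0.
  have [x|d dE] := ker_lift (f := mklin cL) (h := mklin rowL).
    rewrite /= row_mxKl row_mxKr; congr pair; exact: kin0.
  apply: (fingen_surj (p := d)) ak => z.
  have e := kin0 (f := mklin cL) z; have e1 : a (lsubmx (kin _ z)) = 0 := congr1 fst e.
  have e2 : rsubmx (kin (mklin cL) z) = 0 := congr1 snd e.
  have [x xE] := (kinP a _).1 e1.
  exists x; apply: kin_inj; rewrite dE.
  by rewrite -[RHS]hsubmxK e2 -xE.
pose th : {linear F -> E} := (i \o fst) \+ (b' \o snd).
have thS : surj th.
  move=> e; have [y yE] := bS (p e).
  have [|k kE] := (ex (e - b' y)).1; first by rewrite linearB b'E yE subrr.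
  by exists (k, y); rewrite /th /= kE subrK.
apply: finpres_quot (ses_kin thS) Ff _.
have [|d dE] := ses_lift (i := kin b) (p := b) (h := snd \o kin th) (ses_kin bS).
  move=> x; have : th (kin th x) = 0 by apply/kinP; exists x.
  move/(congr1 p); rewrite linear0 /th /= linearD (ses0 _ ip) add0r b'E //.
have dI : injective d.
  apply: lin_inj => x dx; apply: kin_inj; rewrite linear0.
  have x2 : (kin th x).2 = 0 by rewrite -[LHS]/((snd \o kin th) x) -dE dx linear0.
  have : th (kin th x) = 0 by apply/kinP; exists x.
  case kx: (kin th x) x2 => [k y] /= ->; rewrite /th /= linear0 addr0.
  by move/(lin_inj0 iI) ->.
have dS : surj d.
  move=> y; have by0 : b (kin b y) = 0 by apply/kinP; exists y.
  have [|k kE] := (ex (b' (kin b y))).1; first by rewrite b'E.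
  have [|x xE] := (kinP th (- k, kin b y)).1.
    by rewrite /th -[LHS]/(i (- k) + b' (kin b y)) linearN kE addNr.
  by exists x; apply: kin_inj; rewrite dE -[LHS]/((kin th x).2) xE.
have [u [v [uK vK]]] := (isoP _ _).1 (iso_bij dI dS).
by apply: (fingen_surj (p := v)) bk => x; exists (u x).
Qed.

(** For inductions on the rank. *)
Lemma rV_ses n : exists (i : {linear 'rV[R]_n -> 'rV[R]_(1 + n)})
  (p : {linear 'rV[R]_(1 + n) -> R^o}), ses i p.
Proof.
have iL : linear (fun x : 'rV[R]_n => row_mx 0 x : 'rV[R]_(1 + n)).
  move=> r x y; apply/rowP => j; rewrite !mxE; case: split => j'; rewrite !mxE //.
  by rewrite mulr0 addr0.
have pL : linear (fun x : 'rV[R]_(1 + n) => lsubmx x 0 0 : R^o).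
  by move=> r x y; rewrite linearP !mxE.
exists (mklin iL), (mklin pL); split=> [x y /eq_row_mx[]//|a|x].
  by exists (row_mx a%:M 0); rewrite /= row_mxKl mxE mulr1n.
split=> [/= x0|[y <-]]; last by rewrite /= row_mxKl mxE.
exists (rsubmx x); rewrite /= -[RHS]hsubmxK; congr row_mx.
by apply/rowP => j; rewrite [j]ord1 mxE x0.
Qed.

Lemma finpres_regular : finpres (R^o : lmodType R).
Proof.
have [i [p ip]] := rV_ses 0.
exact: finpres_quot ip (finpres_rV _) (fingen_rV 0).
Qed.

Lemma regular_projective : projective (R^o : lmodType R).
Proof.
move=> M N p h pS; have [m mE] := pS (h 1).
have kL : linear (fun r : R^o => (r : R) *: m).
  by move=> a x y; rewrite scalerDl scalerA.
exists (mklin kL) => x; rewrite /= linearZ_LR mE -linearZ_LR; congr (h _).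
exact: mulr1.
Qed.

(** ** Coherent rings *)

(** Coherence in terms of relations between elements, the form in which it passes
    to corners of a ring. *)
Definition relfg : Prop :=
  forall n (phi : {linear 'rV[R]_n -> R^o}), fingen (mker phi).

Lemma coherent_relfg : coherent R -> relfg.
Proof.
move=> coh n phi; have [q [qS qE]] := mim_onto phi.
have qf : finpres (mim phi).
  apply: (coh _ (iin phi)) => //; first exact: iin_inj.
  by apply: (fingen_surj qS); apply: fingen_rV.
have [|d dE] := ker_lift (f := phi) (h := kin q).
  by move=> x; rewrite -qE kin0 linear0.
apply: (fingen_surj (p := d)) (finpres_ker (ses_kin qS) qf (fingen_rV n)) => y.
have [|x xE] := (kinP q (kin phi y)).1; first by apply: iin_inj; rewrite qE kin0 linear0.
by exists x; apply: kin_inj; rewrite dE.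
Qed.

(** Relations between vectors are found one coordinate at a time. *)
Lemma relfg_rV : relfg -> forall p n (phi : {linear 'rV[R]_n -> 'rV[R]_p}),
  fingen (mker phi).
Proof.
move=> rel; elim=> [|p IHp] n phi.
  have [|d dE] := ker_lift (f := phi) (h := idfun); first by move=> x; apply/matrixP => i [].
  apply: (fingen_surj (p := d)) (fingen_rV n) => y.
  by exists (kin phi y); apply: kin_inj; rewrite dE.
have [i [c ic]] := rV_ses p; have [iI _ ex] := ic.
have /fingenP[m [u uS]] := rel n (c \o (phi : {linear 'rV[R]_n -> 'rV[R]_(1 + p)})).
have [|psi psiE] := ses_lift (h := phi \o kin (c \o phi) \o u) ic.
  by move=> x; apply: (kin0 (u x)).
have [|d dE] := ker_lift (f := phi) (h := kin (c \o phi) \o u \o kin psi).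
  move=> x; rewrite -[LHS]/((phi \o kin (c \o phi) \o u) (kin psi x)) -psiE kin0.
  exact: linear0.
apply: (fingen_surj (p := d)) (IHp m psi) => y.
have [|z zE] := (kinP (c \o phi) (kin phi y)).1.
  by rewrite -[LHS]/(c (phi (kin phi y))) kin0 linear0.
have [w wE] := uS z.
have [|x xE] := (kinP psi w).1.
  apply: iI; rewrite psiE linear0 -[LHS]/(phi (kin _ (u w))) wE zE; exact: kin0.
exists x; apply: kin_inj; rewrite dE -[LHS]/(kin _ (u (kin psi x))) xE wE; exact: zE.
Qed.

(** The relations of L are generated by finitely many vectors, and the relations
    between these are finitely generated. *)
Lemma relfg_syzygy L : relfg -> finpres L ->
  exists L', finpres L' /\ linked (@projective R) L' L.
Proof.
move=> rel Lf; have [n [q [qS /fingenP[m [u uS]]]]] := Lf.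
exists (mker q); split; last first.
  exists ('rV[R]_n : lmodType R), (kin q), q; split; last exact: ses_kin.
  exact: rV_projective.
exists m, u; split=> //.
have [|d dE] := ker_lift (f := u) (h := kin (kin q \o u)).
  by move=> x; apply: kin_inj; rewrite linear0; exact: (kin0 (f := kin q \o u) x).
apply: (fingen_surj (p := d)) (relfg_rV rel (kin q \o u)) => y.
have [|x xE] := (kinP (kin q \o u) (kin u y)).1.
  by rewrite -[LHS]/(kin q (u (kin u y))) kin0 linear0.
by exists x; apply: kin_inj; rewrite dE.
Qed.

(** ** FP-injective modules *)

Lemma Ext_zero_ext1z M N (P : resolution M) k : (forall i, projective (P i)) ->
  Ext_zero k.+1 M N -> ext1z (rsyz P k) N.
Proof.
move=> PP MN; have [q [qs qE]] := rsyz_out P k.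
apply: (ext1z_pres qs) => // h.
have [q' [q's q'E]] := rsyz_out P k.+1; have [_ q'S _] := q's.
have [|g gE] := MN P PP (h \o q').
  move=> x /=; suff -> : q' (rdiff P k.+1 x) = 0 by rewrite linear0.
  by apply: (@iin_inj _ _ _ (rdiff P k)); rewrite linear0 [LHS]q'E rexact; exists x.
exists g => y; have [x <-] := q'S y.
rewrite -[RHS]/((h \o q') x) -gE; congr (g _); exact: q'E.
Qed.

Lemma FP_injectiveP E : FP_injective E <-> forall L, finpres L -> ext1z L E.
Proof.
split=> [Ef L Lf|ext L Lf P PP h hd].
  have [P PP] := projective_resolution L.
  exact: (Ext_zero_ext1z (k := 0) PP (Ef L Lf)).
have [q [qs qE]] := rsyz_out P 0; have [q' [q's q'E]] := rsyz_out P 1.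
have [|h' h'E] := ses_desc (h := h) q's.
  move=> y; have [x] := (iinP (rdiff P 1) (rsyz_in P 1 y)).1 (ex_intro _ y erefl).
  by move=> <-; apply: hd.
have [g gE] := ext _ Lf _ _ _ _ qs h'.
by exists g => x; rewrite -q'E gE h'E.
Qed.

Lemma injmod_FP_injective (I : lmodType R) : injmod I -> FP_injective I.
Proof. by move=> Ii; apply/FP_injectiveP => L _; apply: ext1z_inj. Qed.
End Finiteness.

(** ** Coherence passes from the matrix ring to its corners *)

(** A finite relation between elements of M becomes, through the additive
    embedding eta, a relation between elements of S; finitely many of those
    suffice, and they are brought back by alpha. *)
Lemma relfg_transfer (S R : nzRingType) (M : lmodType R) (iota : R -> S) (alpha : S -> R)
    (eta : M -> S) (theta : S -> M) :
    relfg S -> {morph eta : x y / x + y} -> {morph theta : x y / x + y} ->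
    {morph alpha : x y / x + y} -> {morph alpha : x y / x * y} -> cancel iota alpha ->
    (forall a m, eta (a *: m) = iota a * eta m) ->
    (forall l m, theta (l * eta m) = alpha l *: m) ->
  forall n (phi : {linear 'rV[R]_n -> M}), fingen (mker phi).
Proof.
move=> rel etaD thetaD alD alM ioK etaZ thetaM n phi.
have eta_sum I (r : seq I) (F : I -> M) : eta (\sum_(i <- r) F i) = \sum_(i <- r) eta (F i).
  exact: (big_morph eta etaD (morph_add0 etaD)).
have theta_sum I (r : seq I) (F : I -> S) :
    theta (\sum_(i <- r) F i) = \sum_(i <- r) theta (F i).
  exact: (big_morph theta thetaD (morph_add0 thetaD)).
have al_sum I (r : seq I) (F : I -> S) :
    alpha (\sum_(i <- r) F i) = \sum_(i <- r) alpha (F i).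
  exact: (big_morph alpha alD (morph_add0 alD)).
have [Phi PhiE] := rV_universal (fun i : 'I_n => eta (phi (delta_mx 0 i)) : S^o).
have /fingenP[k [u uS]] := rel n Phi.
pose w j := \row_i alpha (kin Phi (u (delta_mx 0 j)) 0 i).
have wK j : phi (w j) = 0.
  have := kin0 (f := Phi) (u (delta_mx 0 j)).
  rewrite PhiE => /(congr1 theta); rewrite theta_sum (morph_add0 thetaD) => e.
  rewrite rV_linE -[RHS]e; apply: eq_bigr => i _; rewrite mxE; symmetry; exact: thetaM.
have [om omE] := rV_universal w.
have [|om' om'E] := ker_lift (f := phi) (h := om).
  by move=> x; rewrite omE linear_sum big1 // => j _; rewrite linearZ_LR wK scaler0.
apply/fingenP; exists k, om' => y.
pose Y := \row_i iota (kin phi y 0 i).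
have [|z zE] := (kinP Phi Y).1.
  rewrite PhiE -[RHS](morph_add0 etaD) -(kin0 (f := phi) y) [in RHS]rV_linE eta_sum.
  by apply: eq_bigr => i _; rewrite mxE etaZ.
have [c cE] := uS z.
exists (\row_j alpha (c 0 j)); apply: kin_inj; rewrite om'E omE; apply/rowP => i.
have -> : kin phi y 0 i = alpha (Y 0 i) by rewrite mxE ioK.
rewrite -zE -cE -[kin Phi (u c)]/((kin Phi \o u) c) (rV_linE (kin Phi \o u)) !summxE al_sum.
by apply: eq_bigr => j _; rewrite !mxE alM.
Qed.

Section Corners.
Variables (A B : nzRingType) (V : bimod A B) (U : bimod B A).
Local Notation Lc := ((Lambda00 V U)^c).

Lemma relfg_cornerA : relfg Lc -> relfg A^c.
Proof.
move=> rel n phi.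
apply: (@relfg_transfer Lc A^c (A^c)^o (@lAc A B V U) (@La A B V U)
  (@lAc A B V U) (@La A B V U) rel) => //; first exact: lAc_D.
by move=> a m; rewrite [RHS]LmkMc ?Lcsimp.
Qed.

Lemma relfg_cornerB : relfg Lc -> relfg B^c.
Proof.
move=> rel n phi.
apply: (@relfg_transfer Lc B^c (B^c)^o (@lBc A B V U) (@Lb A B V U)
  (@lBc A B V U) (@Lb A B V U) rel) => //; first exact: lBc_D.
by move=> a m; rewrite [RHS]LmkMc ?Lcsimp.
Qed.

Lemma finpres_cornerU : relfg Lc -> fingen (rmod U) -> finpres (rmod U).
Proof.
move=> rel /fingenP[n [p pS]]; exists n, p; split=> //.
apply: (@relfg_transfer Lc A^c (rmod U) (@lAc A B V U) (@La A B V U)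
  (@lUc A B V U) (@Lu A B V U) rel) => //.
- by move=> x y; rewrite LmkDc ?Lcsimp.
- by move=> a m; rewrite [RHS]LmkMc ?Lcsimp.
- by move=> [[a v] [u b]] m; rewrite LmkMc ?Lcsimp.
Qed.

Lemma finpres_cornerV : relfg Lc -> fingen (rmod V) -> finpres (rmod V).
Proof.
move=> rel /fingenP[n [p pS]]; exists n, p; split=> //.
apply: (@relfg_transfer Lc B^c (rmod V) (@lBc A B V U) (@Lb A B V U)
  (@lVc A B V U) (@Lv A B V U) rel) => //.
- by move=> x y; rewrite LmkDc ?Lcsimp.
- by move=> a m; rewrite [RHS]LmkMc ?Lcsimp.
- by move=> [[a v] [u b]] m; rewrite LmkMc ?Lcsimp.
Qed.
End Corners.

(** * Homomorphisms from a bimodule into FP-injective modules *)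

Section HomFP.
Variables (R S : nzRingType) (U : bimod R S).

Lemma tensr_unit : isomorphic (R := S^c) (rmod U) (tensr U (R^c)^o).
Proof.
have [Dl Dr Z] := tpure_balanced (R := R) (R^c)^o U.
have fL : linear (fun u : rmod U => tpure (1 : (R^c)^o) (u : U) : tensr U (R^c)^o).
  move=> s u u'; rewrite rmod_scaleE Dr; congr (_ + _).
  by symmetry; exact: tensr_scaleE.
pose f := mklin fL; pose b (r : (R^c)^o) (u : U) : rmod U := (r : R) *: u.
have bb : balanced b.
  split=> [r r' u|r u u'|r r' u]; rewrite /b ?scalerDl ?scalerDr //.
  by rewrite scalerA.
pose g : tens (R := R) (R^c)^o U -> rmod U := tens_lift b.
have gf x : g (f x) = x by rewrite /g [LHS]tens_liftE // /b scale1r.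
exists f; exists g => // z; move: z; apply: tens_ext => [x y|x y|r u] //.
- by rewrite /g tens_liftD // linearD.
- rewrite /g tens_liftE // -[LHS]/(tpure (1 : (R^c)^o) ((r : R) *: (u : U))) -Z.
  by congr tpure; exact: (mulr1 (r : R^c)).
Qed.

Lemma finpres_tensr_rV n : finpres (rmod U) -> finpres (R := S^c) (tensr U 'rV[R^c]_n).
Proof.
move=> Uf; elim: n => [|n IHn].
  apply: (finpres_iso _ (finpres_rV _ 0)).
  apply: (iso_bij (f := \0 : {linear 'rV[S^c]_0 -> tensr U 'rV[R^c]_0})) => [x y _|z].
    by apply/matrixP => i [].
  exists 0; rewrite linear0; symmetry; move: z.
  apply: tens_ind => // m u x ->; rewrite addr0.
  have -> : m = 0 by apply/matrixP => i [].
  by rewrite balanced0l //; exact: tpure_balanced.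
have [i [p ip]] := rV_ses R^c n; have [iI pS _] := ip.
have [s sE] := regular_projective (idfun : {linear (R^c)^o -> (R^c)^o}) pS.
have [|r rE] := ses_lift (h := idfun \- (s \o p)) ip.
  by move=> x; rewrite /= linearB sE subrr.
have dec z : tensr_map U i (tensr_map U r z) + tensr_map U s (tensr_map U p z) = z.
  move: z; apply: tens_ext => [x y|x y|x u] //.
    by rewrite !linearD addrACA.
  rewrite -[tensr_map U r _]/(tens_map _ _ _) tens_mapE.
  rewrite -[tensr_map U p _]/(tens_map _ _ _) tens_mapE.
  rewrite -[tensr_map U i _]/(tens_map _ _ _) tens_mapE.
  rewrite -[tensr_map U s _]/(tens_map _ _ _) tens_mapE rE.
  have [Dl _ _] := tpure_balanced (R := R) ('rV[R^c]_(1 + n)) U.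
  by rewrite -[LHS]Dl /= subrK.
have ti z : tensr_map U r (tensr_map U i z) = z.
  move: z; apply: tens_ext => [x y|x y|x u] //; first by rewrite !linearD.
  rewrite -[tensr_map U i _]/(tens_map _ _ _) tens_mapE.
  rewrite -[tensr_map U r _]/(tens_map _ _ _) tens_mapE.
  by congr tpure; apply: iI; rewrite rE /= (ses0 _ ip) linear0 subr0.
have pi0 z : tensr_map U p (tensr_map U i z) = 0.
  have := dec (tensr_map U i z); rewrite ti => /(canRL (addKr _)); rewrite addNr.
  move/(congr1 (tensr_map U p)); rewrite linear0 => <-.
  move: (tensr_map U p _); apply: tens_ext => [x y|x y|x u] //; first by rewrite !linearD.
  rewrite -[tensr_map U s _]/(tens_map _ _ _) tens_mapE.
  by rewrite -[RHS]/(tens_map _ _ _) tens_mapE sE.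
have tip : ses (tensr_map U i) (tensr_map U p).
  split=> [||z]; first exact: can_inj ti.
    by apply: tens_map_surj => // x; exists x.
  split=> [z0|[y <-]]; last exact: pi0.
  by exists (tensr_map U r z); rewrite -[RHS]dec z0 linear0 addr0.
exact: finpres_ext tip IHn (finpres_iso tensr_unit Uf).
Qed.

Lemma fingen_tensr (L : lmodType R^c) : finpres (rmod U) -> fingen L -> fingen (R := S^c) (tensr U L).
Proof.
move=> Uf /fingenP[n [p pS]].
apply: (fingen_surj (p := tensr_map U p)).
  by apply: tens_map_surj => // x; exists x.
exact/finpres_fingen/finpres_tensr_rV.
Qed.

Lemma ext1z_homr_FP (L : lmodType R^c) (E : lmodType S^c) :
    finpres (rmod U) -> finpres L -> ext1z L (charR U) -> FP_injective E ->
  ext1z L (homr U E).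
Proof.
move=> Uf [n [p [pS pk]]] LU /FP_injectiveP EF.
apply: (ext1z_pres (ses_kin pS) (@rV_projective _ _)) => h.
have iI : injective (tensr_map U (kin p)) := ext1z_tensR (ses_kin pS) LU.
apply: homr_extend => k.
have Cf := finpres_quot (ses_cpi iI) (finpres_tensr_rV n Uf) (fingen_tensr Uf pk).
exact: (EF _ Cf _ _ _ _ (ses_cpi iI) k).
Qed.

(** Dimension shifting turns the vanishing of Ext on high syzygies of finitely
    presented modules into FP-injectivity of high cosyzygies. *)
Lemma homr_FP_cosyzygy : relfg R^c -> finpres (rmod U) -> fd_finite U ->
  exists n, forall (E : lmodType S^c) (C : nat -> lmodType R^c) m, FP_injective E ->
    C 0 = homr U E -> cosyzseq (@injmod R^c) C -> (n <= m)%N -> FP_injective (C m).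
Proof.
move=> rel Uf /fd_syzygy[n Un]; exists n => E C m EF C0 Cs nm; apply/FP_injectiveP => L Lf.
have [Z [<- Zs Zf]] := syzseq_exists Lf (fun L => relfg_syzygy rel (L := L)).
apply: ((ext1z_balanceD 0 0 m Zs Cs).1); rewrite C0.
exact: ext1z_homr_FP Uf (Zf m) (Un _ _ Zs nm) EF.
Qed.

Lemma DI_ext_homr (C : lmodType R^c -> Prop) L (E : lmodType S^c) :
  DI_class C -> C L -> relfg R^c -> finpres (rmod U) -> fd_finite U -> FP_injective E ->
  ext1z (R := R^c) (homr U E) L.
Proof.
move=> CI CL rel Uf Ud EF; have [n Un] := homr_FP_cosyzygy rel Uf Ud.
have [K K0 Ks] := injective_cosyzseq (R := R^c) (homr U E).
rewrite -K0; apply: (ext1z_cosyzygy_dim (S := C) (T := @FP_injective R^c) (n := n)) => //.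
- by move=> Y /CI[_ [Y' [CY' lk]] _]; exists Y'.
- by move=> i; apply: linked_sub (Ks i) => I; apply: injmod_FP_injective.
- by move=> Q Y QF /CI[_ _]; apply.
- exact: Un EF K0 Ks _.
Qed.
End HomFP.

Section FiniteProjectiveDimension.
Variables (R : nzRingType) (M : lmodType R).

(** Within a class [S] closed under syzygies Ext^1(M, N) is an Ext^1 of any syzygy
    of M with values in [S], hence zero once this syzygy is projective. *)
Lemma pd_ext1z (S T : lmodType R -> Prop) N : pd_finite M -> S N ->
    (forall Y, S Y -> exists2 Y', S Y' & linked T Y' Y) ->
    (forall Z Q i, Z 0 = M -> syzseq (@projective R) Z -> T Q -> ext1z (Z i) Q) ->
  ext1z M N.
Proof.
move=> /(finite_dimP (@proj_iso R))[Z [n [Z0 Zs Zn]]] SN SS ZT.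
rewrite -Z0; apply: (ext1z_resolution SS Zs Zn _ SN) => Q i; exact: ZT.
Qed.

Lemma Ext_zero_cosyzygy (K : nat -> lmodType R) i :
    (forall j, (1 <= j)%N -> Ext_zero j M (K 0)) -> cosyzseq (@injmod R) K -> ext1z M (K i).
Proof.
move=> MK Ks; have [P PP] := projective_resolution M.
apply: ((ext1z_balanceD 0 0 i (rsyz_seq PP) Ks).1).
by apply: Ext_zero_ext1z => //; apply: MK.
Qed.

Lemma Ext_zero_syzygy N (Z : nat -> lmodType R) i :
    (forall j, (1 <= j)%N -> Ext_zero j M N) -> Z 0 = M -> syzseq (@projective R) Z ->
  ext1z (Z i) N.
Proof.
move=> MN Z0 Zs; have [K K0 Ks] := injective_cosyzseq N.
rewrite -K0; apply: ((ext1z_balanceD 0 0 i Zs Ks).2); rewrite Z0.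
by apply: Ext_zero_cosyzygy => //; rewrite K0.
Qed.

End FiniteProjectiveDimension.

(** * Finitely presented and FP-injective modules over the matrix ring *)

Section LambdaFinite.
Variables (A B : nzRingType) (V : bimod A B) (U : bimod B A).
Variables (UV0 : tens_zero (rmod U) V) (VU0 : tens_zero (rmod V) U).
Local Notation L := (Lambda00 V U).

(** The ideal U + V of the matrix ring with its quotient A + B. Testing modules on
    this inclusion detects the structure maps s and t. *)
Lemma regularR_ses :
  exists (j : {linear ZR UV0 VU0 (rmod U) (rmod V) -> (L^c)^o})
    (q : {linear (L^c)^o -> ZR UV0 VU0 (A^c)^o (B^c)^o}),
  ses j q /\ forall m, j m = Lmk 0 m.2 m.1 0.
Proof.
have jL : linear ((fun m : ZR UV0 VU0 (rmod U) (rmod V) => Lmk 0 m.2 m.1 0)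
    : ZR UV0 VU0 (rmod U) (rmod V) -> (L^c)^o).
  move=> l [u v] [u' v']; rewrite [_ *: _]RRZ RRD.
  have e : l *: (Lmk 0 v u 0 : (L^c)^o) = (Lmk 0 v u 0 : L) * (l : L) by [].
  rewrite [X in _ = X + _]e; case: l {e} => [[a w] [x b]].
  rewrite (LmkM 0 v u 0 a w x b) [RHS](LmkD _ _ _ _ 0 v' u' 0).
  by rewrite !mul0r !scale0r !addr0 !add0r.
have qL : linear ((fun m : (L^c)^o => (La m, Lb m))
    : (L^c)^o -> ZR UV0 VU0 (A^c)^o (B^c)^o).
  by move=> l m m'; rewrite RRZ RRD /= addr0 add0r.
exists (mklin jL), (mklin qL); split=> //; split.
- move=> [u v] [u' v'] e; congr pair.
  + exact: (congr1 (@Lu _ _ V U) e).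
  + exact: (congr1 (@Lv _ _ V U) e).
- by move=> [a b]; exists ((((a : A), (0 : V)), ((0 : U), (b : B))) : L).
- move=> [[a v] [u b]]; split=> [e|[y <-]] //; exists ((u, v) : ZR UV0 VU0 (rmod U) (rmod V)).
  have a0 : a = 0 := congr1 fst e; have b0 : b = 0 := congr1 snd e.
  by rewrite a0 b0.
Qed.

Local Notation Lc := ((Lambda00 V U)^c).
Local Notation RR s t := (RRm UV0 VU0 s t).
Local Notation ZR K J := (ZR UV0 VU0 K J).
Local Notation HR K J := (HR UV0 VU0 K J).

Lemma fingen_common (K : lmodType A^c) (J : lmodType B^c) : fingen K -> fingen J ->
  exists n (p : {linear 'rV[A^c]_n -> K}) (q : {linear 'rV[B^c]_n -> J}), surj p /\ surj q.
Proof.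
move=> /fingenP[m [p pS]] /fingenP[n [q qS]].
have [p' p'S] := fingen_pad n pS; have [q' q'S] := fingen_pad m qS.
by exists (m + n)%N, p'; move: q' q'S; rewrite addnC => q' q'S; exists q'.
Qed.

Lemma ZR_fingen (K : lmodType A^c) (J : lmodType B^c) :
  fingen K -> fingen J -> fingen (ZR K J).
Proof.
move=> Kf Jf; have [n [p [q [pS qS]]]] := fingen_common Kf Jf.
have [h hE] := rV_universal
  (fun i : 'I_n => (p (delta_mx 0 i), q (delta_mx 0 i)) : ZR K J).
apply/fingenP; exists n, h => -[x y]; have [a <-] := pS x; have [b <-] := qS y.
exists (\row_i (Lmk (a 0 i : A) 0 0 (b 0 i : B) : Lc)); rewrite hE.
have sumE (F : 'I_n -> ZR K J) (r : seq 'I_n) :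
    \sum_(i <- r) F i = (\sum_(i <- r) (F i).1, \sum_(i <- r) (F i).2) :> ZR K J.
  by elim: r => [|i r IHr]; rewrite ?big_nil // !big_cons IHr; case: (F i).
rewrite sumE [p a]rV_linE [q b]rV_linE; congr pair; apply: eq_bigr => i _; rewrite mxE RRZ /=.
  by rewrite addr0.
by rewrite add0r.
Qed.

Lemma ZR_regular_finpres : fingen (rmod U) -> fingen (rmod V) ->
  finpres (ZR (A^c)^o (B^c)^o).
Proof.
move=> Uf Vf; have [j [q [jq _]]] := regularR_ses.
exact: finpres_quot jq (finpres_regular _) (ZR_fingen Uf Vf).
Qed.

Lemma ZR_rV_finpres n : fingen (rmod U) -> fingen (rmod V) ->
  finpres (ZR 'rV[A^c]_n 'rV[B^c]_n).
Proof.
move=> Uf Vf; elim: n => [|n IHn].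
  apply: (finpres_iso _ (finpres_rV Lc 0)).
  apply: (iso_bij (f := \0 : {linear 'rV[Lc]_0 -> ZR 'rV[A^c]_0 'rV[B^c]_0})).
    by move=> x y _; apply/matrixP => i [].
  by move=> [x y]; exists 0; congr pair; apply/matrixP => i [].
have [i [p ip]] := rV_ses A^c n; have [j [q jq]] := rV_ses B^c n.
have [a [b [ab _ _]]] := ZR_ses UV0 VU0 ip jq.
exact: finpres_ext ab IHn (ZR_regular_finpres Uf Vf).
Qed.

Lemma ZR_finpres (K : lmodType A^c) (J : lmodType B^c) :
  fingen (rmod U) -> fingen (rmod V) -> finpres K -> finpres J -> finpres (ZR K J).
Proof.
move=> Uf Vf Kf Jf.
have [n [p [q [pS qS]]]] := fingen_common (finpres_fingen Kf) (finpres_fingen Jf).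
have [a [b [ab _ _]]] := ZR_ses UV0 VU0 (ses_kin pS) (ses_kin qS).
apply: finpres_quot ab (ZR_rV_finpres n Uf Vf) (ZR_fingen _ _).
  exact: finpres_ker (ses_kin pS) Kf (fingen_rV _ n).
exact: finpres_ker (ses_kin qS) Jf (fingen_rV _ n).
Qed.

(** The components of the regular module are extensions of A by U and of B by V. *)
Lemma quadR_finpres_rV n (W : lmodType A^c) (N : lmodType B^c)
    (s : {linear N -> homr U W}) (t : {linear W -> homr V N}) :
  finpres (rmod U) -> finpres (rmod V) -> isomorphic 'rV[Lc]_n (RR s t) ->
  finpres W /\ finpres N.
Proof.
move=> Uf Vf; elim: n W N s t => [|n IHn] W N s t isoM.
  have [f [g [fK gK]]] := (isoP _ _).1 isoM.
  have z (m : RR s t) : m = 0.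
    have g0 : g m = 0 by apply/matrixP => i [].
    by rewrite -[m]gK g0 linear0.
  split; apply: (finpres_iso _ (finpres_rV _ 0)).
    apply: (iso_bij (f := \0 : {linear 'rV[A^c]_0 -> W})) => [x y _|w].
      by apply/matrixP => i [].
    by exists 0; symmetry; exact: (congr1 fst (z (w, 0))).
  apply: (iso_bij (f := \0 : {linear 'rV[B^c]_0 -> N})) => [x y _|w].
    by apply/matrixP => i [].
  by exists 0; symmetry; exact: (congr1 snd (z (0, w))).
have [i [p ip]] := rV_ses Lc n; have [j [q [jq _]]] := regularR_ses.
have [W1 [N1 [s1 [t1 iso1]]]] := quadR UV0 VU0 'rV[Lc]_n.
have [W2 [N2 [s2 [t2 iso2]]]] := quadR UV0 VU0 (Lc^o).
have [_ [_ [i1 [i2 [p1 [p2 [[_ [ip1 ip2]] _ _ _ _]]]]]]] := quadR_ses iso1 isoM iso2 ip.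
have [_ [_ [j1 [j2 [q1 [q2 [[_ [jq1 jq2]] _ _ _ _]]]]]]] :=
  quadR_ses (iso_refl _) iso2 (iso_refl _) jq.
have [W1f N1f] := IHn _ _ _ _ iso1.
split.
  exact: finpres_ext ip1 W1f (finpres_ext jq1 Uf (finpres_regular _)).
exact: finpres_ext ip2 N1f (finpres_ext jq2 Vf (finpres_regular _)).
Qed.

Lemma quadR_finpres (W : lmodType A^c) (N : lmodType B^c)
    (s : {linear N -> homr U W}) (t : {linear W -> homr V N}) :
  finpres (rmod U) -> finpres (rmod V) -> finpres (RR s t) -> finpres W /\ finpres N.
Proof.
move=> Uf Vf [n [p [pS /fingenP[m [u uS]]]]].
have [W1 [N1 [s1 [t1 iso1]]]] := quadR UV0 VU0 'rV[Lc]_n.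
have [W2 [N2 [s2 [t2 iso2]]]] := quadR UV0 VU0 (mker p).
have [W3 [N3 [s3 [t3 iso3]]]] := quadR UV0 VU0 'rV[Lc]_m.
have [W4 [N4 [s4 [t4 iso4]]]] := quadR UV0 VU0 (mker u).
have [_ [_ [i1 [i2 [p1 [p2 [[_ [ip1 ip2]] _ _ _ _]]]]]]] :=
  quadR_ses iso2 iso1 (iso_refl _) (ses_kin pS).
have [_ [_ [j1 [j2 [q1 [q2 [[_ [jq1 jq2]] _ _ _ _]]]]]]] :=
  quadR_ses iso4 iso3 iso2 (ses_kin uS).
have [W1f N1f] := quadR_finpres_rV Uf Vf iso1.
have [W3f N3f] := quadR_finpres_rV Uf Vf iso3.
have [_ q1S _] := jq1; have [_ q2S _] := jq2.
split.
  exact: finpres_quot ip1 W1f (fingen_surj q1S (finpres_fingen W3f)).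
exact: finpres_quot ip2 N1f (fingen_surj q2S (finpres_fingen N3f)).
Qed.

Lemma HR_FP_injective I J : finpres (rmod U) -> finpres (rmod V) ->
  FP_injective I -> FP_injective J -> FP_injective (HR I J).
Proof.
move=> Uf Vf /FP_injectiveP IF /FP_injectiveP JF; apply/FP_injectiveP => M Mf.
have [W [N [s [t isoM]]]] := quadR UV0 VU0 M.
have [Wf Nf] := quadR_finpres Uf Vf (finpres_iso isoM Mf).
by apply: ext1z_retractl (iso_retract isoM) _; apply: HR_ext; [apply: IF|apply: JF].
Qed.

(** Extending maps from the ideal U + V to the whole matrix ring shows that the
    structure maps of an FP-injective module are onto. *)
Lemma RR_FP_injective (W : lmodType A^c) (N : lmodType B^c)
    (s : {linear N -> homr U W}) (t : {linear W -> homr V N}) :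
  fingen (rmod U) -> fingen (rmod V) -> FP_injective (RR s t) ->
  [/\ surj s, surj t, FP_injective (mker s) & FP_injective (mker t)].
Proof.
move=> Uf Vf /FP_injectiveP EF.
have [j [q [jq jE]]] := regularR_ses.
have ext (h : homr U W) (k : homr V N) : exists w n,
    (forall u, s n u = h u) /\ (forall v, t w v = k v).
  have [||l lE] := @RR_mk _ _ _ _ UV0 VU0 _ _ _ _ (\0 : {linear rmod V -> homr U (rmod U)})
    (\0 : {linear rmod U -> homr V (rmod V)}) s t
    (h : {linear rmod U -> W}) (k : {linear rmod V -> N}).
  - move=> u; rewrite -[LHS]/(hmap U t h u) (hom_hom0 UV0 (hmap U t h)).
    by symmetry; exact: linear0.
  - move=> v; rewrite -[LHS]/(hmap V s k v) (hom_hom0 VU0 (hmap V s k)).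
    by symmetry; exact: linear0.
  have [l' l'E] := EF _ (ZR_regular_finpres Uf Vf) _ _ _ _ jq l.
  have l'M x : l' x = (x : Lc) *: l' (1 : Lc).
    by rewrite -linearZ_LR; congr (l' _); symmetry; exact: (mulr1 (x : Lc)).
  case e: (l' (1 : Lc)) => [w n]; exists w, n; split=> [u|v].
    have := l'E (u, 0); rewrite lE jE l'M e RRZ => e0.
    have e1 : (0 : A^c) *: w + s n u = h u := congr1 fst e0.
    by rewrite -e1 scale0r add0r.
  have := l'E (0, v); rewrite lE jE l'M e RRZ => e0.
  have e1 : t w v + (0 : B^c) *: n = k v := congr1 snd e0.
  by rewrite -e1 scale0r addr0.
have [FA FB] : (forall K, finpres K -> ext1z K (mker t)) /\
  (forall J, finpres J -> ext1z J (mker s)).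
  split=> K Kf.
    by have [] := ZR_ext_ker (EF _ (ZR_finpres Uf Vf Kf (finpres_rV _ 0))).
  by have [] := ZR_ext_ker (EF _ (ZR_finpres Uf Vf (finpres_rV _ 0) Kf)).
split; try exact/FP_injectiveP.
- by move=> h; have [w [n [sE _]]] := ext h 0; exists n; apply: homr_ext.
- by move=> h; have [w [n [_ tE]]] := ext 0 h; exists w; apply: homr_ext.
Qed.
End LambdaFinite.

(** * Ding injective modules over the opposite of the Morita context ring *)

Section MoritaDISufficient.
Variables (A B : nzRingType) (V : bimod A B) (U : bimod B A).
Variables (UV0 : tens_zero (rmod U) V) (VU0 : tens_zero (rmod V) U).
Local Notation Lc := ((Lambda00 V U)^c).
Local Notation RR s t := (RRm UV0 VU0 s t).
Local Notation ZR K J := (ZR UV0 VU0 K J).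
Local Notation HR K J := (HR UV0 VU0 K J).
Hypothesis rel : relfg Lc.
Hypotheses (Ufg : fingen (rmod U)) (Vfg : fingen (rmod V)).
Hypotheses (fdU : fd_finite U) (fdV : fd_finite V).
Hypotheses (pdU : pd_finite (rmod U)) (pdV : pd_finite (rmod V)).
Let Ufp : finpres (rmod U) := finpres_cornerU rel Ufg.
Let Vfp : finpres (rmod V) := finpres_cornerV rel Vfg.
Let relA : relfg A^c := relfg_cornerA rel.
Let relB : relfg B^c := relfg_cornerB rel.

Section Sufficient.
Variables (CA : lmodType A^c -> Prop) (CB : lmodType B^c -> Prop).
Hypotheses (CAcl : DI_class CA) (CBcl : DI_class CB).

Definition kernel_class (M : lmodType Lc) : Prop :=
  exists (W : lmodType A^c) (N : lmodType B^c)
    (s : {linear N -> homr U W}) (t : {linear W -> homr V N})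
    (LA : lmodType A^c) (LB : lmodType B^c) (p : {linear LA -> W}) (q : {linear LB -> N}),
    [/\ isomorphic M (RR s t), ses p t, ses q s, CA LA & CB LB].

Lemma DI_ext_pd (R : nzRingType) (C : lmodType R -> Prop) (M N : lmodType R) :
  DI_class C -> pd_finite M -> C N -> ext1z M N.
Proof.
move=> Ccl Md CN; apply: (pd_ext1z (S := C) (T := @injmod R)) => //.
  by move=> Y /Ccl[[Y' [CY' lk]] _ _]; exists Y'.
by move=> Z Q i _ _; apply: ext1z_inj.
Qed.

Section Member.
Variables (W : lmodType A^c) (N : lmodType B^c).
Variables (s : {linear N -> homr U W}) (t : {linear W -> homr V N}).
Variables (LA : lmodType A^c) (LB : lmodType B^c).
Variables (p : {linear LA -> W}) (q : {linear LB -> N}).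
Hypotheses (pt : ses p t) (qs : ses q s) (CLA : CA LA) (CLB : CB LB).

Lemma kernel_class_left : exists M', kernel_class M' /\ linked (@injmod Lc) M' (RR s t).
Proof.
have [[LA' [CLA' [I [i [pi [II ipi]]]]]] _ _] := CAcl CLA.
have [[LB' [CLB' [J [j [rho [JI jrho]]]]]] _ _] := CBcl CLB.
have [psi1 [psi1S psi1p psi1t]] := rhalf_cover VU0 pt qs ipi jrho
  (DI_ext_homr CAcl CLA relA Vfp fdV (injmod_FP_injective JI)) (DI_ext_pd CBcl pdV CLB').
have [psi2 [psi2S psi2q psi2s]] := rhalf_cover UV0 qs pt jrho ipi
  (DI_ext_homr CBcl CLB relB Ufp fdU (injmod_FP_injective II)) (DI_ext_pd CAcl pdU CLA').
have ct z : t (psi1 z) = hmap V psi2 (Ht V U I J z).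
  case: z => x h; rewrite psi1t; apply: homr_ext => v; symmetry; exact: psi2q.
have cs z : s (psi2 z) = hmap U psi1 (Ht U V J I z).
  case: z => x h; rewrite psi2s; apply: homr_ext => v; symmetry; exact: psi1p.
have [psi psiE] := RR_mk UV0 VU0 ct cs.
have psiS : surj psi.
  by move=> [w n]; have [x <-] := psi1S w; have [y <-] := psi2S n; exists (x, y); apply: psiE.
have [W' [N' [s' [t' iso']]]] := quadR UV0 VU0 (mker psi).
have [k kpsi] := ses_iso_sub (iso_sym iso') (ses_kin psiS).
have [k1 [k2 [kE kt ks]]] := RR_comp k.
have [s1 s2] := (RR_ses kE psiE).1 kpsi.
have [p' pt'] := rhalf_cover_ker VU0 pt ipi s1 s2 psi1p ct kt.
have [q' qs'] := rhalf_cover_ker UV0 qs jrho s2 s1 psi2q cs ks.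
exists (mker psi); split; first by exists W', N', s', t', LA', LB', p', q'.
exists (HR I J), (kin psi), psi; split; first exact: HR_injective.
exact: ses_kin.
Qed.

Lemma kernel_class_right : exists M', kernel_class M' /\ linked (@injmod Lc) (RR s t) M'.
Proof.
have [_ [LA' [CLA' [I [i [pi [II ipi]]]]]] _] := CAcl CLA.
have [_ [LB' [CLB' [J [j [rho [JI jrho]]]]]] _] := CBcl CLB.
have [pI _ _] := pt; have [qI _ _] := qs.
have [a aE] := II _ _ p i pI; have [b bE] := JI _ _ q j qI.
have [phi phiE] := HR_map UV0 VU0 s t a b.
have [phi1 [phi2 [phi12 _ _]]] := RR_comp phi.
have phi1E w : phi1 w = (a w, hmap V b (t w)).
  by rewrite -[LHS]/((phi1 w, phi2 0).1) -phi12 phiE.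
have phi2E n : phi2 n = (b n, hmap U a (s n)).
  by rewrite -[LHS]/((phi1 0, phi2 n).2) -phi12 phiE.
have phi1I := rhalf_embed_inj VU0 pt qs ipi jrho aE bE phi1E.
have phi2I := rhalf_embed_inj UV0 qs pt jrho ipi bE aE phi2E.
have phiI : injective phi.
  move=> [w n] [w' n']; rewrite !phi12 => e.
  by rewrite (phi1I _ _ (congr1 fst e)) (phi2I _ _ (congr1 snd e)).
have [W' [N' [s' [t' iso']]]] := quadR UV0 VU0 (mcoker phi).
have [c phic] := ses_iso_quo iso' (ses_cpi phiI).
have [c1 [c2 [cE ct cs]]] := RR_comp c.
have [s1 s2] := (RR_ses phi12 cE).1 phic.
have VLB := DI_ext_pd CBcl pdV CLB; have ULA := DI_ext_pd CAcl pdU CLA.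
have [p' [p'E p'I p't]] := rhalf_embed_coker VU0 pt qs ipi jrho aE bE phi1E s1 ct.
have [q' [q'E q'I q's]] := rhalf_embed_coker UV0 qs pt jrho ipi bE aE phi2E s2 cs.
have p'ex := rhalf_embed_exact pt jrho VLB bE phi1E s1 ct p'E q'E q'I.
have q'ex := rhalf_embed_exact qs ipi ULA aE phi2E s2 cs q'E p'E p'I.
have t'S := rhalf_embed_surj VU0 jrho VLB ct q'E q'I q'ex.
have s'S := rhalf_embed_surj UV0 ipi ULA cs p'E p'I p'ex.
exists (mcoker phi); split.
  exists W', N', s', t', LA', LB', p', q'; split=> //.
  - by split=> // x; split=> [/p'ex//|[z <-]].
  - by split=> // x; split=> [/q'ex//|[z <-]].
exists (HR I J), phi, (cpi phi); split; first exact: HR_injective.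
exact: ses_cpi.
Qed.

(** An FP-injective module is an extension of the trivial module on the images
    homr V N and homr U W of its structure maps by the one on their kernels. *)
Lemma kernel_class_ext E : FP_injective E -> ext1z E (RR s t).
Proof.
move=> EF; have [WE [NE [sE [tE isoE]]]] := quadR UV0 VU0 E.
have EF' : FP_injective (RR sE tE).
  apply/FP_injectiveP => M Mf; apply: ext1z_retractr (iso_retract (iso_sym isoE)) _.
  by move: M Mf; apply/FP_injectiveP.
have [sES tES KBF KAF] := RR_FP_injective Ufg Vfg EF'.
apply: ext1z_retractl (iso_retract isoE) _.
have [||i iE] := @RR_mk _ _ _ _ UV0 VU0 _ _ _ _ (\0 : {linear mker sE -> homr U (mker tE)})
  (\0 : {linear mker tE -> homr V (mker sE)}) sE tE (kin tE) (kin sE).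
- by move=> z; rewrite kin0; symmetry; exact: linear0.
- by move=> z; rewrite kin0; symmetry; exact: linear0.
have [||c cE] := @RR_mk _ _ _ _ UV0 VU0 _ _ _ _ sE tE
  (\0 : {linear homr U WE -> homr U (homr V NE)})
  (\0 : {linear homr V NE -> homr V (homr U WE)}) tE sE.
- by move=> z; rewrite hmap_s0.
- by move=> z; rewrite hmap_t0.
have ic : ses i c by apply/(RR_ses iE cE); split; apply: ses_kin.
have isoV : isomorphic (R := A^c) (homr V NE) (homr V (mker sE)).
  apply: iso_sym; apply: (iso_bij (f := hmap V (kin sE))); first exact/hmap_inj/kin_inj.
  exact: (hmap_ker_surj VU0 (@kin_inj _ _ _ sE) (fun n => (kinP sE n).1)).
have isoU : isomorphic (R := B^c) (homr U WE) (homr U (mker tE)).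
  apply: iso_sym; apply: (iso_bij (f := hmap U (kin tE))); first exact/hmap_inj/kin_inj.
  exact: (hmap_ker_surj UV0 (@kin_inj _ _ _ tE) (fun n => (kinP tE n).1)).
apply: (ext1z_extl ic); apply: (ZR_ext pt qs).
- by have [_ _ h] := CAcl CLA; apply: h.
- by have [_ _ h] := CBcl CLB; apply: h.
- exact: ext1z_retractl (iso_retract isoV) (DI_ext_homr CAcl CLA relA Vfp fdV KBF).
- exact: ext1z_retractl (iso_retract isoU) (DI_ext_homr CBcl CLB relB Ufp fdU KAF).
Qed.
End Member.

Lemma kernel_class_DI : DI_class kernel_class.
Proof.
move=> M [W [N [s [t [LA [LB [p [q [isoM pt qs CLA CLB]]]]]]]]]; split.
- have [M' [CM' lk]] := kernel_class_left pt qs CLA CLB; exists M'; split=> //.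
  exact: linked_isor (iso_sym isoM) lk.
- have [M' [CM' lk]] := kernel_class_right pt qs CLA CLB; exists M'; split=> //.
  exact: linked_isol isoM lk.
- move=> E EF; apply: ext1z_retractr (iso_retract isoM) _.
  exact: kernel_class_ext pt qs CLA CLB E EF.
Qed.
End Sufficient.

Lemma DI_of_kernels (W : lmodType A^c) (N : lmodType B^c)
    (s : {linear N -> homr U W}) (t : {linear W -> homr V N}) :
  surj s -> surj t -> DI (mker s) -> DI (mker t) -> DI (RR s t).
Proof.
move=> sS tS /DI_class_of[CB [CBcl _ Cs]] /DI_class_of[CA [CAcl _ Ct]].
apply: (DI_of_class (kernel_class_DI CAcl CBcl)).
exists W, N, s, t, (mker t), (mker s), (kin t), (kin s).
by split=> //; [apply: iso_refl|apply: ses_kin|apply: ses_kin].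
Qed.
End MoritaDISufficient.

Section MoritaDINecessary.
Variables (A B : nzRingType) (V : bimod A B) (U : bimod B A).
Variables (UV0 : tens_zero (rmod U) V) (VU0 : tens_zero (rmod V) U).
Local Notation Lc := ((Lambda00 V U)^c).
Local Notation RR s t := (RRm UV0 VU0 s t).
Local Notation ZR K J := (ZR UV0 VU0 K J).
Local Notation HR K J := (HR UV0 VU0 K J).
Hypothesis rel : relfg Lc.
Hypotheses (Ufg : fingen (rmod U)) (Vfg : fingen (rmod V)).
Hypothesis ExtU : forall (j : nat) (E2 : lmodType B^c), (1 <= j)%N -> FP_injective E2 ->
  Ext_zero j (rmod U) (homr V E2).
Hypothesis ExtV : forall (j : nat) (E1 : lmodType A^c), (1 <= j)%N -> FP_injective E1 ->
  Ext_zero j (rmod V) (homr U E1).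
Hypotheses (fdU : fd_finite U) (fdV : fd_finite V).
Hypotheses (pdU : pd_finite (rmod U)) (pdV : pd_finite (rmod V)).
Let Ufp : finpres (rmod U) := finpres_cornerU rel Ufg.
Let Vfp : finpres (rmod V) := finpres_cornerV rel Vfg.
Let relA : relfg A^c := relfg_cornerA rel.
Let relB : relfg B^c := relfg_cornerB rel.
Variable D : lmodType Lc -> Prop.
Hypothesis Dcl : DI_class D.
Hypothesis Diso : iso_closed D.

Implicit Types (W WI : lmodType A^c) (N NI : lmodType B^c).

Lemma DI_syzygy_quad W N (s : {linear N -> homr U W}) (t : {linear W -> homr V N}) :
  D (RR s t) -> exists WI NI (sI : {linear NI -> homr U WI}) (tI : {linear WI -> homr V NI})
    W' N' (s' : {linear N' -> homr U W'}) (t' : {linear W' -> homr V N'})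
    (i1 : {linear W' -> WI}) (i2 : {linear N' -> NI})
    (p1 : {linear WI -> W}) (p2 : {linear NI -> N}),
  [/\ injmod (RR sI tI), D (RR s' t'), ses i1 p1 /\ ses i2 p2,
      (forall w, tI (i1 w) = hmap V i2 (t' w)) /\ (forall n, sI (i2 n) = hmap U i1 (s' n)) &
      (forall w, t (p1 w) = hmap V p2 (tI w)) /\ (forall n, s (p2 n) = hmap U p1 (sI n))].
Proof.
move=> /Dcl[[M' [DM' [I [i [p [II ip]]]]]] _ _].
have [WI [NI [sI [tI isoI]]]] := quadR UV0 VU0 I.
have [W' [N' [s' [t' iso']]]] := quadR UV0 VU0 M'.
have [_ [_ [i1 [i2 [p1 [p2 [[_ ss] _ _ ci cp]]]]]]] := quadR_ses iso' isoI (iso_refl _) ip.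
exists WI, NI, sI, tI, W', N', s', t', i1, i2, p1, p2; split=> //.
  exact: injmod_retract (iso_retract (iso_sym isoI)) II.
exact: Diso iso' DM'.
Qed.

Lemma DI_cosyzygy_quad W N (s : {linear N -> homr U W}) (t : {linear W -> homr V N}) :
  D (RR s t) -> exists WI NI (sI : {linear NI -> homr U WI}) (tI : {linear WI -> homr V NI})
    W' N' (s' : {linear N' -> homr U W'}) (t' : {linear W' -> homr V N'})
    (i1 : {linear W -> WI}) (i2 : {linear N -> NI})
    (p1 : {linear WI -> W'}) (p2 : {linear NI -> N'}),
  [/\ injmod (RR sI tI), D (RR s' t'), ses i1 p1 /\ ses i2 p2,
      (forall w, tI (i1 w) = hmap V i2 (t w)) /\ (forall n, sI (i2 n) = hmap U i1 (s n)) &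
      (forall w, t' (p1 w) = hmap V p2 (tI w)) /\ (forall n, s' (p2 n) = hmap U p1 (sI n))].
Proof.
move=> /Dcl[_ [M' [DM' [I [i [p [II ip]]]]]] _].
have [WI [NI [sI [tI isoI]]]] := quadR UV0 VU0 I.
have [W' [N' [s' [t' iso']]]] := quadR UV0 VU0 M'.
have [_ [_ [i1 [i2 [p1 [p2 [[_ ss] _ _ ci cp]]]]]]] := quadR_ses (iso_refl _) isoI iso' ip.
exists WI, NI, sI, tI, W', N', s', t', i1, i2, p1, p2; split=> //.
  exact: injmod_retract (iso_retract (iso_sym isoI)) II.
exact: Diso iso' DM'.
Qed.

(** The second components of injective modules are summands of J + Hom(U, I), on
    which the higher Ext of V vanishes. So Ext^1(V, N) is an Ext of V with values in
    syzygies in degrees beyond its projective dimension. *)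
Lemma DI_class_ext_bimod W N (s : {linear N -> homr U W}) (t : {linear W -> homr V N}) :
  D (RR s t) -> ext1z (rmod V) N /\ ext1z (rmod U) W.
Proof.
move=> Dst; split.
- apply: (@pd_ext1z _ _
    (fun N => exists W (s : {linear N -> homr U W}) (t : {linear W -> homr V N}), D (RR s t))
    (fun N => exists W (s : {linear N -> homr U W}) (t : {linear W -> homr V N}),
      injmod (RR s t)) N pdV).
  + by exists W, s, t.
  + move=> N0 [W0 [s0 [t0
      /DI_syzygy_quad[WI [NI [sI [tI [W' [N' [s' [t' [i1 [i2 [p1 [p2 [II D' [_ s2] _ _]]]]]]]]]]]]]]]].
    exists N'; first by exists W', s', t'.
    by exists NI, i2, p2; split=> //; exists WI, sI, tI.
  + move=> Z Q i Z0 Zs [WI [sI [tI /RR_injective[[IA IB] _ _ ret]]]].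
    apply: ext1z_retractr ret _; apply: ext1z_prodr; first exact: ext1z_inj.
    apply: (Ext_zero_syzygy _ Z0 Zs) => j j1; apply: ExtV => //.
    exact: injmod_FP_injective.
- apply: (@pd_ext1z _ _
    (fun W => exists N (s : {linear N -> homr U W}) (t : {linear W -> homr V N}), D (RR s t))
    (fun W => exists N (s : {linear N -> homr U W}) (t : {linear W -> homr V N}),
      injmod (RR s t)) W pdU).
  + by exists N, s, t.
  + move=> W0 [N0 [s0 [t0
      /DI_syzygy_quad[WI [NI [sI [tI [W' [N' [s' [t' [i1 [i2 [p1 [p2 [II D' [s1 _] _ _]]]]]]]]]]]]]]]].
    exists W'; first by exists N', s', t'.
    by exists WI, i1, p1; split=> //; exists NI, sI, tI.
  + move=> Z Q i Z0 Zs [NI [sI [tI /RR_injective[[IA IB] _ ret _]]]].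
    apply: ext1z_retractr ret _; apply: ext1z_prodr; first exact: ext1z_inj.
    apply: (Ext_zero_syzygy _ Z0 Zs) => j j1; apply: ExtU => //.
    exact: injmod_FP_injective.
Qed.

Lemma DI_class_surj W N (s : {linear N -> homr U W}) (t : {linear W -> homr V N}) :
  D (RR s t) -> surj s /\ surj t.
Proof.
move=> /DI_syzygy_quad[WI [NI [sI [tI [W' [N' [s' [t' [i1 [i2 [p1 [p2 [II D' [s1 s2] _ [tp sp]]]]]]]]]]]]]].
have [_ [sIS tIS] _ _] := RR_injective II; have [VN' UW'] := DI_class_ext_bimod D'.
have [_ rV _] := hmap_ses s2 VN'; have [_ rU _] := hmap_ses s1 UW'.
split=> h.
- have [h1 <-] := rU h; have [n <-] := sIS h1; exists (p2 n); exact: sp.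
- have [h1 <-] := rV h; have [w <-] := tIS h1; exists (p1 w); exact: tp.
Qed.

(** Coinducing injective coresolutions of the Hom modules shows that the module
    with zero structure maps on an FP-injective pair has finite FP-injective
    dimension. *)
Lemma DI_class_ext_ZR M (E1 : lmodType A^c) (E2 : lmodType B^c) : D M ->
  FP_injective E1 -> FP_injective E2 -> ext1z (ZR E1 E2) M.
Proof.
move=> DM E1F E2F.
have [K K0 Ks] := injective_cosyzseq (R := A^c) (homr V E2).
have [J J0 Js] := injective_cosyzseq (R := B^c) (homr U E1).
have KU i : ext1z (rmod U) (K i).
  by apply: Ext_zero_cosyzygy => // j j1; rewrite K0; apply: ExtU.
have JV i : ext1z (rmod V) (J i).
  by apply: Ext_zero_cosyzygy => // j j1; rewrite J0; apply: ExtV.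
have [n1 n1P] := homr_FP_cosyzygy relA Vfp fdV.
have [n2 n2P] := homr_FP_cosyzygy relB Ufp fdU.
pose n := maxn n1 n2.
have Kn : FP_injective (K n) by apply: (n1P E2 _ n E2F K0 Ks); exact: leq_maxl.
have Jn : FP_injective (J n) by apply: (n2P E1 _ n E1F J0 Js); exact: leq_maxr.
have ext0 M0 : D M0 -> ext1z (HR (K 0) (J 0)) M0.
  apply: (@ext1z_cosyzygy_dim _ D (@FP_injective Lc) (fun i => HR (K i) (J i)) n).
  - by move=> Y /Dcl[_ [Y' [DY' lk]] _]; exists Y'.
  - move=> i; have [P [a [b [PI ab]]]] := Ks i; have [Q [c [d [QI cd]]]] := Js i.
    have [u [v uv]] := HR_ses UV0 VU0 ab cd (JV i) (KU i).
    exists (HR P Q), u, v; split=> //.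
    by apply: injmod_FP_injective; apply: HR_injective.
  - by move=> Q Y QF /Dcl[_ _ h]; apply: h.
  - exact: HR_FP_injective.
have [_ [M' [DM' [I [i [p [II ip]]]]]] extM] := Dcl DM.
have [u [v uv]] := ZR_HR_ses UV0 VU0 E1 E2.
apply: (ext1z_unshift uv ip II); first by apply: extM; apply: HR_FP_injective.
have := ext0 _ DM'; rewrite K0 J0.
exact: ext1z_retractl (iso_retract (ZR_HR_iso UV0 VU0 E1 E2)).
Qed.

Definition kernels_t (K : lmodType A^c) : Prop := exists W N
  (s : {linear N -> homr U W}) (t : {linear W -> homr V N}),
  D (RR s t) /\ isomorphic K (mker t).
Definition kernels_s (K : lmodType B^c) : Prop := exists W N
  (s : {linear N -> homr U W}) (t : {linear W -> homr V N}),
  D (RR s t) /\ isomorphic K (mker s).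

Lemma kernels_t_DI : DI_class kernels_t.
Proof.
move=> K [W [N [s [t [Dst isoK]]]]]; have [sS tS] := DI_class_surj Dst; split.
- have [WI [NI [sI [tI [W' [N' [s' [t' [i1 [i2 [p1 [p2 [II D' [s1 s2] [ti _] [tp _]]]]]]]]]]]]]] :=
    DI_syzygy_quad Dst.
  have [[IA _] _ _ _] := RR_injective II; have [_ t'S] := DI_class_surj D'.
  have [j [r [jr _ _]]] := rhalf_ker_ses s1 s2 t'S ti tp.
  exists (mker t'); split; first by exists W', N', s', t'; split=> //; apply: iso_refl.
  by apply: linked_isor (iso_sym isoK) _; exists (mker tI), j, r.
- have [WI [NI [sI [tI [W' [N' [s' [t' [i1 [i2 [p1 [p2 [II D' [s1 s2] [ti _] [tp _]]]]]]]]]]]]]] :=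
    DI_cosyzygy_quad Dst.
  have [[IA _] _ _ _] := RR_injective II.
  have [j [r [jr _ _]]] := rhalf_ker_ses s1 s2 tS ti tp.
  exists (mker t'); split; first by exists W', N', s', t'; split=> //; apply: iso_refl.
  by apply: linked_isol isoK _; exists (mker tI), j, r.
- move=> E EF; apply: ext1z_retractr (iso_retract isoK) _.
  have E0 : FP_injective ('rV[B^c]_0 : lmodType B^c).
    by apply: injmod_FP_injective => M M' i h _; exists \0 => x; apply/matrixP => j [].
  by have [] := ZR_ext_ker (DI_class_ext_ZR Dst EF E0).
Qed.

Lemma kernels_s_DI : DI_class kernels_s.
Proof.
move=> K [W [N [s [t [Dst isoK]]]]]; have [sS tS] := DI_class_surj Dst; split.
- have [WI [NI [sI [tI [W' [N' [s' [t' [i1 [i2 [p1 [p2 [II D' [s1 s2] [_ si] [_ sp]]]]]]]]]]]]]] :=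
    DI_syzygy_quad Dst.
  have [[_ IB] _ _ _] := RR_injective II; have [s'S _] := DI_class_surj D'.
  have [j [r [jr _ _]]] := rhalf_ker_ses s2 s1 s'S si sp.
  exists (mker s'); split; first by exists W', N', s', t'; split=> //; apply: iso_refl.
  by apply: linked_isor (iso_sym isoK) _; exists (mker sI), j, r.
- have [WI [NI [sI [tI [W' [N' [s' [t' [i1 [i2 [p1 [p2 [II D' [s1 s2] [_ si] [_ sp]]]]]]]]]]]]]] :=
    DI_cosyzygy_quad Dst.
  have [[_ IB] _ _ _] := RR_injective II.
  have [j [r [jr _ _]]] := rhalf_ker_ses s2 s1 sS si sp.
  exists (mker s'); split; first by exists W', N', s', t'; split=> //; apply: iso_refl.
  by apply: linked_isol isoK _; exists (mker sI), j, r.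
- move=> E EF; apply: ext1z_retractr (iso_retract isoK) _.
  have E0 : FP_injective ('rV[A^c]_0 : lmodType A^c).
    by apply: injmod_FP_injective => M M' i h _; exists \0 => x; apply/matrixP => j [].
  by have [] := ZR_ext_ker (DI_class_ext_ZR Dst E0 EF).
Qed.
End MoritaDINecessary.

Section MoritaDI.
Variables (A B : nzRingType) (V : bimod A B) (U : bimod B A).
Variables (UV0 : tens_zero (rmod U) V) (VU0 : tens_zero (rmod V) U).
Local Notation RR s t := (RRm UV0 VU0 s t).

Lemma DI_morita (W : lmodType A^c) (N : lmodType B^c)
    (s : {linear N -> homr U W}) (t : {linear W -> homr V N}) :
  right_coherent (Lambda00 V U) -> fingen (rmod U) -> fingen (rmod V) ->
  (forall (j : nat) (E2 : lmodType B^c), (1 <= j)%N -> FP_injective E2 ->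
      Ext_zero j (rmod U) (homr V E2)) ->
  (forall (j : nat) (E1 : lmodType A^c), (1 <= j)%N -> FP_injective E1 ->
      Ext_zero j (rmod V) (homr U E1)) ->
  fd_finite U -> fd_finite V -> pd_finite (rmod U) -> pd_finite (rmod V) ->
  DI (RR s t) <-> [/\ surj s, surj t, DI (mker s) & DI (mker t)].
Proof.
move=> /coherent_relfg rel Ufg Vfg ExtU ExtV fdU fdV pdU pdV.
split=> [/DI_class_of[D [Dcl Diso Dst]]|[sS tS]]; last exact: DI_of_kernels.
have [sS tS] := DI_class_surj ExtU ExtV pdU pdV Dcl Diso Dst.
split=> //.
- apply: (DI_of_class (kernels_s_DI rel Ufg Vfg ExtU ExtV fdU fdV pdU pdV Dcl Diso)).
  by exists W, N, s, t; split=> //; apply: iso_refl.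
- apply: (DI_of_class (kernels_t_DI rel Ufg Vfg ExtU ExtV fdU fdV pdU pdV Dcl Diso)).
  by exists W, N, s, t; split=> //; apply: iso_refl.
Qed.
End MoritaDI.

Theorem corollary4p3 (A B : nzRingType) (V : bimod A B) (U : bimod B A)
    (UV0 : tens_zero (rmod U) V) (VU0 : tens_zero (rmod V) U)
    (X : lmodType A) (Y : lmodType B)
    (f : {linear tens (rmod U) X -> Y}) (g : {linear tens (rmod V) Y -> X})
    (W : lmodType A^c) (N : lmodType B^c)
    (s : {linear N -> homr U W}) (t : {linear W -> homr V N}) :
  ((forall (j : nat) (F1 : lmodType A), (1 <= j)%N -> flat F1 ->
      Tor_zero j (rmod V) (tens (rmod U) F1)) ->
   (forall (j : nat) (F2 : lmodType B), (1 <= j)%N -> flat F2 ->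
      Tor_zero j (rmod U) (tens (rmod V) F2)) ->
   fd_finite U -> rfd_finite (rmod U) -> fd_finite V -> rfd_finite (rmod V) ->
   (DP (LambdaL UV0 VU0 f g : lmodType (Lambda00 V U)) <->
    [/\ injective f, injective g, DP (mcoker f) & DP (mcoker g)]))
  /\
  (right_coherent (Lambda00 V U) -> fingen (rmod U) -> fingen (rmod V) ->
   (forall (j : nat) (E2 : lmodType B^c), (1 <= j)%N -> FP_injective E2 ->
      Ext_zero j (rmod U) (homr V E2)) ->
   (forall (j : nat) (E1 : lmodType A^c), (1 <= j)%N -> FP_injective E1 ->
      Ext_zero j (rmod V) (homr U E1)) ->
   fd_finite U -> fd_finite V -> pd_finite (rmod U) -> pd_finite (rmod V) ->
   (DI (LambdaR UV0 VU0 s t : lmodType (Lambda00 V U)^c) <->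
    [/\ surj s, surj t, DI (mker s) & DI (mker t)])).
Proof.
split=> [TorV TorU fdU rfdU fdV rfdV|coh Ufg Vfg ExtU ExtV fdU fdV pdU pdV].
  exact: DP_morita.
exact: DI_morita.
Qed.
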